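(* Let $N\ge 1$, $p,q>0$, let $L_{\mathcal A}u=\operatorname{div}\mathcal A(x,u,\nabla u)$ be a weakly $m$-coercive operator, let $K$ be a kernel satisfying the standing assumptions in the context with exponent $\beta$, and let $u_0\in L^1_{\rm loc}(\mathbb R^N)$, $u_0\ge 0$. Assume $$0<\beta<\frac m2\qquad\text{and}\qquad p+q>2\max\{1,m-1\},$$ and let $d>0$ be such that $$2<\Gamma(d):=\max\Big\{\frac{p+q+d}{d+1},\ \frac{p+q+d}{d+m-1}\Big\}<\frac{2N+m}{N+\beta}.$$ Then the problem $$\begin{cases} u_t+L_{\mathcal A}u\ge (K\ast u^p)u^q & \text{in } \mathbb R^N\times(0,\infty),\\ u(x,0)=u_0(x)\ge 0 & \text{in }\mathbb R^N\end{cases}$$ does not have nonnegative nontrivial (weak) solutions $u$ in the class $$\mathcal S\cap\Big\{(K\ast u^p)u^{q+d}\in L^1_{\rm loc}(\mathbb R^N\times[0,\infty))\Big\}.$$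
   Context: Operator: $\mathcal A:\mathbb R^N\times\mathbb R\times\mathbb R^N\to\mathbb R^N$ is a Carathéodory function with $\mathcal A(x,z,0)=0$ and $\mathcal A(x,z,\xi)\cdot\xi\ge 0$ for all $(x,z,\xi)\in\mathbb R^N\times[0,\infty)\times\mathbb R^N$. $L_{\mathcal A}$ is weakly $m$-coercive: there are a constant $c_0>0$ and an exponent $m>1$ such that $\mathcal A(x,z,\xi)\cdot\xi\ge c_0|\mathcal A(x,z,\xi)|^{m'}$ for all $(x,z,\xi)\in\mathbb R^N\times[0,\infty)\times\mathbb R^N$, where $m'=m/(m-1)$. $\nabla$ and $\operatorname{div}$ are with respect to $x$. Kernel: $K\in C(\mathbb R^N\setminus\{0\})$, $K>0$, $\liminf_{x\to0}K(x)>0$, and there exist $\rho>0$, $c>0$ such that $K(x)\ge c|x|^{-\beta}$ for all $|x|>\rho$. Convolution is in space only: $(K\ast u^p)(x,t)=\int_{\mathbb R^N}K(x-y)u^p(y,t)\,dy$. Nonnegative weak solutions (class $\mathcal S$ for this problem): nonnegative functions $u\in W^{1,m}_{\rm loc}(\mathbb R^N\times(0,\infty))$, with initial datum $u(x,0)=u_0(x)$, such that (i) $\mathcal A(x,u,\nabla u)\in[L^{m'}_{\rm loc}(\mathbb R^N\times(0,\infty))]^N$; (ii) $(K\ast u^p)u^q\in L^1_{\rm loc}(\mathbb R^N\times(0,\infty))$; and for any nonnegative test function $\varphi\in C^1_c(\mathbb R^N\times\mathbb R)$, $$\int_0^\infty\!\int_{\mathbb R^N}(K\ast u^p)u^q\varphi\,dx\,dt\le\int_0^\infty\!\int_{\mathbb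 R^N}u_t\,\varphi\,dx\,dt-\int_0^\infty\!\int_{\mathbb R^N}\mathcal A(x,u,\nabla u)\cdot\nabla\varphi\,dx\,dt.$$ *)

(* Defs.v *)
From HB Require Import structures.
From mathcomp Require Import all_boot all_order all_algebra.
From mathcomp Require Import all_classical all_reals all_analysis.
From mathcomp Require Import measurable_realfun.

Set Implicit Arguments.
Unset Strict Implicit.
Unset Printing Implicit Defensive.

Import Order.TTheory GRing.Theory Num.Theory.
Import numFieldNormedType.Exports.

Local Open Scope classical_set_scope.
Local Open Scope ring_scope.

Section rV_measurable.
Variables (R : realType) (n : nat).

Let coors : 'I_n -> 'rV[R]_n -> R := fun i x => x ord0 i.

Let rV_set0 : g_sigma_preimage coors set0.
Proof. exact: sigma_algebra0. Qed.

Let rV_setC A : g_sigma_preimage coors A -> g_sigma_preimage coors (~` A).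
Proof. exact: sigma_algebraC. Qed.

Let rV_bigcup (F : _^nat) : (forall i, g_sigma_preimage coors (F i)) ->
  g_sigma_preimage coors (\bigcup_i (F i)).
Proof. exact: sigma_algebra_bigcup. Qed.

HB.instance Definition _ := @isMeasurable.Build default_measure_display
  'rV[R]_n (g_sigma_preimage coors) rV_set0 rV_setC rV_bigcup.

Lemma measurable_coord (i : 'I_n) :
  measurable_fun [set: 'rV[R]_n] (fun x => x ord0 i).
Proof.
move=> _ Y mY; rewrite setTI; apply: sub_sigma_algebra => /=.
rewrite -bigcup_seq/=; exists i => /=; first by rewrite mem_index_enum.
by exists Y => //; rewrite setTI.
Qed.

Lemma measurable_fun_rVP d (T : measurableType d) (f : T -> 'rV[R]_n) :
  (forall i, measurable_fun [set: T] (fun t => f t ord0 i)) ->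
  measurable_fun [set: T] f.
Proof.
move=> mf; suff : g_sigma_preimage (fun i => coors i \o f) `<=` measurable.
  rewrite g_sigma_preimage_comp => prefS _ A mA.
  by apply: prefS; exists A.
apply: smallest_sub; first exact: sigma_algebra_measurable.
rewrite -bigcup_seq => B [i _ [A mA <-]].
exact: mf.
Qed.

End rV_measurable.

(* The library's instance of the same fact is not found by unification on
   arbitrary sigma-finite measures. *)
Lemma product_measure_sigma_finite d1 d2 (T1 : measurableType d1)
    (T2 : measurableType d2) (R : realType)
    (m1 : {sigma_finite_measure set T1 -> \bar R})
    (m2 : {sigma_finite_measure set T2 -> \bar R}) :
  sigma_finite setT (m1 \x m2)%E.
Proof.
have /sigma_finiteP[F [TF ndF Foo]] := sigma_finiteT m1.
have /sigma_finiteP[G [TG ndG Goo]] := sigma_finiteT m2.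
exists (fun n => F n `*` G n).
  rewrite -setXTT TF TG predeqE => -[x y]; split.
    move=> [/= [n _ Fnx] [k _ Gky]]; exists (maxn n k) => //; split.
    - by move: x Fnx; exact/subsetPset/ndF/leq_maxl.
    - by move: y Gky; exact/subsetPset/ndG/leq_maxr.
  by move=> [n _ []/= ? ?]; split; exists n.
move=> k; have [? ?] := Foo k; have [? ?] := Goo k.
split; first exact: measurableX.
by rewrite product_measure1E// lte_mul_pinfty// ge0_fin_numE.
Qed.

Section lebesgue_rV.
Variable R : realType.

Definition rV_cons n (z : measurableTypeR R * 'rV[R]_n) : 'rV[R]_n.+1 :=
  row_mx (z.1)%:M z.2 : 'M[R]_(1, 1 + n).

Lemma rV_consE0 n z : @rV_cons n z ord0 ord0 = z.1.
Proof.
have -> : @ord0 n = lshift n (@ord0 0) by exact/val_inj.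
by rewrite /rV_cons (row_mxEl (z.1)%:M) mxE eqxx mulr1n.
Qed.

Lemma rV_consE n z i : @rV_cons n z ord0 (lift ord0 i) = z.2 ord0 i.
Proof.
have -> : lift ord0 i = rshift 1 i by exact/val_inj.
by rewrite /rV_cons (row_mxEr (z.1)%:M).
Qed.

Lemma measurable_rV_cons n : measurable_fun setT (@rV_cons n).
Proof.
apply: measurable_fun_rVP => i; case: (unliftP ord0 i) => [j ->|->].
  under eq_fun do rewrite rV_consE.
  apply: (measurableT_comp (@measurable_coord R n j)).
  exact: measurable_snd.
under eq_fun do rewrite rV_consE0.
exact: measurable_fst.
Qed.

Section step.
Variables (n : nat) (mu : {sigma_finite_measure set 'rV[R]_n -> \bar R}).

Definition lebesgue_rVS : set 'rV[R]_n.+1 -> \bar R :=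
  pushforward (lebesgue_measure \x mu)%E (@rV_cons n).

Let lebesgue_rVS0 : lebesgue_rVS set0 = 0%E.
Proof. by rewrite /lebesgue_rVS /pushforward preimage_set0 measure0. Qed.

Let lebesgue_rVS_ge0 A : (0 <= lebesgue_rVS A)%E.
Proof. exact: (measure_ge0 (lebesgue_measure \x mu)%E). Qed.

Let lebesgue_rVS_sigma_additive : semi_sigma_additive lebesgue_rVS.
Proof.
by apply: measure_semi_sigma_additive; exact: measurable_rV_cons.
Qed.

HB.instance Definition _ := isMeasure.Build _ _ _ lebesgue_rVS
  lebesgue_rVS0 lebesgue_rVS_ge0 lebesgue_rVS_sigma_additive.

Let sigmaT_finite : sigma_finite setT lebesgue_rVS.
Proof.
have [F TF Foo] :
    sigma_finite setT ((@lebesgue_measure R) \x mu)%E.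
  exact: product_measure_sigma_finite.
pose g (v : 'rV[R]_n.+1) : measurableTypeR R * 'rV[R]_n :=
  (v ord0 ord0, \row_i v ord0 (lift ord0 i)).
have gK z : g (rV_cons z) = z.
  case: z => a v; rewrite /g rV_consE0/=; congr pair.
  by apply/rowP => i; rewrite mxE rV_consE.
have mg : measurable_fun setT g.
  apply/measurable_fun_pairP; split.
    exact: (@measurable_coord R n.+1 ord0).
  apply: measurable_fun_rVP => i; under eq_fun do rewrite /= mxE.
  exact: measurable_coord.
exists (fun k => g @^-1` F k).
  by rewrite -preimage_bigcup -TF preimage_setT.
move=> k; have [mF Fk] := Foo k; split.
  by rewrite -[X in measurable X]setTI; exact: mg.
rewrite /lebesgue_rVS /pushforward (_ : _ @^-1` _ = F k)//.
by apply/seteqP; split => z /=; rewrite gK.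
Qed.

HB.instance Definition _ := Measure_isSigmaFinite.Build _ _ _ lebesgue_rVS
  sigmaT_finite.

End step.

Fixpoint lebesgue_rV n : {sigma_finite_measure set 'rV[R]_n -> \bar R} :=
  if n is n'.+1 then lebesgue_rVS (lebesgue_rV n') else \d_(0 : 'rV[R]_0).

Lemma lebesgue_rV_box n (A : 'I_n -> set (measurableTypeR R)) :
  (forall i, measurable (A i)) ->
  lebesgue_rV n [set x | forall i, A i (x ord0 i)] =
  (\prod_(i < n) lebesgue_measure (A i))%E.
Proof.
elim: n A => [|n IHn] A mA.
  rewrite big_ord0 /= diracE (_ : _ \in _ = true)//.
  by apply/mem_set => -[].
rewrite big_ord_recl -IHn; last by move=> i; exact: mA.
pose B : set 'rV[R]_n := [set x | forall i, A (lift ord0 i) (x ord0 i)].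
have mB : measurable B.
  have -> : B = \bigcap_(i in [set: 'I_n])
      ((fun x : 'rV[R]_n => x ord0 i) @^-1` A (lift ord0 i)).
    by apply/seteqP; split=> x /= Ax i; [move=> _|]; exact: Ax.
  apply: fin_bigcap_measurable => // i _; rewrite -[X in measurable X]setTI.
  exact: (@measurable_coord R n i measurableT _ (mA _)).
rewrite -[RHS](product_measure1E lebesgue_measure (lebesgue_rV n))//.
rewrite /= /lebesgue_rVS /pushforward; congr (product_measure1 _ _ _).
apply/seteqP; split=> -[a x] /=.
  move=> Ax; split; first by have := Ax ord0; rewrite rV_consE0.
  by move=> i; have := Ax (lift ord0 i); rewrite rV_consE.
move=> [A0 Ax] i; case: (unliftP ord0 i) => [j ->|->].
  by rewrite rV_consE; exact: Ax.
by rewrite rV_consE0.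
Qed.

End lebesgue_rV.

Section ae_measurable.
Context d (T : measurableType d) (R : realType) (mu : set T -> \bar R).

(* For the Lebesgue measures below, this is measurability with respect to the
   completed (Lebesgue) sigma-algebra. The integral \int[mu] of a function with
   this property is the integral of any of its measurable versions. *)
Definition ae_measurable d' (T' : sigmaRingType d') (D : set T)
    (f : T -> T') : Prop :=
  exists2 g : T -> T', measurable_fun D g &
    {ae mu, forall x, D x -> f x = g x}.

Definition ae_integrable (D : set T) (f : T -> \bar R) : Prop :=
  ae_measurable D f /\ (\int[mu]_(x in D) `|f x| < +oo)%E.

End ae_measurable.

Section euclidean.
Variables (R : realType) (N : nat).
Implicit Types x y : 'rV[R]_N.

Definition dot x y : R := \sum_(i < N) x ord0 i * y ord0 i.

(* The norm `|x| of the library on row vectors is the maximum norm. *)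
Definition enorm x : R := Num.sqrt (dot x x).

End euclidean.

Section spacetime.
Variables (R : realType) (N : nat).

Notation ST := ('rV[R]_N * R)%type.

Definition spacetime_measure : set ('rV[R]_N * measurableTypeR R) -> \bar R :=
  (lebesgue_rV R N \x lebesgue_measure)%E.

HB.instance Definition _ := Measure.on spacetime_measure.

HB.instance Definition _ := Measure_isSigmaFinite.Build _ _ _
  spacetime_measure
  (product_measure_sigma_finite (lebesgue_rV R N) lebesgue_measure).

Local Notation mu := spacetime_measure.

Definition open_halfspace : set ST := [set z | 0 < z.2].

Definition closed_halfspace : set ST := [set z | 0 <= z.2].

Definition L1loc (D : set ST) (f : ST -> \bar R) : Prop :=
  ae_measurable mu D f /\
  forall C : set ST, compact C -> C `<=` D ->
    (\int[mu]_(z in C) `|f z| < +oo)%E.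

Definition Lploc (r : R) (D : set ST) (f : ST -> R) : Prop :=
  ae_measurable mu D f /\
  forall C : set ST, compact C -> C `<=` D ->
    (\int[mu]_(z in C) (`|f z| `^ r)%:E < +oo)%E.

Definition L1loc_space (f : 'rV[R]_N -> R) : Prop :=
  ae_measurable (lebesgue_rV R N) setT f /\
  forall C : set 'rV[R]_N, compact C ->
    (\int[lebesgue_rV R N]_(x in C) `|f x|%:E < +oo)%E.

Definition e_space (i : 'I_N) : ST := (delta_mx ord0 i, 0).

Definition e_time : ST := (0, 1).

Definition grad (phi : ST -> R) (z : ST) : 'rV[R]_N :=
  \row_i 'D_(e_space i) phi z.

Definition C1 (phi : ST -> R) : Prop :=
  (forall z, differentiable phi z) /\
  (forall v, continuous (fun z => 'D_v phi z)).

Definition tsupport (phi : ST -> R) : set ST :=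
  closure [set z | phi z != 0].

Definition C1c (D : set ST) (phi : ST -> R) : Prop :=
  [/\ C1 phi, compact (tsupport phi) & tsupport phi `<=` D].

(* For locally integrable f and g, testing with C^1_c or with C^infinity_c
   functions is the same. *)
Definition weak_derivative (D : set ST) (v : ST) (f g : ST -> R) : Prop :=
  forall psi, C1c D psi ->
    (\int[mu]_(z in D) (f z * 'D_v psi z)%:E =
     - \int[mu]_(z in D) (g z * psi z)%:E)%E.

(* u belongs to W^{1,m}_loc(D), with weak spatial gradient Du and weak time
   derivative ut; these are unique up to a null subset of D. *)
Record W1loc (m : R) (D : set ST) (u : ST -> R) (Du : ST -> 'rV[R]_N)
    (ut : ST -> R) : Prop := {
  W1loc_fun : Lploc m D u ;
  W1loc_grad : forall i, Lploc m D (fun z => Du z ord0 i) ;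
  W1loc_time : Lploc m D ut ;
  W1loc_gradP : forall i,
    weak_derivative D (e_space i) u (fun z => Du z ord0 i) ;
  W1loc_timeP : weak_derivative D e_time u ut }.

Definition caratheodory (A : 'rV[R]_N -> R -> 'rV[R]_N -> 'rV[R]_N) : Prop :=
  (forall z xi, ae_measurable (lebesgue_rV R N) setT (fun x => A x z xi)) /\
  {ae lebesgue_rV R N, forall x,
    continuous (fun w : R * 'rV[R]_N => A x w.1 w.2)}.

Definition conjugate_exponent (m : R) : R := m / (m - 1).

Record weakly_coercive (m : R) (A : 'rV[R]_N -> R -> 'rV[R]_N -> 'rV[R]_N) :
    Prop := {
  wc_caratheodory : caratheodory A ;
  wc_zero : forall x z, 0 <= z -> A x z 0 = 0 ;
  wc_ge0 : forall x z xi, 0 <= z -> 0 <= dot (A x z xi) xi ;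
  wc_exponent : 1 < m ;
  wc_coercive : exists2 c0 : R, 0 < c0 & forall x z xi, 0 <= z ->
    c0 * enorm (A x z xi) `^ conjugate_exponent m <= dot (A x z xi) xi }.

(* The value of K at 0 is irrelevant. *)
Record admissible_kernel (beta : R) (K : 'rV[R]_N -> R) : Prop := {
  kernel_continuous : forall x : 'rV[R]_N, x != 0 -> {for x, continuous K} ;
  kernel_gt0 : forall x : 'rV[R]_N, x != 0 -> 0 < K x ;
  kernel_liminf : (0 < limf_einf (EFin \o K) (dnbhs (0%R : 'rV[R]_N)))%E ;
  kernel_decay : exists rho c : R, [/\ 0 < rho, 0 < c &
    forall x, rho < enorm x -> c * enorm x `^ (- beta) <= K x] }.

Definition convolution (K : 'rV[R]_N -> R) (p : R) (u : ST -> R) (z : ST) :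
    \bar R :=
  (\int[lebesgue_rV R N]_y (K (z.1 - y) * u (y, z.2) `^ p)%:E)%E.

(* The initial value is attained as a trace in L^1_loc: u(., t) --> u0 in
   L^1(C) as t --> 0+ (outside a null set of times), for every compact C. *)
Definition initial_value (u : ST -> R) (u0 : 'rV[R]_N -> R) : Prop :=
  forall C : set 'rV[R]_N, compact C -> forall e : R, 0 < e ->
    exists2 tau : R, 0 < tau & {ae lebesgue_measure, forall t : R,
      0 < t < tau ->
      (\int[lebesgue_rV R N]_(x in C) `|u (x, t) - u0 x|%:E <= e%:E)%E}.

Definition weak_solution (A : 'rV[R]_N -> R -> 'rV[R]_N -> 'rV[R]_N) (m : R)
    (K : 'rV[R]_N -> R) (p q : R) (u0 : 'rV[R]_N -> R) (u : ST -> R) : Prop :=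
  exists (Du : ST -> 'rV[R]_N) (ut : ST -> R),
  let D := open_halfspace in
  let flux z := A z.1 (u z) (Du z) in
  let source z := (convolution K p u z * (u z `^ q)%:E)%E in
  [/\ {ae mu, forall z, D z -> 0 <= u z},
      W1loc m D u Du ut,
      initial_value u u0,
      (forall i, Lploc (conjugate_exponent m) D (fun z => flux z ord0 i)) /\
      L1loc D source &
      (* phi need not vanish at t = 0, so that the existence of the integrals
         in the right-hand side is part of the requirement. *)
      forall phi, C1c setT phi -> (forall z, 0 <= phi z) ->
      [/\ ae_integrable mu D (fun z => (ut z * phi z)%:E),
          ae_integrable mu D (fun z => (dot (flux z) (grad phi z))%:E) &
          (\int[mu]_(z in D) (source z * (phi z)%:E) <=
           \int[mu]_(z in D) (ut z * phi z)%:E -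
           \int[mu]_(z in D) (dot (flux z) (grad phi z))%:E)%E]].

End spacetime.

Definition Gamma (R : realType) (p q m d : R) : R :=
  Num.max ((p + q + d) / (d + 1)) ((p + q + d) / (d + m - 1)).

Arguments open_halfspace {R N}.
Arguments closed_halfspace {R N}.

(* Main.v *)
Require Import Defs.
From HB Require Import structures.
From mathcomp Require Import all_boot all_order all_algebra.
From mathcomp Require Import all_classical all_reals all_analysis.
From mathcomp Require Import measurable_realfun.
From mathcomp Require Import ring lra.

Set Implicit Arguments.
Unset Strict Implicit.
Unset Printing Implicit Defensive.

Import Order.TTheory GRing.Theory Num.Theory.
Import numFieldNormedType.Exports.

Local Open Scope classical_set_scope.
Local Open Scope ring_scope.

Section translation_invariance.
Context {R : realType}.

Lemma lebesgue_measure_shift (a : R) (A : set (measurableTypeR R)) :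
  measurable A -> lebesgue_measure ((fun s : R => s + a) @^-1` A) = lebesgue_measure A.
Proof.
move=> mA.
have mshift : measurable_fun [set: measurableTypeR R]
    (fun s => s + a : measurableTypeR R).
  exact: (@measurable_funD _ _ R setT id (cst a)).
pose shift : {mfun measurableTypeR R >-> measurableTypeR R} :=
  HB.pack (fun s : measurableTypeR R => s + a : measurableTypeR R)
    (isMeasurableFun.Build _ _ _ _ _ mshift).
apply/esym/(@lebesgue_measure_unique R (pushforward lebesgue_measure shift)) => //.
move=> X [[c e]] _ <-; transitivity (lebesgue_measure (`]c - a, e - a]%classic : set (measurableTypeR R))); last first.
  congr (lebesgue_measure _).
  by apply/seteqP; split => s /=; rewrite !in_itv/= ltrBlDr lerBrDr.
rewrite !lebesgue_measure_itv/= !lte_fin ltrD2r /=.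
by case: ifP => // _; congr EFin; ring.
Qed.

Lemma ge0_integral_shift (f : R -> \bar R) (a : R) :
  measurable_fun [set: measurableTypeR R] f -> (forall s, 0 <= f s)%E ->
  (\int[lebesgue_measure]_s f (s + a)%R = \int[lebesgue_measure]_s f s)%E.
Proof.
move=> mf f0.
have mshift : measurable_fun [set: measurableTypeR R]
    (fun s => s + a : measurableTypeR R).
  exact: (@measurable_funD _ _ R setT id (cst a)).
pose shift : {mfun measurableTypeR R >-> measurableTypeR R} :=
  HB.pack (fun s : measurableTypeR R => s + a : measurableTypeR R)
    (isMeasurableFun.Build _ _ _ _ _ mshift).
transitivity (\int[pushforward lebesgue_measure shift]_s f s)%E.
  by rewrite ge0_integral_pushforward.
apply: eq_measure_integral => A mA _ /=.
by rewrite /pushforward lebesgue_measure_shift.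
Qed.

Lemma rV_consD n (s s0 : R) (x : 'rV[R]_n) (a : 'rV[R]_n.+1) :
  rV_cons (s, x) + a =
  rV_cons (s + a ord0 ord0, x + \row_i a ord0 (lift ord0 i)).
Proof.
apply/rowP => i; rewrite mxE; case: (unliftP ord0 i) => [j ->|->].
  by rewrite !rV_consE/= !mxE.
by rewrite !rV_consE0.
Qed.

Lemma measurable_rV_add d (T : measurableType d) n (f g : T -> 'rV[R]_n) :
  measurable_fun setT f -> measurable_fun setT g ->
  measurable_fun setT (fun t => f t + g t).
Proof.
move=> mf mg; apply: measurable_fun_rVP => i.
under eq_fun do rewrite mxE.
apply: measurable_funD.
  by apply: (measurableT_comp (@measurable_coord R n i)).
by apply: (measurableT_comp (@measurable_coord R n i)).
Qed.

Lemma ge0_integral_rV_shift n (f : 'rV[R]_n -> \bar R) (a : 'rV[R]_n) :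
  measurable_fun setT f -> (forall x, 0 <= f x)%E ->
  (\int[lebesgue_rV R n]_x f (x + a)%R = \int[lebesgue_rV R n]_x f x)%E.
Proof.
elim: n f a => [|n IHn] f a mf f0.
  by congr (integral _ _ _); apply/funext => x; congr f; apply/rowP => -[].
have mfa : measurable_fun setT (fun x : 'rV[R]_n.+1 => f (x + a)).
  by apply: measurableT_comp => //; apply: measurable_rV_add.
have mfc : measurable_fun setT (fun z : measurableTypeR R * 'rV[R]_n => f (rV_cons z)).
  by apply: measurableT_comp => //; exact: measurable_rV_cons.
have mfac : measurable_fun setT (fun z : measurableTypeR R * 'rV[R]_n => f (rV_cons z + a)).
  by apply: (measurableT_comp mfa); exact: measurable_rV_cons.
rewrite /= /lebesgue_rVS.
rewrite !ge0_integral_pushforward//; try exact: measurable_rV_cons.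
rewrite !preimage_setT.
rewrite [LHS](@fubini_tonelli1 _ _ _ _ R lebesgue_measure (lebesgue_rV R n)
  (fun z => f (rV_cons z + a)) mfac (fun z => f0 _)).
rewrite [RHS](@fubini_tonelli1 _ _ _ _ R lebesgue_measure (lebesgue_rV R n)
  (fun z => f (rV_cons z)) mfc (fun z => f0 _)).
rewrite /fubini_F/=.
rewrite -(@ge0_integral_shift (fun s => \int[lebesgue_rV R n]_x f (rV_cons (s, x)))%E (a ord0 ord0)); first last.
- by move=> s; exact: integral_ge0.
- by apply: (@measurable_fun_fubini_tonelli_F _ _ _ _ _ (lebesgue_rV R n) (fun z : measurableTypeR R * 'rV[R]_n => f (rV_cons z))).
apply: eq_integral => s _ /=.
under eq_integral do rewrite rV_consD//.
by apply: (IHn (fun x => f (rV_cons (s + a ord0 ord0, x)))) => //; exact: (measurableT_comp mfc).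
Qed.

Context {N : nat}.
Local Notation ST := ('rV[R]_N * measurableTypeR R)%type.
Local Notation mu := (@spacetime_measure R N).

Lemma measurable_st_add d (T : measurableType d) (f g : T -> ST) :
  measurable_fun setT f -> measurable_fun setT g ->
  measurable_fun setT (fun t => (f t + g t : 'rV[R]_N * R) : ST).
Proof.
move=> /measurable_fun_pairP[mf1 mf2] /measurable_fun_pairP[mg1 mg2].
apply/measurable_fun_pairP; split => /=.
  exact: measurable_rV_add.
exact: (@measurable_funD _ _ R setT (snd \o f) (snd \o g)).
Qed.

Lemma ge0_integral_st_shift (f : ST -> \bar R) (a : 'rV[R]_N * R) :
  measurable_fun setT f -> (forall z, 0 <= f z)%E ->
  (\int[mu]_z f (z + a)%R = \int[mu]_z f z)%E.
Proof.
move=> mf f0.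
have mfa : measurable_fun [set: ST] (fun z : ST => f (z + a)%R).
  apply: measurableT_comp => //; apply: (@measurable_st_add _ _ id (cst (a : ST))) => //.
rewrite /spacetime_measure.
rewrite [LHS](@fubini_tonelli2 _ _ _ _ R (lebesgue_rV R N) lebesgue_measure
  (fun z => f (z + a)%R) mfa (fun z => f0 _)).
rewrite [RHS](@fubini_tonelli2 _ _ _ _ R (lebesgue_rV R N) lebesgue_measure f
  mf f0).
rewrite /fubini_G/=.
rewrite -(@ge0_integral_shift (fun s => \int[lebesgue_rV R N]_x f (x, s))%E a.2); first last.
- by move=> s; exact: integral_ge0.
- exact: (@measurable_fun_fubini_tonelli_G _ _ _ _ _ (lebesgue_rV R N) f).
apply: eq_integral => s _ /=.
rewrite -(@ge0_integral_rV_shift _ (fun x => f (x, (s + a.2)%R)) a.1)//.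
exact: (measurableT_comp mf).
Qed.

End translation_invariance.

Section spacetime_boxes.
Context {R : realType} {N : nat}.
Local Notation ST := ('rV[R]_N * measurableTypeR R)%type.
Local Notation mu := (@spacetime_measure R N).

Lemma ler_norm_space (z : 'rV[R]_N * R) i : `|z.1 ord0 i| <= `|z|.
Proof.
apply: (@le_trans _ _ `|z.1|); last by rewrite [leRHS]prod_normE le_max lexx.
rewrite [leRHS]mx_normrE.
exact: (le_bigmax _ (fun ij : 'I_1 * 'I_N => `|z.1 ij.1 ij.2|) (ord0, i)).
Qed.

Lemma ler_norm_time (z : 'rV[R]_N * R) : `|z.2| <= `|z|.
Proof. by rewrite [leRHS]prod_normE le_max lexx orbT. Qed.

Lemma measurable_space_coord i :
  measurable_fun [set: ST] (fun z : ST => z.1 ord0 i : measurableTypeR R).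
Proof. exact: (measurableT_comp (@measurable_coord R N i)). Qed.

Lemma measurable_time_coord : measurable_fun [set: ST] (snd : ST -> measurableTypeR R).
Proof. exact: measurable_snd. Qed.

Definition stbox (r a b : R) : set ('rV[R]_N * R) :=
  [set z : 'rV[R]_N * R | (forall i, `|z.1 ord0 i| <= r) /\ a <= z.2 <= b].

Lemma stboxE (r a b : R) : stbox r a b =
  [set x : 'rV[R]_N | forall i, `[-r, r]%classic (x ord0 i)] `*` `[a, b]%classic.
Proof.
by apply/seteqP; split => -[x t] /= [xr tab]; split; rewrite ?in_itv//= => i;
  move: (xr i); rewrite in_itv/= ler_norml.
Qed.

Lemma measurable_rV_box (A : 'I_N -> set (measurableTypeR R)) :
  (forall i, measurable (A i)) ->
  measurable [set x : 'rV[R]_N | forall i, A i (x ord0 i)].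
Proof.
move=> mA.
have -> : [set x : 'rV[R]_N | forall i, A i (x ord0 i)] =
    \bigcap_(i in [set: 'I_N]) ((fun x : 'rV[R]_N => x ord0 i) @^-1` A i).
  by apply/seteqP; split=> x /= Ax i; [move=> _|]; exact: Ax.
apply: fin_bigcap_measurable => // i _; rewrite -[X in measurable X]setTI.
exact: (@measurable_coord R N i measurableT _ (mA _)).
Qed.

Lemma measurable_stbox r a b : measurable (stbox r a b : set ST).
Proof.
rewrite stboxE; apply: measurableX.
  by apply: (@measurable_rV_box (fun=> `[-r, r]%classic)) => i; exact: measurable_itv.
exact: measurable_itv.
Qed.

Lemma compact_stbox r a b : compact (stbox r a b).
Proof.
rewrite stboxE; apply: compact_setX.
  by apply: (@rV_compact R N (fun=> `[-r, r]%classic)) => i; exact: segment_compact.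
exact: segment_compact.
Qed.

Lemma spacetime_measure_prod (A : 'I_N -> set (measurableTypeR R))
    (B : set (measurableTypeR R)) :
  (forall i, measurable (A i)) -> measurable B ->
  mu ([set x : 'rV[R]_N | forall i, A i (x ord0 i)] `*` B) =
  (\prod_(i < N) lebesgue_measure (A i) * lebesgue_measure B)%E.
Proof.
move=> mA mB; rewrite /spacetime_measure product_measure1E//.
  by congr (_ * _)%E; exact: lebesgue_rV_box.
exact: measurable_rV_box.
Qed.

Lemma stbox_ltoo r a b : (mu (stbox r a b) < +oo)%E.
Proof.
rewrite stboxE (@spacetime_measure_prod (fun=> `[-r, r]%classic))//.
have fin c e : lebesgue_measure (`[c, e]%classic : set (measurableTypeR R)) \is a fin_num.
  by rewrite lebesgue_measure_itv/=; case: ifP.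
rewrite ltey_eq fin_numM//.
apply: (big_ind (fun x => x \is a fin_num)) => //.
by move=> x y xf yf; rewrite fin_numM.
Qed.

Lemma lebesgue_rV_hyperplane (i : 'I_N) c :
  lebesgue_rV R N [set x | x ord0 i = c] = 0%E.
Proof.
pose A (j : 'I_N) : set (measurableTypeR R) := if j == i then [set c] else setT.
transitivity (lebesgue_rV R N [set x : 'rV[R]_N | forall j, A j (x ord0 j)]).
  apply: (congr1 (lebesgue_rV R N)); apply/seteqP; split => x /=.
    by move=> xi j; rewrite /A; case: eqP => [->|].
  by move=> /(_ i); rewrite /A eqxx.
transitivity (\prod_(i < N) lebesgue_measure (A i))%E.
  by apply: lebesgue_rV_box => j; rewrite /A; case: ifP.
by rewrite (bigD1 i)//= /A eqxx lebesgue_measure_set1 mul0e.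
Qed.

Lemma spacetime_null_space (A : set 'rV[R]_N) : measurable A ->
  lebesgue_rV R N A = 0%E -> mu (A `*` setT) = 0%E.
Proof.
move=> mA A0.
transitivity (lebesgue_rV R N A * (lebesgue_measure [set: measurableTypeR R]))%E.
  exact: product_measure1E.
by rewrite A0 mul0e.
Qed.

Lemma spacetime_null_time (B : set (measurableTypeR R)) : measurable B ->
  lebesgue_measure B = 0%E -> mu (setT `*` B) = 0%E.
Proof.
move=> mB B0.
transitivity (lebesgue_rV R N setT * lebesgue_measure B)%E.
  exact: product_measure1E.
by rewrite B0 mule0.
Qed.

(** The sigma-algebra of space-time is generated by the half-spaces. *)
Lemma measurable_spacetime_ind (P : set ST -> Prop) :
  P set0 -> (forall E, measurable E -> P E -> P (~` E)) ->
  (forall F : (set ST)^nat, (forall k, measurable (F k)) -> (forall k, P (F k)) ->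
    P (\bigcup_k F k)) ->
  (forall i c, P [set z : ST | (z.1 : 'rV[R]_N) ord0 i < c]) ->
  (forall c, P [set z : ST | (z.2 : R) < c]) ->
  forall E, measurable E -> P E.
Proof.
move=> P0 PC PU Psp Pti.
pose G := [set E : set ST | measurable E /\ P E].
have sG : sigma_algebra setT G.
  split.
  - by split.
  - by move=> E [mE PE]; rewrite setTD; split; [exact: measurableC|exact: PC].
  - move=> F mF; split; first by apply: bigcup_measurable => k _; have [] := mF k.
    by apply: PU => k; have [] := mF k.
have Gpre (h : ST -> measurableTypeR R) : measurable_fun setT h ->
    (forall c, P [set z | (h z : R) < c]) -> forall A, measurable A -> G (h @^-1` A).
  move=> mh Ph.
  pose H := [set A : set (measurableTypeR R) | G (h @^-1` A)].
  have sH : sigma_algebra setT H.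
    split.
    - by rewrite /H/= preimage_set0; split.
    - move=> A; rewrite /H/= setTD preimage_setC => -[mA PA].
      by split; [exact: measurableC|exact: PC].
    - move=> F HF; rewrite /H/= preimage_bigcup.
      split; first by apply: bigcup_measurable => k _; have [] := HF k.
      by apply: PU => k; have [] := HF k.
  move=> A; rewrite RGenInftyO.measurableE => mA.
  apply: (smallest_sub sH _ mA) => _ [c ->]; rewrite /H/=.
  have -> : h @^-1` `]-oo, c[ = [set z | (h z : R) < c].
    by apply/seteqP; split => z /=; rewrite in_itv.
  split => //.
  rewrite -[X in measurable X]setTI (_ : [set z | _] = h @^-1` `]-oo, c[).
    by apply: mh => //; exact: measurable_itv.
  by apply/seteqP; split => z /=; rewrite in_itv.
suff mG : (measurable : set (set ST)) `<=` G by move=> E /mG[].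
apply: smallest_sub => //; rewrite subUset; split.
- move=> _ [A mA <-]; rewrite setTI.
  pose H := [set A : set 'rV[R]_N | G (fst @^-1` A)].
  have sH : sigma_algebra setT H.
    split.
    - by rewrite /H/= preimage_set0; split.
    - move=> B; rewrite /H/= setTD preimage_setC => -[mB PB].
      by split; [exact: measurableC|exact: PC].
    - move=> F HF; rewrite /H/= preimage_bigcup.
      split; first by apply: bigcup_measurable => k _; have [] := HF k.
      by apply: PU => k; have [] := HF k.
  apply: (smallest_sub sH _ mA); rewrite -bigcup_seq => B [i _ [Y mY <-]].
  rewrite /H/= setTI.
  exact: (Gpre (fun z => z.1 ord0 i) (@measurable_space_coord i) (Psp i) Y mY).
- move=> _ [A mA <-]; rewrite setTI.
  exact: (Gpre snd measurable_time_coord Pti A mA).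
Qed.

End spacetime_boxes.

Section continuity_of_translations.
Context {R : realType} {N : nat}.
Local Notation ST := ('rV[R]_N * measurableTypeR R)%type.
Local Notation mu := (@spacetime_measure R N).
Implicit Types (T : 'rV[R]_N * R -> \bar R).

Definition vanishes_at0 T := forall e : R, 0 < e ->
  exists2 dl : R, 0 < dl & forall y, `|y| < dl -> (T y <= e%:E)%E.

Lemma vanishes_le T T' (r : R) : 0 < r ->
  (forall y, `|y| < r -> (T' y <= T y)%E) -> vanishes_at0 T -> vanishes_at0 T'.
Proof.
move=> r0 T'T vT e e0; have [dl dl0 Tdl] := vT e e0.
exists (Num.min r dl); first by rewrite lt_min r0.
move=> y; rewrite lt_min => /andP[yr ydl].
by rewrite (le_trans (T'T y yr))// Tdl.
Qed.

Lemma vanishesD T T' : vanishes_at0 T -> vanishes_at0 T' ->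
  vanishes_at0 (fun y => T y + T' y)%E.
Proof.
move=> vT vT' e e0; have e20 : 0 < e / 2 by rewrite divr_gt0.
have [a a0 Ta] := vT _ e20; have [b b0 T'b] := vT' _ e20.
exists (Num.min a b); first by rewrite lt_min a0.
move=> y; rewrite lt_min => /andP[ya yb].
by rewrite [e]splitr EFinD leeD// ?Ta ?T'b.
Qed.

Lemma vanishes0 : vanishes_at0 (cst 0%E).
Proof. by move=> e e0; exists 1 => // y _; rewrite lee_fin ltW. Qed.

Lemma vanishesZ (c : R) T : 0 <= c -> (forall y, 0 <= T y)%E -> vanishes_at0 T ->
  vanishes_at0 (fun y => c%:E * T y)%E.
Proof.
move=> c0 T0 vT e e0.
have c10 : 0 < c + 1 by rewrite ltr_wpDl.
have [dl dl0 Tdl] := vT (e / (c + 1)) (divr_gt0 e0 c10).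
exists dl => // y /Tdl Ty.
apply: (@le_trans _ _ (c%:E * (e / (c + 1))%:E)%E).
  by apply: lee_wpmul2l; rewrite ?lee_fin.
rewrite -EFinM lee_fin.
by rewrite mulrA ler_pdivrMr// mulrC ler_wpM2l ?ltW// ltrDl.
Qed.

Lemma vanishes_sum n (T : nat -> 'rV[R]_N * R -> \bar R) :
  (forall j, vanishes_at0 (T j)) ->
  vanishes_at0 (fun y => \sum_(j < n) T j y)%E.
Proof.
move=> vT; elim: n => [|n IHn].
  by move=> e e0; exists 1 => // y _; rewrite big_ord0 lee_fin ltW.
apply: (@vanishes_le (fun y => \sum_(j < n) T j y + T n y)%E _ 1) => //.
  by move=> y _; rewrite big_ord_recr.
exact: vanishesD.
Qed.

Definition bigbox (k : nat) : set ('rV[R]_N * R) := stbox k%:R (- k%:R) k%:R.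

Lemma bigbox_le k l : (k <= l)%N -> bigbox k `<=` bigbox l.
Proof.
move=> kl z [zk /andP[kz zk']]; have kl' : k%:R <= l%:R :> R by rewrite ler_nat.
split; first by move=> i; rewrite (le_trans (zk i)).
by rewrite (le_trans _ kz) ?lerN2//= (le_trans zk').
Qed.

Lemma bigcup_bigbox : \bigcup_k bigbox k = setT.
Proof.
apply/seteqP; split => // z _; exists (Num.truncn `|z|).+1 => //.
have zk : `|z| <= (Num.truncn `|z|).+1%:R by rewrite ltW// truncnS_gt.
split; first by move=> i; rewrite (le_trans (ler_norm_space z i)).
by rewrite -ler_norml (le_trans (ler_norm_time z)).
Qed.

Lemma measurable_bigbox k : measurable (bigbox k : set ST).
Proof. exact: measurable_stbox. Qed.

Definition shift_preimage (E : set ST) (y : 'rV[R]_N * R) : set ST :=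
  [set z : ST | E ((z : 'rV[R]_N * R) + y)].

Lemma measurable_shift (y : 'rV[R]_N * R) :
  measurable_fun [set: ST] (fun z : ST => ((z : 'rV[R]_N * R) + y) : ST).
Proof. exact: (@measurable_st_add R N _ _ id (cst (y : ST))). Qed.

Lemma measurable_shift_preimage E y : measurable E ->
  measurable (shift_preimage E y).
Proof.
by move=> mE; rewrite -[X in measurable X]setTI; exact: (measurable_shift y).
Qed.

Lemma spacetime_measure_shift E y : measurable E ->
  mu (shift_preimage E y) = mu E.
Proof.
move=> mE; have mEy := measurable_shift_preimage y mE.
transitivity (\int[mu]_z (\1_(shift_preimage E y) z)%:E)%E.
  by rewrite integral_indic// setIT.
transitivity (\int[mu]_z (\1_E z)%:E)%E; last by rewrite integral_indic// setIT.
apply: etrans (@ge0_integral_st_shift R N (fun z => (\1_E z)%:E) y _ _).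
- by [].
- exact/measurable_EFinP.
- by move=> z; rewrite lee_fin.
Qed.

Definition shift_diff (E : set ST) y : set ST :=
  (shift_preimage E y `\` E) `|` (E `\` shift_preimage E y).

Lemma measurable_shift_diff E y : measurable E -> measurable (shift_diff E y).
Proof.
move=> mE; have mEy := measurable_shift_preimage y mE.
by apply: measurableU; exact: measurableD.
Qed.

Lemma shift_diffC E y : shift_diff (~` E) y = shift_diff E y.
Proof.
apply/seteqP; split => z /= [[a b]|[a b]].
- by right; split => //; exact: contrapT.
- by left; split => //; exact: contrapT.
- by right; split => //; apply.
- by left; split => //; apply.
Qed.

Lemma shift_diffU E F y : shift_diff (E `|` F) y `<=` shift_diff E y `|` shift_diff F y.
Proof.
move=> z /= [[[a|a] b]|[[a|a] b]].
- by left; left; split => // ?; apply: b; left.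
- by right; left; split => // ?; apply: b; right.
- by left; right; split => // ?; apply: b; left.
- by right; right; split => // ?; apply: b; right.
Qed.

Lemma bigbox_shift k E y : `|y| < 1 ->
  bigbox k `&` shift_preimage E y `<=` shift_preimage (bigbox k.+1 `&` E) y.
Proof.
move=> y1 z [[zk /andP[kz zk']] Ez]; split => //; split.
  move=> i /=; rewrite mxE -natr1 (le_trans (ler_normD _ _))// lerD//.
  by rewrite (le_trans (ler_norm_space y i))// ltW.
rewrite -ler_norml -natr1 (le_trans (ler_normD _ _))// lerD//.
  by rewrite ler_norml kz.
by rewrite (le_trans (ler_norm_time y))// ltW.
Qed.

Definition translation_continuous (E : set ST) :=
  forall k, vanishes_at0 (fun y => mu (bigbox k `&` shift_diff E y)).

Lemma nonincreasing_measure_cvg0 (F : (set ST)^nat) (e : R) : 0 < e ->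
  (mu (F 0%N) < +oo)%E -> (forall i, measurable (F i)) ->
  mu (\bigcap_n F n) = 0%E -> nonincreasing_seq F ->
  exists n, (mu (F n) <= e%:E)%E.
Proof.
move=> e0 F0 mF F00 ndF.
have : mu \o F @ \oo --> 0%E.
  rewrite -F00; exact: (@nonincreasing_cvg_mu _ _ R mu F F0 mF (bigcapT_measurable mF) ndF).
move=> /fine_cvgP[[n _ Fn]] /cvgr_le /(_ _ e0)[k _ Fk].
exists (maxn n k).
rewrite -[leLHS]fineK; last by apply: Fn => /=; exact: leq_maxl.
by rewrite lee_fin; apply: Fk => /=; exact: leq_maxr.
Qed.

Lemma translation_continuous_halfspace (h : ST -> R) c :
  measurable_fun setT (h : ST -> measurableTypeR R) ->
  (forall z y : 'rV[R]_N * R, h (z + y) = h z + h y) ->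
  (forall y, `|h y| <= `|y : 'rV[R]_N * R|) ->
  mu [set z | h z = c] = 0%E ->
  translation_continuous [set z : ST | h z < c].
Proof.
move=> mh hD hle hc k e e0.
pose F n : set ST := bigbox k `&` [set z | c - n.+1%:R^-1 <= h z <= c + n.+1%:R^-1].
have mslab n : measurable [set z : ST | c - n.+1%:R^-1 <= h z <= c + n.+1%:R^-1].
  rewrite -[X in measurable X]setTI
    (_ : [set z | _] = h @^-1` `[c - n.+1%:R^-1, c + n.+1%:R^-1]).
    by apply: mh => //; exact: measurable_itv.
  by apply/seteqP; split => z /=; rewrite in_itv.
have mF n : measurable (F n) by apply: measurableI => //; exact: measurable_bigbox.
have [n Fn] : exists n, (mu (F n) <= e%:E)%E.
  apply: nonincreasing_measure_cvg0 => //.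
  - apply: (@le_lt_trans _ _ (mu (bigbox k : set ST))); last exact: stbox_ltoo.
    apply: le_measure; rewrite ?inE//; first exact: measurable_bigbox.
    by move=> z [].
  - have sub : \bigcap_n F n `<=` [set z | h z = c].
      move=> z Fz /=; apply/eqP; rewrite eq_le; apply/andP; split.
        apply/ler_addgt0Pl => x x0.
        have /andP[_] := (Fz (Num.truncn x^-1) Logic.I).2.
        rewrite addrC => /le_trans; apply; rewrite lerD2r.
        rewrite invf_ple ?posrE//; exact/ltW/truncnS_gt.
      apply/ler_addgt0Pl => x x0.
      have /andP[+ _] := (Fz (Num.truncn x^-1) Logic.I).2.
      rewrite lerBlDl => /le_trans; apply; rewrite lerD2r.
      rewrite invf_ple ?posrE//; exact/ltW/truncnS_gt.
    apply: (subset_measure0 _ _ sub hc); first exact: bigcapT_measurable.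
    rewrite -[X in measurable X]setTI (_ : [set z | _] = h @^-1` [set c])//.
    by apply: mh => //; exact: measurable_set1.
  - move=> a b ab; apply/subsetPset => z [zk /andP[az bz]]; split => //.
    have ba : b.+1%:R^-1 <= a.+1%:R^-1 :> R by rewrite lef_pV2 ?posrE// ler_nat.
    apply/andP; split; first by rewrite (le_trans _ az)// lerD2l lerN2.
    by rewrite (le_trans bz)// lerD2l.
exists n.+1%:R^-1; first by rewrite invr_gt0.
move=> y yn; apply: le_trans Fn; apply: le_measure => //.
- rewrite inE; apply: measurableI; first exact: measurable_bigbox.
  apply: measurable_shift_diff.
  rewrite -[X in measurable X]setTI (_ : [set z | _] = h @^-1` `]-oo, c[).
    by apply: mh => //; exact: measurable_itv.
  by apply/seteqP; split => z /=; rewrite in_itv.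
- by rewrite inE.
- move=> z [zk]; have := le_lt_trans (hle y) yn.
  rewrite ltr_norml => /andP[ya yb] zd; split => //; move: zd => [[h1 h2] | [h1 h2]].
    have {}h1 : h z + h y < c by rewrite -hD.
    have {}h2 : c <= h z by rewrite leNgt; exact/negP.
    rewrite /=; move: h1 h2 ya yb; move: (h z) (h y) (n.+1%:R^-1) => a b u.
    by move=> *; apply/andP; split; lra.
  have {}h2 : c <= h z + h y by rewrite -hD leNgt; exact/negP.
  have {}h1 : h z < c by [].
  rewrite /=; move: h1 h2 ya yb; move: (h z) (h y) (n.+1%:R^-1) => a b u.
  by move=> *; apply/andP; split; lra.
Qed.

Lemma translation_continuousT E : measurable E -> translation_continuous E.
Proof.
move: E; apply: measurable_spacetime_ind.
- move=> k e e0; exists 1 => // y _.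
  rewrite (_ : _ `&` _ = set0) ?measure0 ?lee_fin ?ltW//.
  by apply/seteqP; split => // z [_ [[]|[]]].
- by move=> E mE tE k; under eq_fun do rewrite shift_diffC; exact: tE.
- move=> F mF tF k e e0.
  pose G n : set ST := \big[setU/set0]_(i < n) F i.
  have mG n : measurable (G n) by exact: bigsetU_measurable.
  have tG n : translation_continuous (G n).
    rewrite /G; elim: n => [|n IHn].
      rewrite big_ord0 => l r r0; exists 1 => // y _.
      rewrite (_ : _ `&` _ = set0) ?measure0 ?lee_fin ?ltW//.
      by apply/seteqP; split => // z [_ [[]|[]]].
    rewrite big_ord_recr/= => l.
    apply: (vanishes_le ltr01 _ (vanishesD (IHn l) (tF n l))) => y _.
    apply: (@le_trans _ _ (mu ((bigbox l `&` shift_diff (\big[setU/set0]_(i < n) F i) y) `|`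
       (bigbox l `&` shift_diff (F n) y)))).
      apply: le_measure; rewrite ?inE.
      + apply: measurableI; first exact: measurable_bigbox.
        by apply: measurable_shift_diff; apply: measurableU => //; exact: mG.
      + apply: measurableU; apply: measurableI; try exact: measurable_bigbox.
          by apply: measurable_shift_diff; exact: mG.
        exact: measurable_shift_diff.
      + by rewrite -setIUr; apply: setIS; exact: shift_diffU.
    apply: measureU2; apply: measurableI; try exact: measurable_bigbox.
      by apply: measurable_shift_diff; exact: mG.
    exact: measurable_shift_diff.
  pose U : set ST := \bigcup_k F k.
  have mU : measurable U by exact: bigcup_measurable.
  pose Q n : set ST := bigbox k.+1 `&` (U `\` G n).
  have mQ n : measurable (Q n).
    by apply: measurableI; [exact: measurable_bigbox|exact: measurableD].
  have e40 : 0 < e / 4 by rewrite divr_gt0.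
  have [n Qn] : exists n, (mu (Q n) <= (e / 4)%:E)%E.
    apply: nonincreasing_measure_cvg0 => //.
    + apply: (@le_lt_trans _ _ (mu (bigbox k.+1 : set ST))); last exact: stbox_ltoo.
      apply: le_measure; rewrite ?inE//; first exact: measurable_bigbox.
      by move=> z [].
    + rewrite (_ : \bigcap_n Q n = set0) ?measure0//.
      apply/seteqP; split => // z Qz.
      have [_ [[i _ Fiz] _]] := Qz 0%N Logic.I.
      have [_ [_]] := Qz i.+1 Logic.I; apply.
      by rewrite /G big_ord_recr/=; right.
    + move=> a b ab; apply/subsetPset => z [zk [Uz Gz]]; split => //; split => //.
      move: Gz; apply: contra_not; rewrite /G => Gaz.
      exact: (subset_bigsetU ab).
  have [dl dl0 Gdl] := tG n k (e / 2) (divr_gt0 e0 (ltr0n _ 2)).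
  exists (Num.min 1 dl); first by rewrite lt_min ltr01.
  move=> y; rewrite lt_min => /andP[y1 ydl].
  have sub : bigbox k `&` shift_diff U y `<=`
      (bigbox k `&` shift_diff (G n) y) `|` (shift_preimage (Q n) y `|` Q n).
    have GU : G n `<=` U by exact: bigsetU_bigcup.
    move=> z [zk [[Uzy nUz]|[Uz nUzy]]].
      have [Gzy|nGzy] := pselect (G n ((z : 'rV[R]_N * R) + y)).
        by left; split => //; left; split => //; move=> /GU.
      right; left.
      by apply: (@bigbox_shift k (U `\` G n) y y1); split.
    have [Gz|nGz] := pselect (G n z).
      by left; split => //; right; split => //; move=> /GU.
    by right; right; split => //; exact: bigbox_le zk.
  have m1 : measurable (bigbox k `&` shift_diff (G n) y : set ST).
    by apply: measurableI; [exact: measurable_bigbox|exact: measurable_shift_diff].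
  have m2 : measurable (shift_preimage (Q n) y) by exact: measurable_shift_preimage.
  apply: (@le_trans _ _ (mu ((bigbox k `&` shift_diff (G n) y) `|`
      (shift_preimage (Q n) y `|` Q n)))).
    apply: le_measure => //; rewrite inE.
      by apply: measurableI; [exact: measurable_bigbox|exact: measurable_shift_diff].
    by apply: measurableU => //; exact: measurableU.
  apply: (@le_trans _ _ ((e / 2)%:E + ((e / 4)%:E + (e / 4)%:E))%E); last first.
    by rewrite -!EFinD lee_fin; lra.
  apply: le_trans (measureU2 _ _ _) _ => //; first exact: measurableU.
  apply: leeD; first exact: Gdl.
  apply: le_trans (measureU2 _ _ _) _ => //.
  apply: leeD => //; apply: le_trans Qn.
  have <- := spacetime_measure_shift y (mQ n); exact: lexx.
- move=> i c; apply: (@translation_continuous_halfspace (fun z : ST => z.1 ord0 i)).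
  + exact: measurable_space_coord.
  + by move=> z y; rewrite mxE.
  + by move=> y; exact: ler_norm_space.
  + have := spacetime_null_space _ (lebesgue_rV_hyperplane i c).
    rewrite (_ : _ `*` _ = [set z : ST | (z.1 : 'rV[R]_N) ord0 i = c]).
      apply; rewrite -[X in measurable X]setTI.
      exact: (@measurable_coord R N i measurableT [set c] (measurable_set1 _)).
    by apply/seteqP; split => z //= [].
- move=> c; apply: (@translation_continuous_halfspace (fun z : ST => z.2)).
  + exact: measurable_time_coord.
  + by [].
  + by move=> y; exact: ler_norm_time.
  + have := @spacetime_null_time R N [set c] (measurable_set1 _) (lebesgue_measure_set1 _).
    rewrite (_ : _ `*` _ = [set z : ST | (z.2 : R) = c])//.
    by apply/seteqP; split => z //= [].
Qed.

End continuity_of_translations.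

Ltac integral_side :=
  first [ by apply: measurable_funeM; exact/measurable_EFinP
        | by exact/measurable_EFinP
        | by move=> ? _; rewrite -?EFinM lee_fin ?mulr_ge0
        | by rewrite lee_fin ?mulr_ge0 ].

Section tails.
Context d (T : measurableType d) {R : realType} (mu : {measure set T -> \bar R}).

Lemma tail_integral (g : T -> R) (B : (set T)^nat) (e : R) : 0 < e ->
  measurable_fun setT g -> (forall z, 0 <= g z) ->
  (\int[mu]_z (g z)%:E < +oo)%E ->
  (forall n, measurable (B n)) ->
  (forall z, \forall n \near \oo, ~ B n z) ->
  exists n, (\int[mu]_z (g z * \1_(B n) z)%:E <= e%:E)%E.
Proof.
move=> e0 mg g0 gfin mB Bz.
have mf n : measurable_fun setT (fun z => (g z * \1_(B n) z)%:E).
  by apply/measurable_EFinP; apply: measurable_funM.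
have [] := @dominated_convergence _ _ _ mu setT measurableT
  (fun n z => (g z * \1_(B n) z)%:E) (cst 0%E) (EFin \o g) mf (measurable_cst _).
- apply: aeW => z _ /=; apply: cvg_near_cst.
  by near=> n; rewrite indicE memNset ?mulr0//; near: n; exact: Bz.
- apply/integrableP; split; first exact/measurable_EFinP.
  by under eq_integral do rewrite /= ger0_norm//.
- apply: aeW => z n _ /=; rewrite lee_fin ger0_norm ?mulr_ge0//.
  by rewrite indicE; case: (_ \in _); rewrite ?mulr1 ?mulr0.
move=> _ _; rewrite integral0 => /fine_cvgP[[n _ Fn]] /cvgr_le /(_ _ e0)[k _ Fk].
exists (maxn n k).
rewrite -[leLHS]fineK; last by apply: Fn => /=; exact: leq_maxl.
by rewrite lee_fin; apply: Fk => /=; exact: leq_maxr.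
Unshelve. all: by end_near. Qed.

End tails.

Section translation_of_functions.
Context {R : realType} {N : nat}.
Local Notation ST := ('rV[R]_N * measurableTypeR R)%type.
Local Notation mu := (@spacetime_measure R N).

Lemma measurable_fun_shift (f : ST -> R) (y : 'rV[R]_N * R) :
  measurable_fun setT f -> measurable_fun setT (fun z : ST => f ((z : 'rV[R]_N * R) + y)).
Proof. by move=> mf; apply: (measurableT_comp mf); exact: measurable_shift. Qed.

Lemma measurable_shift_err (f : ST -> R) (y : 'rV[R]_N * R) :
  measurable_fun setT f ->
  measurable_fun setT (fun z : ST => `|f ((z : 'rV[R]_N * R) + y) - f z|).
Proof.
move=> mf; apply: (measurableT_comp (@normr_measurable R setT)).
by apply: measurable_funB => //; exact: measurable_fun_shift.
Qed.

(* grid bound *)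
Lemma grid_bound (f : ST -> R) (M eta : R) : 0 < eta -> (forall z, `|f z| <= M) ->
  let E (j : nat) := [set z : ST | f z < - M + j%:R * eta] in
  exists n : nat, forall (y z : 'rV[R]_N * R), 
    `|f (z + y) - f z| <= eta + 2 * M * \sum_(j < n) \1_(shift_diff (E j) y) (z : ST).
Proof.
move=> eta0 fM E; pose n := (Num.truncn (2 * M / eta)).+2; exists n => y z.
have M0 : 0 <= M by apply: le_trans (fM z).
have bd : `|f (z + y) - f z| <= 2 * M.
  by rewrite (le_trans (ler_normB _ _))// mulr2n mulrDl mul1r lerD.
have S0 : 0 <= \sum_(j < n) \1_(shift_diff (E j) y) (z : ST) :> R by exact: sumr_ge0.
have [le|gt] := leP `|f (z + y) - f z| eta.
  by rewrite (le_trans le)// lerDl mulr_ge0// mulr_ge0.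
suff [j jn zj] : exists2 j, (j < n)%N & shift_diff (E j) y (z : ST).
  rewrite (le_trans bd)// ler_wpDl ?(ltW eta0)// ler_peMr ?mulr_ge0//.
  rewrite (bigD1 (Ordinal jn))//= indicE mem_set//= lerDl.
  exact: sumr_ge0.
have key a b : `|a| <= M -> `|b| <= M -> eta < b - a ->
    exists2 j, (j < n)%N & a < - M + j%:R * eta /\ ~ (b < - M + j%:R * eta).
  rewrite !ler_norml => /andP[Ma aM] /andP[Mb bM] etaba.
  have x0 : 0 <= (a + M) / eta by rewrite divr_ge0 ?(ltW eta0)//; lra.
  have /andP[lo up] := truncn_itv x0.
  exists (Num.truncn ((a + M) / eta)).+1.
    rewrite ltnS ltnS; apply: le_truncn.
    by rewrite ler_pM2r ?invr_gt0//; lra.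
  split; first by move: up; rewrite ltr_pdivrMr//; lra.
  apply/negP; rewrite -leNgt; move: lo; rewrite ler_pdivlMr//.
  by move: (Num.truncn _) => t; rewrite -[t.+1%:R]natr1; lra.
have := gt; rewrite ltr_normr => /orP[h|h].
  have [j jn [ja jb]] := key (f z) (f (z + y)) (fM _) (fM _) h.
  by exists j => //; right; split.
have h' : eta < f z - f (z + y) by lra.
have [j jn [ja jb]] := key (f (z + y)) (f z) (fM _) (fM _) h'.
by exists j => //; left; split.
Qed.

Lemma measurable_sublevel (f : ST -> R) c : measurable_fun setT f ->
  measurable [set z : ST | f z < c].
Proof.
move=> mf; rewrite -[X in measurable X]setTI (_ : [set z | _] = f @^-1` `]-oo, c[).
  by apply: mf => //; exact: measurable_itv.
by apply/seteqP; split => z /=; rewrite in_itv.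
Qed.

Lemma vanishes_bounded_box (f : ST -> R) (M : R) (k : nat) :
  measurable_fun setT f -> (forall z, `|f z| <= M) ->
  vanishes_at0 (fun y : 'rV[R]_N * R =>
    \int[mu]_(z in bigbox k) `|f ((z : 'rV[R]_N * R) + y) - f z|%:E)%E.
Proof.
move=> mf fM e e0.
have M0 : 0 <= M by apply: le_trans (fM 0).
have boxfin : mu (bigbox k : set ST) \is a fin_num.
  by rewrite ge0_fin_numE//; exact: stbox_ltoo.
pose m := fine (mu (bigbox k : set ST)).
have m0 : 0 <= m by exact: fine_ge0.
have mE : mu (bigbox k : set ST) = m%:E by rewrite fineK.
pose eta := e / 2 / (m + 1).
have eta0 : 0 < eta by rewrite !divr_gt0// ltr_wpDl.
have [n gb] := grid_bound eta0 fM.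
pose E (j : nat) := [set z : ST | f z < - M + j%:R * eta].
have mE' j : measurable (E j) by exact: measurable_sublevel.
have vS : vanishes_at0 (fun y => \sum_(j < n) mu (bigbox k `&` shift_diff (E j) y))%E.
  apply: (@vanishes_sum R N n (fun j y => mu (bigbox k `&` shift_diff (E j) y))) => j.
  exact: translation_continuousT.
have vS' : vanishes_at0
    (fun y => (2 * M)%:E * \sum_(j < n) mu (bigbox k `&` shift_diff (E j) y))%E.
  apply: vanishesZ => //; first by rewrite mulr_ge0.
  by move=> y; apply: sume_ge0.
have [dl dl0 dlP] := vS' (e / 2) (divr_gt0 e0 (ltr0n _ 2)).
exists dl => // y /dlP ydl.
have mi j : measurable (shift_diff (E j) y) by exact: measurable_shift_diff.
have mind j : measurable_fun (bigbox k : set ST) (fun z => (\1_(shift_diff (E j) y) z)%:E : \bar R).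
  by apply/measurable_EFinP; apply: measurable_funTS.
apply: (@le_trans _ _ (\int[mu]_(z in bigbox k)
   (eta%:E + (2 * M)%:E * \sum_(j < n) (\1_(shift_diff (E j) y) z)%:E))%E).
  apply: ge0_le_integral.
  - exact: measurable_bigbox.
  - by move=> z _; rewrite lee_fin.
  - apply/measurable_EFinP; apply: measurable_funTS; exact: measurable_shift_err.
  - apply: emeasurable_funD => //; apply: measurable_funeM.
    by apply: emeasurable_sum => j; exact: mind.
  - by move=> z _; rewrite sumEFin -EFinM -EFinD lee_fin; exact: gb.
have s0 z : (0 <= (2 * M)%:E * \sum_(j < n) (\1_(shift_diff (E j) y) z)%:E)%E.
  by rewrite mule_ge0 ?lee_fin ?mulr_ge0//; apply: sume_ge0 => j _; rewrite lee_fin.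
have mB := @measurable_bigbox R N k.
rewrite ge0_integralD//; first last.
- by apply: measurable_funeM; apply: emeasurable_sum => j; exact: mind.
- by move=> z _; rewrite lee_fin ltW.
rewrite integral_cst// ge0_integralZl//; first last.
- by rewrite lee_fin mulr_ge0.
- by move=> z _; apply: sume_ge0 => j _; rewrite lee_fin.
- by apply: emeasurable_sum => j; exact: mind.
rewrite ge0_integral_sum//.
rewrite [e]splitr EFinD; apply: leeD.
  rewrite [X in (X <= _)%E](_ : _ = (eta * m)%:E); last first.
    exact: (congr1 (fun x => eta%:E * x)%E mE).
  rewrite lee_fin /eta mulrAC ler_pdivrMr ?ltr_wpDl//.
  by rewrite ler_wpM2l ?divr_ge0 ?ltW// ltrDl.
apply: le_trans ydl; apply: lee_wpmul2l; first by rewrite lee_fin mulr_ge0.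
by apply: lee_sum => j _; rewrite integral_indic// setIC.
Qed.

Lemma vanishes_bounded (a f : ST -> R) (M : R) :
  measurable_fun setT a -> (forall z, 0 <= a z) ->
  (\int[mu]_z (a z)%:E < +oo)%E ->
  measurable_fun setT f -> (forall z, `|f z| <= M) ->
  vanishes_at0 (fun y : 'rV[R]_N * R =>
    \int[mu]_z (a z * `|f ((z : 'rV[R]_N * R) + y) - f z|)%:E)%E.
Proof.
move=> ma a0 afin mf fM e e0.
have M0 : 0 <= M by apply: le_trans (fM 0).
pose B n : set ST := ~` ([set z | a z < n%:R] `&` bigbox n).
have mB n : measurable (B n).
  apply: measurableC; apply: measurableI; last exact: measurable_bigbox.
  exact: measurable_sublevel.
have M1 : 0 < 2 * (2 * M + 1) by rewrite mulr_gt0// ltr_wpDl// mulr_ge0.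
have Bz z : \forall n \near \oo, ~ B n z.
  have [k _ zk] : (\bigcup_k bigbox k) (z : 'rV[R]_N * R) by rewrite bigcup_bigbox.
  near=> n; apply; split.
    rewrite /= (lt_le_trans (truncnS_gt _))// ler_nat.
    by near: n; exact: nbhs_infty_ge.
  by apply: bigbox_le zk; near: n; exact: nbhs_infty_ge.
have [n Bn] := tail_integral (divr_gt0 e0 M1) ma a0 afin mB Bz.
have e20 : 0 < e / 2 by rewrite divr_gt0.
have [dl dl0 dlP] : exists2 dl : R, 0 < dl & forall y : 'rV[R]_N * R, `|y| < dl ->
    (n%:R%:E * \int[mu]_(z in bigbox n) `|f ((z : 'rV[R]_N * R) + y) - f z|%:E <= (e / 2)%:E)%E.
  apply: vanishesZ e20 => //; last exact: (vanishes_bounded_box n mf fM).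
  by move=> y; apply: integral_ge0 => z _; rewrite lee_fin.
exists dl => // y /dlP ydl.
have msh := @measurable_shift_err f y mf.
have mbox := @measurable_bigbox R N n.
have mind : measurable_fun setT (fun z : ST => \1_(bigbox n : set ST) z * `|f ((z : 'rV[R]_N * R) + y) - f z|).
  by apply: measurable_funM.
have mtail : measurable_fun setT (fun z : ST => a z * \1_(B n) z).
  by apply: measurable_funM.
apply: (@le_trans _ _ (\int[mu]_z (n%:R%:E * (\1_(bigbox n : set ST) z * `|f ((z : 'rV[R]_N * R) + y) - f z|)%:E + (2 * M)%:E * (a z * \1_(B n) z)%:E))%E).
  apply: ge0_le_integral => //.
  - by move=> z _; rewrite lee_fin mulr_ge0.
  - by apply/measurable_EFinP; apply: measurable_funM.
  - by apply: emeasurable_funD; apply: measurable_funeM; exact/measurable_EFinP.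
  - move=> z _; rewrite -!EFinM -EFinD lee_fin !indicE.
    have bd : `|f ((z : 'rV[R]_N * R) + y) - f z| <= 2 * M.
      by rewrite (le_trans (ler_normB _ _))// mulr2n mulrDl mul1r lerD.
    have [zB|zB] := pselect (B n z).
      rewrite (mem_set zB) mulr1 ler_wpDl ?mulr_ge0//.
      by rewrite mulrC ler_wpM2r.
    rewrite (memNset zB) !mulr0 addr0.
    have [za zn] : ([set z | a z < n%:R] `&` bigbox n) z by exact: contrapT.
    by rewrite (mem_set zn) mul1r ler_wpM2r// ltW.
rewrite ge0_integralD//; [|integral_side..].
rewrite ge0_integralZl//; [|integral_side..].
rewrite ge0_integralZl//; [|integral_side..].
rewrite [e]splitr EFinD; apply: leeD.
  apply: le_trans ydl; apply: lee_wpmul2l; first by rewrite lee_fin.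
  rewrite [leRHS]integral_mkcond; apply: ge0_le_integral => //.
  - exact/measurable_EFinP.
  - apply/(measurable_restrictT _ mbox). exact/measurable_EFinP/measurable_funTS.
  - by move=> z _; rewrite patchE indicE; case: (z \in _); rewrite ?mul1r ?mul0r.
apply: (@le_trans _ _ ((2 * M)%:E * (e / (2 * (2 * M + 1)))%:E)%E).
  by apply: lee_wpmul2l => //; rewrite lee_fin mulr_ge0.
rewrite -EFinM lee_fin mulrA ler_pdivrMr//.
have -> : e / 2 * (2 * (2 * M + 1)) = 2 * M * e + e by field.
lra.
Unshelve. all: by end_near.
Qed.

End translation_of_functions.

Section nonneg_real_integrals.
Context d (T : measurableType d) {R : realType} (mu : {measure set T -> \bar R}).
Implicit Types f g h : T -> R.

Lemma nnint_le f g : measurable_fun setT f -> measurable_fun setT g ->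
  (forall z, 0 <= f z) -> (forall z, f z <= g z) ->
  (\int[mu]_z (f z)%:E <= \int[mu]_z (g z)%:E)%E.
Proof.
move=> mf mg f0 fg; apply: ge0_le_integral => //.
- by move=> z _; rewrite lee_fin.
- exact/measurable_EFinP.
- exact/measurable_EFinP.
- by move=> z _; rewrite lee_fin.
Qed.

Lemma nnintD f g : measurable_fun setT f -> measurable_fun setT g ->
  (forall z, 0 <= f z) -> (forall z, 0 <= g z) ->
  (\int[mu]_z (f z + g z)%:E = \int[mu]_z (f z)%:E + \int[mu]_z (g z)%:E)%E.
Proof.
move=> mf mg f0 g0; under eq_integral do rewrite EFinD.
rewrite ge0_integralD//; first [exact/measurable_EFinP | by move=> z _; rewrite lee_fin].
Qed.

Lemma nnintZ (c : R) f : measurable_fun setT f -> (forall z, 0 <= f z) -> 0 <= c ->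
  (\int[mu]_z (c * f z)%:E = c%:E * \int[mu]_z (f z)%:E)%E.
Proof.
move=> mf f0 c0; under eq_integral do rewrite EFinM.
by rewrite ge0_integralZl//; first [exact/measurable_EFinP | by move=> z _; rewrite lee_fin].
Qed.

Lemma nnint_leD f g h : measurable_fun setT f -> measurable_fun setT g ->
  measurable_fun setT h ->
  (forall z, 0 <= f z) -> (forall z, 0 <= g z) -> (forall z, 0 <= h z) ->
  (forall z, f z <= g z + h z) ->
  (\int[mu]_z (f z)%:E <= \int[mu]_z (g z)%:E + \int[mu]_z (h z)%:E)%E.
Proof.
move=> mf mg mh f0 g0 h0 fgh; rewrite -nnintD//.
by apply: nnint_le => //; exact: measurable_funD.
Qed.

Lemma nnint_fine f : (forall z, 0 <= f z) -> (\int[mu]_z (f z)%:E < +oo)%E ->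
  exists2 c : R, 0 <= c & (\int[mu]_z (f z)%:E = c%:E)%E.
Proof.
move=> f0 foo; exists (fine (\int[mu]_z (f z)%:E)%E).
  by apply: fine_ge0; apply: integral_ge0 => z _; rewrite lee_fin.
rewrite fineK// ge0_fin_numE//.
by apply: integral_ge0 => z _; rewrite lee_fin.
Qed.

Lemma integrable_nnint f : measurable_fun setT f ->
  (\int[mu]_z `|f z|%:E < +oo)%E <-> mu.-integrable setT (EFin \o f).
Proof.
move=> mf; split.
  by move=> foo; apply/integrableP; split; first exact/measurable_EFinP.
by move=> /integrableP[].
Qed.

End nonneg_real_integrals.

Section weighted_translation.
Context {R : realType} {N : nat}.
Local Notation ST := ('rV[R]_N * measurableTypeR R)%type.
Local Notation mu := (@spacetime_measure R N).

Lemma integral_st_shift (f : ST -> \bar R) (a : 'rV[R]_N * R) :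
  measurable_fun setT f ->
  (\int[mu]_z f ((z : 'rV[R]_N * R) + a)%R = \int[mu]_z f z)%E.
Proof.
move=> mf; rewrite [LHS]integralE [RHS]integralE; congr (_ - _)%E.
  apply: etrans (@ge0_integral_st_shift R N f^\+%E a _ _).
  - by apply: eq_integral => z _; rewrite !funeposE.
  - exact: measurable_funepos.
  - by [].
apply: etrans (@ge0_integral_st_shift R N f^\-%E a _ _).
- by apply: eq_integral => z _; rewrite !funenegE.
- exact: measurable_funeneg.
- by [].
Qed.

(** Splitting [f] at a high level, the bounded part is handled by
    [vanishes_bounded] and the rest is small uniformly in the translation. *)
Lemma vanishes_weighted (a f A1 Phi : ST -> R) :
  measurable_fun setT a -> measurable_fun setT f ->
  measurable_fun setT A1 -> measurable_fun setT Phi ->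
  (forall z, 0 <= a z) -> (forall z, 0 <= A1 z) -> (forall z, 0 <= Phi z) ->
  (\int[mu]_z (a z)%:E < +oo)%E -> (\int[mu]_z (A1 z)%:E < +oo)%E ->
  (\int[mu]_z (Phi z)%:E < +oo)%E ->
  (forall eta, 0 < eta -> exists2 C, 0 <= C &
     forall z z', a z * `|f z'| <= eta * A1 z + C * Phi z') ->
  vanishes_at0 (fun y : 'rV[R]_N * R =>
    \int[mu]_z (a z * `|f ((z : 'rV[R]_N * R) + y) - f z|)%:E)%E.
Proof.
move=> ma mf mA1 mPhi a0 A10 Phi0 afin A1fin Phifin H e e0.
have [m1 m10 m1E] := nnint_fine A10 A1fin.
pose eta := e / 6 / (m1 + 1).
have eta0 : 0 < eta by rewrite !divr_gt0// ltr_wpDl.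
have [C C0 HC] := H eta eta0.
have absf : measurable_fun setT (fun z => `|f z|).
  by apply: (measurableT_comp (@normr_measurable R setT)).
pose B n : set ST := ~` [set z | `|f z| < n%:R].
have mB n : measurable (B n) by apply: measurableC; exact: measurable_sublevel.
have Bz z : \forall n \near \oo, ~ B n z.
  near=> n; move=> h; apply: h.
  rewrite /= (lt_le_trans (truncnS_gt _))// ler_nat.
  by near: n; exact: nbhs_infty_ge.
have e60 : 0 < e / 6 / (C + 1) by rewrite !divr_gt0// ltr_wpDl.
have [n Bn] := tail_integral e60 mPhi Phi0 Phifin mB Bz.
pose b z := f z * \1_(~` B n) z.
have mb : measurable_fun setT b.
  by apply: measurable_funM => //; apply: measurable_indic; exact: measurableC.
have bn z : `|b z| <= n%:R.
  rewrite /b indicE; have [zB|zB] := pselect (B n z).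
    by rewrite memNset ?mulr0 ?normr0//= => h; exact: h.
  rewrite mem_set ?mulr1//; rewrite ltW//.
  by move: zB => /contrapT.
have e30 : 0 < e / 3 by rewrite divr_gt0.
have [dl dl0 dlP] := vanishes_bounded ma a0 afin mb bn e30.
exists dl => // y ydl.
pose Phin z := Phi z * \1_(B n) z.
have mPhin : measurable_fun setT Phin.
  by apply: measurable_funM => //; exact: measurable_indic.
have Phin0 z : 0 <= Phin z by rewrite mulr_ge0.
have fb z : f z = b z + f z * \1_(B n) z.
  rewrite /b !indicE; have [zB|zB] := pselect (B n z).
    by rewrite (mem_set zB) memNset ?mulr0 ?add0r ?mulr1//= => h; exact: h.
  by rewrite (memNset zB) mem_set// mulr1 mulr0 addr0.
have HCn z z' : a z * `|f z' * \1_(B n) z'| <= eta * A1 z + C * Phin z'.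
  rewrite /Phin indicE; case: (z' \in B n); first by rewrite !mulr1.
  by rewrite !mulr0 normr0 mulr0 addr0 mulr_ge0// ltW.
have mPhis : measurable_fun setT (fun z : ST => Phin ((z : 'rV[R]_N * R) + y)).
  exact: measurable_fun_shift.
have merrb : measurable_fun setT
    (fun z : ST => a z * `|b ((z : 'rV[R]_N * R) + y) - b z|).
  by apply: measurable_funM => //; exact: measurable_shift_err.
have m2 : measurable_fun setT (fun z => 2 * eta * A1 z) by exact: measurable_funM.
have m3 : measurable_fun setT (fun z : ST => C * Phin ((z : 'rV[R]_N * R) + y)).
  exact: measurable_funM.
have m4 : measurable_fun setT (fun z => C * Phin z) by exact: measurable_funM.
have PhinE : (C%:E * \int[mu]_z (Phin z)%:E <= (e / 6)%:E)%E.
  apply: (@le_trans _ _ (C%:E * (e / 6 / (C + 1))%:E)%E).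
    by apply: lee_wpmul2l => //; rewrite lee_fin.
  rewrite -EFinM lee_fin mulrA ler_pdivrMr ?ltr_wpDl//.
  by rewrite mulrC ler_wpM2l ?(ltW e60) ?lerDl//; rewrite divr_ge0// ltW.
apply: (@le_trans _ _ (\int[mu]_z (a z * `|b ((z : 'rV[R]_N * R) + y) - b z|)%:E +
   (\int[mu]_z (2 * eta * A1 z)%:E + (\int[mu]_z (C * Phin ((z : 'rV[R]_N * R) + y)%R)%:E
   + \int[mu]_z (C * Phin z)%:E)))%E); last first.
  have -> : e = e / 3 + (e / 3 + (e / 6 + e / 6)) by field.
  rewrite !EFinD; apply: leeD; first exact: dlP.
  apply: leeD.
    rewrite nnintZ// ?m1E; last by rewrite mulr_ge0// ltW.
    rewrite -EFinM lee_fin /eta.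
    have -> : e / 3 = 2 * (e / 6 / (m1 + 1)) * (m1 + 1).
      by field; rewrite gt_eqF// ltr_wpDl.
    by rewrite ler_wpM2l ?lerDl// mulr_ge0// (ltW eta0).
  apply: leeD; last by rewrite nnintZ.
  rewrite (@integral_st_shift (fun z => (C * Phin z)%:E) y) ?nnintZ//.
  exact/measurable_EFinP.
have n2 z : 0 <= 2 * eta * A1 z by rewrite mulr_ge0// mulr_ge0// (ltW eta0).
rewrite -[X in (_ + (_ + X))%E]nnintD//; last 2 first.
- by move=> z; rewrite mulr_ge0.
- by move=> z; rewrite mulr_ge0.
have m34 : measurable_fun setT
  (fun z : ST => C * Phin ((z : 'rV[R]_N * R) + y) + C * Phin z).
  exact: measurable_funD.
have n34 z : 0 <= C * Phin ((z : 'rV[R]_N * R) + y) + C * Phin z.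
  by rewrite addr_ge0// mulr_ge0.
rewrite -[X in (_ + X)%E]nnintD//.
apply: nnint_leD.
- by apply: measurable_funM => //; exact: measurable_shift_err.
- exact: merrb.
- exact: measurable_funD.
- by move=> z; rewrite mulr_ge0.
- by move=> z; rewrite mulr_ge0.
- by move=> z; rewrite addr_ge0.
move=> z; set w := (z : 'rV[R]_N * R) + y.
rewrite (fb w) {1}(fb z).
have -> : b w + f w * \1_(B n) w - (b z + f z * \1_(B n) z) =
  (b w - b z) + (f w * \1_(B n) w - f z * \1_(B n) z) by ring.
apply: (@le_trans _ _ (a z * (`|b w - b z| + (`|f w * \1_(B n) w| + `|f z * \1_(B n) z|)))).
  rewrite ler_wpM2l// (le_trans (ler_normD _ _))// lerD2l.
  exact: ler_normB.
rewrite mulrDr lerD2l mulrDr.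
have h1 := HCn z w; have h2 := HCn z z.
rewrite -/w in h1 *; move: h1 h2; lra.
Unshelve. all: by end_near. Qed.

End weighted_translation.

Lemma measurable_EFin_fun d (T : measurableType d) (R : realType) (f : T -> R) :
  measurable_fun setT f -> measurable_fun setT (fun y => (f y)%:E).
Proof. by move=> mf; exact/measurable_EFinP. Qed.

Section mollification.
Context {R : realType} {N : nat}.
Local Notation ST := ('rV[R]_N * measurableTypeR R)%type.
Local Notation mu := (@spacetime_measure R N).

Record kernel_of_radius (dl : R) (rho : ST -> R) : Prop := {
  kernel_meas : measurable_fun setT rho ;
  kernel_pos : forall y, 0 <= rho y ;
  kernel_bounded : exists B : R, forall y, rho y <= B ;
  kernel_supp : forall y : 'rV[R]_N * R, dl <= `|y| -> rho y = 0 ;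
  kernel_mass : (\int[mu]_y (rho y)%:E = 1)%E }.

Definition mollify (rho f : ST -> R) (z : 'rV[R]_N * R) : R :=
  \int[mu]_y (f (z + y) * rho y).

Lemma measurable_mollify_integrand (f rho : ST -> R) (z : 'rV[R]_N * R) :
  measurable_fun setT f -> measurable_fun setT rho ->
  measurable_fun setT (fun y : ST => f (z + y) * rho y).
Proof.
move=> mf mrho; apply: measurable_funM => //.
by under eq_fun do rewrite addrC; exact: measurable_fun_shift.
Qed.

Lemma mollify_integrable dl (rho f : ST -> R) (z : 'rV[R]_N * R) :
  kernel_of_radius dl rho -> measurable_fun setT f ->
  (\int[mu]_y `|f y|%:E < +oo)%E ->
  mu.-integrable setT (EFin \o (fun y : ST => f (z + y) * rho y)).
Proof.
move=> [mrho rho0 [B rhoB] _ _] mf foo.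
have mfr := measurable_mollify_integrand z mf mrho.
apply/(integrable_nnint mu mfr).
have mabs : measurable_fun setT (fun y => `|f y|).
  exact: (measurableT_comp (@normr_measurable R setT)).
have mabss : measurable_fun setT (fun y : ST => `|f ((y : 'rV[R]_N * R) + z)|).
  exact: (measurable_fun_shift z mabs).
have B0 : 0 <= B by apply: le_trans (rhoB 0).
apply: (@le_lt_trans _ _ (\int[mu]_y (B * `|f ((y : 'rV[R]_N * R) + z)%R|)%:E)%E).
  apply: nnint_le => //.
  - exact: (measurableT_comp (@normr_measurable R setT)).
  - exact: measurable_funM.
  - move=> y; rewrite normrM (ger0_norm (rho0 y)) mulrC addrC.
    by rewrite ler_wpM2r.
rewrite nnintZ//.
have -> := @integral_st_shift R N (fun y => `|f y|%:E) z (measurable_EFin_fun mabs).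
by rewrite lte_mul_pinfty// ?lee_fin// fin_numE.
Qed.

Lemma measurable_add2 :
  measurable_fun setT (fun w : ST * ST => ((w.1 : 'rV[R]_N * R) + w.2) : ST).
Proof. by apply: measurable_st_add; [exact: measurable_fst|exact: measurable_snd]. Qed.

Lemma measurable_mollify dl (rho f : ST -> R) :
  kernel_of_radius dl rho -> measurable_fun setT f ->
  (\int[mu]_y `|f y|%:E < +oo)%E ->
  measurable_fun setT (mollify rho f : ST -> R).
Proof.
move=> kr mf foo; have [mrho rho0 [B rhoB] _ rho1] := kr.
pose F (w : ST * ST) : \bar R := (f ((w.1 : 'rV[R]_N * R) + w.2) * rho w.2)%:E.
have mF : measurable_fun setT F.
  apply/measurable_EFinP; apply: measurable_funM.
    by apply: (measurableT_comp mf); exact: measurable_add2.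
  by apply: (measurableT_comp mrho); exact: measurable_snd.
have iF : (mu \x mu)%E.-integrable setT F.
  apply/(integrable21ltyP mu mu mF).
  have mabs : measurable_fun setT (fun y => `|f y|).
    exact: (measurableT_comp (@normr_measurable R setT)).
  have [c c0 cE] := nnint_fine (fun y => normr_ge0 (f y)) foo.
  rewrite (_ : (\int[mu]_y _)%E = \int[mu]_y (c * rho y)%:E)%E.
    by rewrite nnintZ// rho1 mule1 ltry.
  apply: eq_integral => y _.
  transitivity (\int[mu]_x (rho y * `|f ((x : 'rV[R]_N * R) + y)%R|)%:E)%E.
    apply: eq_integral => x _ /=.
    by rewrite normrM (ger0_norm (rho0 y)) mulrC.
  have mabss : measurable_fun setT (fun x : ST => `|f ((x : 'rV[R]_N * R) + y)|).
    exact: (measurable_fun_shift y mabs).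
  rewrite nnintZ//.
  have -> := @integral_st_shift R N (fun y => `|f y|%:E) y (measurable_EFin_fun mabs).
  by rewrite cE -EFinM mulrC.
have := measurable_fubini_F iF.
move=> mFF; rewrite /mollify /Rintegral.
exact: (measurableT_comp (@fine_measurable R setT measurableT) mFF).
Qed.

Lemma mollify_close dl (rho f a : ST -> R) (e : R) : 0 <= e ->
  kernel_of_radius dl rho -> measurable_fun setT f ->
  (\int[mu]_y `|f y|%:E < +oo)%E ->
  measurable_fun setT a -> (forall z, 0 <= a z) ->
  (forall y : 'rV[R]_N * R, (`|y| < dl)%R ->
    \int[mu]_z (a z * `|f ((z : 'rV[R]_N * R) + y)%R - f z|)%:E <= e%:E)%E ->
  (\int[mu]_z (a z * `|mollify rho f z - f z|)%:E <= e%:E)%E.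
Proof.
move=> e0 kr mf foo ma a0 Ha; have [mrho rho0 [B rhoB] rhosupp rho1] := kr.
have mmol := measurable_mollify kr mf foo.
have irho : mu.-integrable setT (EFin \o rho).
  apply/(integrable_nnint mu mrho).
  by under eq_integral do rewrite ger0_norm//; rewrite rho1 ltry.
pose G (w : ST * ST) : R :=
  a w.1 * (rho w.2 * `|f ((w.1 : 'rV[R]_N * R) + w.2) - f w.1|).
have mdiff : measurable_fun setT
    (fun w : ST * ST => `|f ((w.1 : 'rV[R]_N * R) + w.2) - f w.1|).
  apply: (measurableT_comp (@normr_measurable R setT)).
  apply: measurable_funB.
    by apply: (measurableT_comp mf); exact: measurable_add2.
  by apply: (measurableT_comp mf); exact: measurable_fst.
have mG : measurable_fun setT G.
  apply: measurable_funM; first by apply: (measurableT_comp ma); exact: measurable_fst.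
  apply: measurable_funM => //.
  by apply: (measurableT_comp mrho); exact: measurable_snd.
have G0 w : (0 <= (G w)%:E)%E by rewrite lee_fin !mulr_ge0.
have mG' : measurable_fun setT (EFin \o G) by exact/measurable_EFinP.
apply: (@le_trans _ _ (\int[mu]_z \int[mu]_y (G (z, y))%:E)%E).
  apply: ge0_le_integral => //.
  - by move=> z _; rewrite lee_fin mulr_ge0.
  - apply/measurable_EFinP; apply: measurable_funM => //.
    by apply: (measurableT_comp (@normr_measurable R setT)); exact: measurable_funB.
  - exact: (@measurable_fun_fubini_tonelli_F _ _ _ _ R mu (EFin \o G)).
  - move=> z _; rewrite /G /=.
    have mdz : measurable_fun setT (fun y : ST => `|f ((z : 'rV[R]_N * R) + y) - f z|).
      apply: (measurableT_comp (@normr_measurable R setT)).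
      apply: measurable_funB => //.
      by under eq_fun do rewrite addrC; exact: measurable_fun_shift.
    rewrite nnintZ//; first last.
    + by move=> y; rewrite mulr_ge0.
    + exact: measurable_funM.
    rewrite EFinM; apply: lee_wpmul2l; first by rewrite lee_fin.
    have i1 := mollify_integrable z kr mf foo.
    have i2 : mu.-integrable setT (EFin \o (fun y => f z * rho y)).
      by rewrite (_ : _ \o _ = (fun y => (f z)%:E * (rho y)%:E)%E)//; exact: integrableZl.
    have -> : mollify rho f z - f z =
        \int[mu]_y (f ((z : 'rV[R]_N * R) + y) * rho y - f z * rho y).
      rewrite RintegralB// RintegralZl// /mollify; congr (_ - _).
      by rewrite /Rintegral rho1 mulr1.
    have mB : measurable_fun setT (fun y : ST => f ((z : 'rV[R]_N * R) + y) * rho y - f z * rho y).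
      apply: measurable_funB; first exact: measurable_mollify_integrand.
      exact: measurable_funM.
    have iB : mu.-integrable setT (EFin \o (fun y : ST => f ((z : 'rV[R]_N * R) + y) * rho y - f z * rho y)).
      exact: (integrableB measurableT i1 i2).
    apply: (@le_trans _ _ (\int[mu]_y `|f ((z : 'rV[R]_N * R) + y) * rho y - f z * rho y|)%:E).
      by rewrite lee_fin; apply: le_normr_Rintegral.
    rewrite /Rintegral fineK; last first.
      rewrite ge0_fin_numE; first by move/integrableP : iB => [].
      by apply: integral_ge0 => y _; rewrite lee_fin.
    apply: nnint_le => //.
    + exact: (measurableT_comp (@normr_measurable R setT)).
    + exact: measurable_funM.
    + by move=> y; rewrite -mulrBl normrM (ger0_norm (rho0 y)) mulrC.
rewrite (@fubini_tonelli _ _ _ _ R mu mu (EFin \o G) mG' G0).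
apply: (@le_trans _ _ (\int[mu]_y (e * rho y)%:E)%E); last first.
  by rewrite nnintZ// rho1 mule1.
apply: ge0_le_integral => //.
- by move=> y _; apply: integral_ge0 => z _; exact: (G0 (z, y)).
- exact: (@measurable_fun_fubini_tonelli_G _ _ _ _ R mu (EFin \o G)).
- by apply/measurable_EFinP; exact: measurable_funM.
- move=> y _; rewrite /G /=.
  rewrite [leLHS](_ : _ =
    \int[mu]_z (rho y * (a z * `|f ((z : 'rV[R]_N * R) + y)%R - f z|))%:E)%E; last first.
    by apply: eq_integral => z _; rewrite mulrCA.
  have mz : measurable_fun setT (fun z : ST => a z * `|f ((z : 'rV[R]_N * R) + y) - f z|).
    by apply: measurable_funM => //; exact: measurable_shift_err.
  rewrite nnintZ//; last by move=> z; rewrite mulr_ge0.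
  have [ydl|ydl] := ltP `|y : 'rV[R]_N * R| dl; last first.
    by rewrite (rhosupp y ydl) mul0e mulr0.
  rewrite mulrC EFinM; apply: lee_wpmul2l; first by rewrite lee_fin.
  exact: Ha.
Qed.

Lemma mollify_shiftE dl (rho f : ST -> R) (z : 'rV[R]_N * R) :
  kernel_of_radius dl rho -> measurable_fun setT f ->
  mollify rho f z = \int[mu]_w (f w * rho ((w : 'rV[R]_N * R) - z)).
Proof.
move=> [mrho _ _ _ _] mf; rewrite /mollify /Rintegral; congr fine.
have mg : measurable_fun setT
    (fun w : ST => (f w * rho ((w : 'rV[R]_N * R) - z))%:E).
  apply/measurable_EFinP; apply: measurable_funM => //.
  exact: (measurable_fun_shift (- z) mrho).
rewrite -(integral_st_shift z mg); apply: eq_integral => y _.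
by rewrite addrK addrC.
Qed.

End mollification.

Section taylor.
Context {R : realType} {V : normedModType R}.
Implicit Types (F : V -> R) (L : V -> V -> R).

Lemma is_diff_taylor F (L : V -> R) (K : R) (z : V) :
  (forall a u v, L (a *: u + v) = a * L u + L v) ->
  (forall h, `|L h| <= K * `|h|) ->
  (forall h, `|h| <= 1 -> `|F (z + h) - F z - L h| <= K * `|h| ^+ 2) ->
  is_diff z F L.
Proof.
move=> linL Lbd FT.
have K0 : 0 <= K \/ forall h : V, `|h| = 0.
  have [triv|/existsNP[h hn0]] := pselect (forall h : V, `|h| = 0); first by right.
  left.
  have h0 : 0 < `|h| by rewrite lt_neqAle normr_ge0 andbT eq_sym; apply/eqP.
  by have := le_trans (normr_ge0 _) (Lbd h); rewrite pmulr_lge0.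
pose LL : {linear V -> R^o} := HB.pack L (GRing.isLinear.Build R V R^o _ L linL).
have cL : continuous LL.
  move=> u; apply/cvgrPdist_le => e e0.
  case: K0 => [K0|triv]; last first.
    near=> w; rewrite -(linearB LL u w); apply: le_trans (Lbd _) _.
    by rewrite triv mulr0 ltW.
  near=> w; rewrite -(linearB LL u w); apply: le_trans (Lbd _) _.
  rewrite (@le_trans _ _ ((K + 1) * `|u - w|))// ?ler_wpM2r ?lerDl//.
  rewrite -ler_pdivlMl ?ltr_wpDl//.
  by near: w; apply: cvgr_dist_le => //; rewrite mulr_gt0// invr_gt0 ltr_wpDl.
have FE : F \o shift z = cst (F z) + (LL : V -> R) +o_ (0 : V) id.
  have FLE h : (F \o shift z - (cst (F z) + (LL : V -> R))) h = F (z + h) - F z - L h.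
    rewrite (_ : (F \o shift z - (cst (F z) + (LL : V -> R))) h = F (h + z) - (F z + L h))//.
    by rewrite opprD addrA [h + z]addrC.
  apply/eqaddoP => e e0; case: K0 => [K0|triv]; last first.
    near=> h; rewrite FLE /= triv mulr0.
    by have := FT h; rewrite triv expr0n/= mulr0; apply.
  near=> h; rewrite FLE /=.
  have h1 : `|h| <= 1 by near: h; apply: nbhs0_le.
  apply: (le_trans (FT h h1)); rewrite expr2 mulrA ler_wpM2r//.
  rewrite (@le_trans _ _ ((K + 1) * `|h|))// ?ler_wpM2r ?lerDl//.
  rewrite -ler_pdivlMl ?ltr_wpDl//.
  by near: h; apply: nbhs0_le; rewrite mulr_gt0// invr_gt0 ltr_wpDl.
have dE := diff_unique cL FE.
apply: DiffDef; last by rewrite dE.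
by apply/diff_locallyP; rewrite dE.
Unshelve. all: by end_near. Qed.

Lemma taylor_continuous F L (K : R) : 0 <= K ->
  (forall z a u v, L z (a *: u + v) = a * L z u + L z v) ->
  (forall z h, `|L z h| <= K * `|h|) ->
  (forall z h, `|h| <= 1 -> `|F (z + h) - F z - L z h| <= K * `|h| ^+ 2) ->
  forall v, continuous (fun z => L z v).
Proof.
move=> K0 linL Lbd FT v z; apply/cvgrPdist_le => e e0.
pose t := Num.min (1 / (`|v| + 1)) (e / 2 / (2 * K * `|v| ^+ 2 + 1)).
have d0 : 0 < 2 * K * `|v| ^+ 2 + 1 by rewrite ltr_wpDl// !mulr_ge0// exprn_ge0.
have t0 : 0 < t by rewrite lt_min !divr_gt0// ltr_wpDl.
have tv : `|t *: v| <= 1.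
  rewrite normrZ (gtr0_norm t0) (@le_trans _ _ (1 / (`|v| + 1) * `|v|))//.
    by rewrite ler_wpM2r// ge_min lexx.
  by rewrite mulrAC mul1r ler_pdivrMr ?ltr_wpDl// mul1r lerDl.
have tKv : 2 * K * `|v| ^+ 2 * t <= e / 2.
  rewrite (@le_trans _ _ (2 * K * `|v| ^+ 2 * (e / 2 / (2 * K * `|v| ^+ 2 + 1))))//.
    by rewrite ler_wpM2l ?mulr_ge0 ?exprn_ge0// ge_min lexx orbT.
  rewrite mulrA ler_pdivrMr// mulrC ler_wpM2l ?lerDl//.
  by rewrite divr_ge0// ltW.
have LZ y : L y (t *: v) = t * L y v.
  have L0 : L y 0 = 0.
    by have := linL y 1 0 0; rewrite scaler0 addr0 mul1r => /eqP; rewrite addrC -subr_eq subrr => /eqP.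
  by have := linL y t v 0; rewrite addr0 => ->; rewrite L0 addr0.
have lip a b : `|b - a| <= 1 -> `|F b - F a| <= 2 * K * `|b - a|.
  move=> ba1; have := FT a (b - a) ba1; rewrite [a + _]addrC subrK => h1.
  have -> : F b - F a = (F b - F a - L a (b - a)) + L a (b - a) by ring.
  rewrite (le_trans (ler_normD _ _))// mulr2n !mulrDl mul1r lerD//.
  by rewrite (le_trans h1)// ler_wpM2l// expr2 ler_piMl.
near=> y.
have yz1 : `|y - z| <= 1 by rewrite distrC; near: y; apply: cvgr_dist_le.
have h1 := lip z y yz1.
have h2 : `|F (y + t *: v) - F (z + t *: v)| <= 2 * K * `|y - z|.
  have -> : y - z = (y + t *: v) - (z + t *: v) by rewrite opprD addrACA subrr addr0.
  by apply: lip; rewrite opprD addrACA subrr addr0.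
have h3 := FT z (t *: v) tv; have h4 := FT y (t *: v) tv.
rewrite -(ler_pM2l t0) -{1}(gtr0_norm t0) -normrM mulrBr -!LZ.
have nt : K * `|t *: v| ^+ 2 = K * `|v| ^+ 2 * t * t.
  by rewrite normrZ (gtr0_norm t0) exprMn; ring.
rewrite nt in h3 h4.
have -> : L z (t *: v) - L y (t *: v) =
  (F (y + t *: v) - F y - L y (t *: v)) - (F (z + t *: v) - F z - L z (t *: v))
  - ((F (y + t *: v) - F (z + t *: v)) - (F y - F z)) by ring.
rewrite (le_trans (ler_normB _ _))//.
have b1 := le_trans (ler_normB _ _) (lerD h4 h3).
have b2 := le_trans (ler_normB _ _) (lerD h2 h1).
apply: (le_trans (lerD b1 b2)).
have small : 4 * K * `|y - z| <= t * (e / 2).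
  apply: (@le_trans _ _ ((4 * K + 1) * `|z - y|)).
    by rewrite distrC ler_wpM2r// lerDl.
  rewrite -ler_pdivlMl ?ltr_wpDl// ?mulr_ge0//.
  by near: y; apply: cvgr_dist_le => //; rewrite !mulr_gt0// ?invr_gt0 ?ltr_wpDl// ?mulr_ge0// divr_gt0.
have := ler_wpM2l (ltW t0) tKv; move: small.
set A := K * `|y - z|; set B := K * `|v| ^+ 2.
have -> : 4 * K * `|y - z| = 4 * A by rewrite mulrA.
have -> : 2 * K * `|y - z| = 2 * A by rewrite mulrA.
have -> : 2 * K * `|v| ^+ 2 = 2 * B by rewrite -mulrA.
lra.
Unshelve. all: by end_near. Qed.

End taylor.

Section C1_calculus.
Context {R : realType} {V : normedModType R}.
Implicit Types (f g : V -> R) (Df Dg : V -> V -> R).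

Definition is_C1 f Df :=
  (forall z, is_diff z f (Df z)) /\ (forall v, continuous (fun z => Df z v)).

Lemma is_C1_continuous f Df : is_C1 f Df -> continuous f.
Proof. by move=> [df _] z; apply: differentiable_continuous; exact: ex_diff. Qed.

Lemma is_C1_ext f Df Df' : (forall z v, Df z v = Df' z v) -> is_C1 f Df -> is_C1 f Df'.
Proof. by move=> e; rewrite (_ : Df' = Df)//; apply/funext => z; apply/funext => v. Qed.

Lemma is_C1_cst (c : R) : is_C1 (cst c) (fun _ _ => 0).
Proof.
split; last by move=> v; exact: cst_continuous.
by move=> z; apply: (is_diff_eq (is_diff_cst c z)).
Qed.

Lemma is_C1D f g Df Dg : is_C1 f Df -> is_C1 g Dg ->
  is_C1 (fun z => f z + g z) (fun z v => Df z v + Dg z v).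
Proof.
move=> [df cf] [dg cg]; split.
  by move=> z; have := df z; have := dg z => ? ?; exact: is_diffD.
by move=> v z; apply: cvgD; [exact: cf|exact: cg].
Qed.

Lemma is_C1M f g Df Dg : is_C1 f Df -> is_C1 g Dg ->
  is_C1 (fun z => f z * g z) (fun z v => f z * Dg z v + g z * Df z v).
Proof.
move=> Cf Cg; have [df cf] := Cf; have [dg cg] := Cg; split.
  move=> z; have := df z; have := dg z => ? ?.
  exact: (is_diff_eq (is_diffM _ _)).
move=> v z; apply: cvgD; apply: cvgM.
- exact: (is_C1_continuous Cf).
- exact: cg.
- exact: (is_C1_continuous Cg).
- exact: cf.
Qed.

Lemma is_C1_sum n (f : 'I_n -> V -> R) (Df : 'I_n -> V -> V -> R) :
  (forall i, is_C1 (f i) (Df i)) ->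
  is_C1 (fun z => \sum_(i < n) f i z) (fun z v => \sum_(i < n) Df i z v).
Proof.
elim: n f Df => [|n IHn] f Df Cf.
  rewrite (_ : (fun z => _) = cst 0); last by apply/funext => z; rewrite big_ord0.
  apply: is_C1_ext (is_C1_cst 0) => z v; first by rewrite big_ord0.
rewrite (_ : (fun z => _) =
    (fun z => \sum_(i < n) f (widen_ord (leqnSn n) i) z + f ord_max z)); last first.
  by apply/funext => z; rewrite big_ord_recr.
apply: (is_C1_ext _ (is_C1D (IHn _ _ (fun i => Cf (widen_ord (leqnSn n) i))) (Cf ord_max))).
by move=> z v; rewrite [RHS]big_ord_recr.
Qed.

Lemma is_C1_linear (l : V -> R) (K : R) :
  (forall a u v, l (a *: u + v) = a * l u + l v) -> (forall h, `|l h| <= K * `|h|) ->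
  is_C1 l (fun _ v => l v).
Proof.
move=> linl lK; split; last by move=> v; exact: cst_continuous.
have lD u v : l (u + v) = l u + l v by have := linl 1 u v; rewrite scale1r mul1r.
move=> z; apply: (@is_diff_taylor R V l l `|K|) => //.
  by move=> h; rewrite (le_trans (lK h))// ler_wpM2r// ler_norm.
move=> h _; have -> : l (z + h) - l z - l h = 0 by rewrite lD; ring.
by rewrite normr0 mulr_ge0// exprn_ge0.
Qed.

Lemma is_C1_comp f Df (h h' : R -> R) : is_C1 f Df ->
  (forall z, is_derive (f z) (1 : R) h (h' (f z))) ->
  (forall z, {for f z, continuous h'}) ->
  is_C1 (fun z => h (f z)) (fun z v => h' (f z) * Df z v).
Proof.
move=> Cf dh ch; have [df cf] := Cf; split.
  move=> z; have := df z => dfz.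
  have [dhz hz] := dh z.
  have dd : differentiable h (f z) by exact/derivable1_diffP.
  have dhd : is_diff (f z) h ('d h (f z)) by exact: differentiableP.
  apply: (is_diff_eq (@is_diff_comp R V _ _ f (Df z) h _ z dfz dhd)); apply/funext => v /=.
  by rewrite diff1E// derive1E hz mulrC.
move=> v z; apply: cvgM; last exact: cf.
by apply: (continuous_comp (is_C1_continuous Cf (x := z))); exact: ch.
Qed.

End C1_calculus.

Section pospart.
Context {R : realType}.

Definition pos (s : R) : R := Num.max 0 s.
(** The square of the positive part: a C^1 cutoff profile. *)
Definition pos2 (s : R) : R := pos s ^+ 2.

Lemma pos_ge0 s : 0 <= pos s. Proof. by rewrite le_max lexx. Qed.
Lemma pos2_ge0 s : 0 <= pos2 s. Proof. by rewrite exprn_ge0// pos_ge0. Qed.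
Lemma pos_id s : 0 <= s -> pos s = s. Proof. by move=> s0; exact/max_idPr. Qed.
Lemma pos_eq0 s : s <= 0 -> pos s = 0. Proof. by move=> s0; exact/max_idPl. Qed.

Lemma pos2_taylor s r : `|pos2 (s + r) - pos2 s - 2 * pos s * r| <= r ^+ 2.
Proof.
rewrite /pos2 ler_norml; have [s0|s0] := leP 0 s; have [sr|sr] := leP 0 (s + r).
- by rewrite !pos_id//; apply/andP; split; nra.
- by rewrite (pos_id s0) (pos_eq0 (ltW sr)); apply/andP; split; nra.
- by rewrite (pos_id sr) (pos_eq0 (ltW s0)); apply/andP; split; nra.
- by rewrite (pos_eq0 (ltW sr)) (pos_eq0 (ltW s0)); apply/andP; split; nra.
Qed.

Lemma pos_continuous : continuous pos.
Proof.
move=> s; apply: (@continuous_max R R (cst 0) id s).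
  exact: cst_continuous.
exact: cvg_id.
Qed.

Lemma is_derive_pos2 s : is_derive s (1 : R) pos2 (2 * pos s).
Proof.
have [] : is_diff s pos2 (fun h : R => 2 * pos s * h).
  apply: (@is_diff_taylor R R pos2 _ (2 * pos s + 1)).
  - by move=> a u v; rewrite mulrDr; congr (_ + _); rewrite mulrCA.
  - move=> h; rewrite normrM ger0_norm ?mulr_ge0 ?pos_ge0//.
    by rewrite ler_wpM2r// lerDl.
  - move=> h _; rewrite (le_trans (pos2_taylor s h))// real_normK ?num_real//.
    by rewrite ler_peMl ?sqr_ge0// lerDr mulr_ge0// pos_ge0.
move=> dd de; apply: DeriveDef; first exact: diff_derivable.
by rewrite deriveE// de mulr1.
Qed.

End pospart.

Section spacetime_C1.
Context {R : realType} {N : nat}.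
Local Notation X := ('rV[R]_N * R)%type.

Lemma is_C1_C1 (f : X -> R) Df : is_C1 f Df -> C1 f.
Proof.
move=> [df cf]; split; first by move=> z; exact: ex_diff.
move=> v; rewrite (_ : (fun z => _) = (fun z => Df z v)); first exact: cf.
by apply/funext => z; have [h1 h2] := df z; rewrite deriveE// h2.
Qed.

Lemma is_C1_derive (f : X -> R) Df z v : is_C1 f Df -> 'D_v f z = Df z v.
Proof. by move=> [df _]; have [h1 h2] := df z; rewrite deriveE// h2. Qed.

Lemma is_C1_space i : is_C1 (fun z : X => z.1 ord0 i) (fun _ v => v.1 ord0 i).
Proof.
apply: (@is_C1_linear R _ _ 1); first by move=> a u v; rewrite !mxE.
by move=> h; rewrite mul1r ler_norm_space.
Qed.

Lemma is_C1_time : is_C1 (fun z : X => z.2) (fun _ v => v.2).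
Proof.
apply: (@is_C1_linear R _ _ 1) => //.
by move=> h; rewrite mul1r ler_norm_time.
Qed.

(** The Euclidean scalar product of space-time. *)
Definition stdot (y h : X) : R := dot y.1 h.1 + y.2 * h.2.

Lemma ler_stdot y h : `|stdot y h| <= N.+1%:R * (`|y| * `|h|).
Proof.
have e : N.+1%:R * (`|y| * `|h|) = \sum_(i < N) `|y| * `|h| + `|y| * `|h|.
  by rewrite sumr_const card_ord -mulrSr mulr_natl.
rewrite e /stdot (le_trans (ler_normD _ _))// lerD//; last first.
  by rewrite normrM ler_pM// ler_norm_time.
rewrite (le_trans (ler_norm_sum _ _ _))//; apply: ler_sum => i _.
by rewrite normrM ler_pM// ler_norm_space.
Qed.

Lemma stdotC y h : stdot y h = stdot h y.
Proof.
rewrite /stdot mulrC; congr (_ + _); apply: eq_bigr => i _; exact: mulrC.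
Qed.

Lemma stdotD y h k : stdot y (h + k) = stdot y h + stdot y k.
Proof.
rewrite /stdot /= mulrDr addrACA; congr (_ + _); rewrite /dot -big_split/=.
by apply: eq_bigr => i _; rewrite mxE mulrDr.
Qed.

Lemma stdotZ y (a : R) h : stdot y (a *: h) = a * stdot y h.
Proof.
rewrite /stdot /= mulrDr; congr (_ + _); last by rewrite mulrCA.
by rewrite /dot mulr_sumr; apply: eq_bigr => i _; rewrite mxE mulrCA.
Qed.

Lemma stdot_ge0 y : 0 <= stdot y y.
Proof.
by rewrite addr_ge0 -?expr2 ?sqr_ge0//; apply: sumr_ge0 => i _; rewrite -expr2 sqr_ge0.
Qed.

Lemma sqr_norm_le_stdot (y : X) : `|y| ^+ 2 <= stdot y y.
Proof.
have sq : `|y| <= Num.sqrt (stdot y y).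
  have sp i : `|y.1 ord0 i| <= Num.sqrt (stdot y y).
    rewrite -(sqrtr_sqr (y.1 ord0 i)) ler_wsqrtr// /stdot /dot (bigD1 i)//=.
    rewrite -addrA -expr2 lerDl addr_ge0 -?expr2 ?sqr_ge0//.
    by apply: sumr_ge0 => j _; rewrite -expr2 sqr_ge0.
  rewrite prod_normE ge_max; apply/andP; split; last first.
    rewrite -(sqrtr_sqr y.2) ler_wsqrtr// /stdot -expr2 lerDr.
    by apply: sumr_ge0 => j _; rewrite -expr2 sqr_ge0.
  rewrite [leLHS]mx_normrE; apply: bigmax_le; first exact: sqrtr_ge0.
  by move=> [a j] _ /=; rewrite ord1; exact: sp.
rewrite -(sqr_sqrtr (stdot_ge0 y)).
by rewrite lerXn2r ?nnegrE ?sqrtr_ge0.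
Qed.

Lemma is_C1_stdot : is_C1 (fun z : X => stdot z z) (fun z v => 2 * stdot z v).
Proof.
apply: (is_C1_ext _ (is_C1D (is_C1_sum (fun i => is_C1M (is_C1_space i) (is_C1_space i)))
  (is_C1M is_C1_time is_C1_time))).
move=> z v; rewrite /stdot mulr2n mulrDl mul1r addrACA; congr (_ + _).
by rewrite /dot -big_split.
Qed.

Definition stbump (lam : R) (y : X) : R := pos2 (1 - lam ^+ 2 * stdot y y).
Definition dstbump (lam : R) (y h : X) : R :=
  - (4 * lam ^+ 2) * pos (1 - lam ^+ 2 * stdot y y) * stdot y h.

Lemma is_C1_bump lam : is_C1 (stbump lam) (dstbump lam).
Proof.
have C := is_C1D (is_C1_cst 1) (is_C1M (is_C1_cst (- lam ^+ 2)) is_C1_stdot).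
have := @is_C1_comp R _ _ _ pos2 (fun s => 2 * pos s) C (fun z => is_derive_pos2 _)
  (fun z => _).
have -> : (fun z : X => pos2 (cst 1 z + cst (- lam ^+ 2) z * stdot z z)) = stbump lam.
  by apply/funext => z; rewrite /stbump /= mulNr.
move=> h; apply: (is_C1_ext _ (h _)); last first.
  move=> z; apply: (@continuousM R _ (cst 2) pos); first exact: cst_continuous.
  exact: pos_continuous.
move=> z v; rewrite /dstbump /= mulNr mulr0 add0r addr0; ring.
Qed.

Section bump_bounds.
Variables (lam : R) (lam0 : 0 < lam).

Lemma bump_arg_le0 (y : X) : lam^-1 <= `|y| -> 1 - lam ^+ 2 * stdot y y <= 0.
Proof.
move=> ly; rewrite subr_le0.
have h : lam^-1 ^+ 2 <= stdot y y.
  apply: le_trans (sqr_norm_le_stdot y).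
  by rewrite lerXn2r// nnegrE// invr_ge0 ltW.
have := ler_wpM2l (sqr_ge0 lam) h.
by rewrite -exprMn divff ?expr1n// gt_eqF.
Qed.

Lemma bump_supp (y : X) : lam^-1 <= `|y| -> stbump lam y = 0.
Proof. by move=> ly; rewrite /stbump /pos2 pos_eq0 ?expr0n// bump_arg_le0. Qed.

Lemma pos_arg_le1 (y : X) : pos (1 - lam ^+ 2 * stdot y y) <= 1.
Proof.
rewrite /pos ge_max ler01/= gerBl mulr_ge0 ?sqr_ge0//; exact: stdot_ge0.
Qed.

Lemma bump_le1 (y : X) : stbump lam y <= 1.
Proof. by rewrite /stbump /pos2 exprn_ile1// ?pos_ge0 ?pos_arg_le1. Qed.

Lemma dbump_linear (y : X) a u v : dstbump lam y (a *: u + v) = a * dstbump lam y u + dstbump lam y v.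
Proof. rewrite /dstbump stdotD stdotZ; ring. Qed.

Let M : R := lam^-1 + 1.
Let n1 : R := N.+1%:R.

Lemma bump_taylor : exists2 K, 0 <= K &
  (forall (y h : X), `|dstbump lam y h| <= K * `|h|) /\
  (forall (y h : X), `|h| <= 1 ->
     `|stbump lam (y + h) - stbump lam y - dstbump lam y h| <= K * `|h| ^+ 2).
Proof.
have M0 : 0 <= M by rewrite addr_ge0// invr_ge0 ltW.
have n10 : 0 <= n1 by [].
have [l lE] : exists l, l = lam ^+ 2 by exists (lam ^+ 2).
have l2 : 0 <= l by rewrite lE sqr_ge0.
pose K1 := 4 * l * (n1 * M).
pose K2 := (l * (2 * n1 * M + n1)) ^+ 2 + 2 * (l * n1).
have K10 : 0 <= K1 by rewrite !mulr_ge0.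
have K20 : 0 <= K2 by rewrite addr_ge0 ?sqr_ge0// !mulr_ge0.
exists (K1 + K2); first exact: addr_ge0.
split=> [y h|y h h1].
  have [yM|/ltW yM] := leP `|y| M; last first.
    rewrite /dstbump (pos_eq0 (bump_arg_le0 _)); last by rewrite (le_trans _ yM)// lerDl.
    by rewrite mulr0 mul0r normr0 mulr_ge0// addr_ge0.
  rewrite /dstbump -lE normrM normrM normrN (ger0_norm (pos_ge0 _)).
  rewrite (@ger0_norm _ (4 * l)) ?mulr_ge0//.
  apply: (@le_trans _ _ (K1 * `|h|)); last by rewrite ler_wpM2r// lerDl.
  rewrite /K1 -!mulrA ler_wpM2l// ler_wpM2l//.
  apply: (@le_trans _ _ (1 * (n1 * (`|y| * `|h|)))).
    by rewrite ler_pM// ?pos_ge0 ?lE ?pos_arg_le1// ler_stdot.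
  by rewrite mul1r ler_wpM2l// ler_wpM2r.
have [yM|/ltW yM] := leP `|y| M; last first.
  have y1 : lam^-1 <= `|y| by rewrite (le_trans _ yM)// lerDl.
  have y2 : lam^-1 <= `|y + h|.
    have := ler_normB (y + h) h; rewrite addrK => yy.
    rewrite -(lerD2r 1) (le_trans yM)// (le_trans yy)// lerD2l//.
  rewrite (bump_supp y1) (bump_supp y2) /dstbump (pos_eq0 (bump_arg_le0 y1)).
  by rewrite mulr0 mul0r !subr0 normr0 mulr_ge0 ?exprn_ge0// addr_ge0.
pose s := 1 - l * stdot y y.
pose r := - (l * (2 * stdot y h + stdot h h)).
have sE : 1 - l * stdot (y + h) (y + h) = s + r.
  rewrite stdotD (stdotC (y + h) y) (stdotC (y + h) h) !stdotD (stdotC h y) /s /r; ring.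
have -> : stbump lam (y + h) - stbump lam y - dstbump lam y h =
   (pos2 (s + r) - pos2 s - 2 * pos s * r) - 2 * pos s * (l * stdot h h).
  rewrite /stbump /dstbump -lE sE -/s /r; ring.
rewrite (le_trans (ler_normB _ _))//.
apply: (@le_trans _ _ (K2 * `|h| ^+ 2)); last first.
  by rewrite ler_wpM2r ?exprn_ge0// lerDr.
rewrite /K2 [leRHS]mulrDl lerD//.
  rewrite (le_trans (pos2_taylor s r))// -exprMn -(real_normK (num_real r)).
  rewrite lerXn2r ?nnegrE// ?mulr_ge0 ?addr_ge0// ?mulr_ge0//.
  rewrite /r normrN normrM (ger0_norm l2) -[leRHS]mulrA ler_wpM2l//.
  rewrite (le_trans (ler_normD _ _))// [leRHS]mulrDl lerD//.
    rewrite normrM ger0_norm// -!mulrA ler_wpM2l//.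
    rewrite (le_trans (ler_stdot _ _))// ler_wpM2l// ler_wpM2r//.
  rewrite (le_trans (ler_stdot _ _))// ler_wpM2l// ler_piMl//.
rewrite !normrM (ger0_norm (pos_ge0 _)) (ger0_norm l2) (ger0_norm (stdot_ge0 h)) ger0_norm//.
rewrite -!mulrA ler_wpM2l//.
rewrite (@le_trans _ _ (1 * (l * stdot h h)))//.
  by rewrite ler_wpM2r ?mulr_ge0 ?stdot_ge0// /s lE pos_arg_le1.
rewrite mul1r ler_wpM2l//.
by rewrite -[stdot h h]ger0_norm ?stdot_ge0// (le_trans (ler_stdot _ _)).
Qed.

End bump_bounds.

End spacetime_C1.

Section bounded_multipliers.
Context d (T : measurableType d) {R : realType} (mu : {measure set T -> \bar R}).

Lemma measurable_abs (f : T -> R) : measurable_fun setT f ->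
  measurable_fun setT (fun y => `|f y|).
Proof. by move=> mf; exact: (measurableT_comp (@normr_measurable R setT)). Qed.

Lemma integrable_bounded_mul (f k : T -> R) (B : R) :
  measurable_fun setT f -> measurable_fun setT k ->
  (\int[mu]_y `|f y|%:E < +oo)%E -> (forall y, `|k y| <= B) ->
  mu.-integrable setT (EFin \o (fun y => f y * k y)).
Proof.
move=> mf mk foo kB.
have mfk : measurable_fun setT (fun y => f y * k y) by exact: measurable_funM.
apply/(integrable_nnint mu mfk).
have [[t0 _]|/forallNP noT] := pselect (exists t : T, True); last first.
  rewrite (_ : (\int[mu]_y _)%E = 0%E) ?ltry//.
  by apply: integral0_eq => y; have := noT y.
have B0 : 0 <= B by apply: le_trans (kB t0).
have mabs := measurable_abs mf.
apply: (@le_lt_trans _ _ (\int[mu]_y (B * `|f y|)%:E)%E).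
  apply: nnint_le => //.
  - exact: measurable_abs.
  - exact: measurable_funM.
  - by move=> y; rewrite normrM mulrC ler_wpM2r.
by rewrite nnintZ// lte_mul_pinfty// ?lee_fin// fin_numE.
Qed.

Lemma le_Rint_bound (f k : T -> R) (B c : R) :
  measurable_fun setT f -> measurable_fun setT k ->
  0 <= B -> (\int[mu]_y `|f y|%:E = c%:E)%E -> (forall y, `|k y| <= B) ->
  `|\int[mu]_y (f y * k y)| <= B * c.
Proof.
move=> mf mk B0 fc kB.
have ifk : mu.-integrable setT (EFin \o (fun y => f y * k y)).
  by apply: integrable_bounded_mul kB => //; rewrite fc ltry.
apply: le_trans (le_normr_Rintegral measurableT ifk) _.
rewrite -lee_fin /Rintegral fineK; last first.
  rewrite ge0_fin_numE; first by move/integrableP : ifk => [].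
  by apply: integral_ge0 => y _; rewrite lee_fin.
rewrite EFinM -fc -nnintZ//; last exact: measurable_abs.
apply: nnint_le => //.
- by apply: measurable_abs; exact: measurable_funM.
- by apply: measurable_funM => //; exact: measurable_abs.
- by move=> y; rewrite normrM mulrC ler_wpM2r.
Qed.

End bounded_multipliers.

Section mollifier.
Context {R : realType} {N : nat}.
Local Notation ST := ('rV[R]_N * measurableTypeR R)%type.
Local Notation X := ('rV[R]_N * R)%type.
Local Notation mu := (@spacetime_measure R N).

Lemma measurable_stdot (f g : ST -> ST) :
  measurable_fun setT f -> measurable_fun setT g ->
  measurable_fun setT (fun w => stdot (f w : X) (g w : X)).
Proof.
move=> mf mg; apply: measurable_funD.
  apply: measurable_sum => i; apply: measurable_funM.
    exact: (measurableT_comp (measurable_space_coord i) mf).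
  exact: (measurableT_comp (measurable_space_coord i) mg).
apply: measurable_funM.
  exact: (measurableT_comp measurable_time_coord mf).
exact: (measurableT_comp measurable_time_coord mg).
Qed.

Lemma measurable_pos : measurable_fun setT (pos : R -> R).
Proof. by apply: measurable_maxr. Qed.

Variable lam : R.
Hypothesis lam0 : 0 < lam.

Let marg : measurable_fun setT (fun w : ST => pos (1 - lam ^+ 2 * stdot (w : X) (w : X))).
Proof.
apply: (measurableT_comp measurable_pos); apply: measurable_funB => //.
by apply: measurable_funM => //; exact: measurable_stdot.
Qed.

Lemma measurable_bump : measurable_fun setT (stbump lam : ST -> R).
Proof. exact: (measurable_funX 2 marg). Qed.

Lemma measurable_dbump (h : X) :
  measurable_fun setT (fun w : ST => dstbump lam (w : X) h).
Proof.
apply: measurable_funM; first by apply: measurable_funM.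
exact: (@measurable_stdot id (cst (h : ST))).
Qed.

Lemma stbox_measure r a b : 0 <= r -> a <= b ->
  mu (stbox r a b : set ST) = ((2 * r) ^+ N * (b - a))%:E.
Proof.
have itv (c e : R) : c <= e ->
    lebesgue_measure (`[c, e]%classic : set (measurableTypeR R)) = (e - c)%:E.
  move=> ce; rewrite lebesgue_measure_itv/= lte_fin; case: ltP => // ec.
  have -> : c = e by apply/eqP; rewrite eq_le ce.
  by rewrite subrr.
move=> r0 ab; rewrite stboxE (@spacetime_measure_prod R N (fun=> `[-r, r]%classic))//.
rewrite (itv _ _ ab) EFinM; congr (_ * _)%E.
elim: (N) => [|n IHn]; first by rewrite big_ord0.
rewrite big_ord_recr exprSr EFinM; congr (_ * _)%E; first exact: IHn.
by rewrite itv; [congr EFin; ring | lra].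
Qed.

Lemma bump_mass : exists2 c : R, 0 < c & (\int[mu]_y (stbump lam y)%:E = c%:E)%E.
Proof.
have mb := measurable_bump.
pose r := lam^-1; have r0 : 0 < r by rewrite invr_gt0.
have fin : (\int[mu]_y (stbump lam y)%:E < +oo)%E.
  apply: (@le_lt_trans _ _ (\int[mu]_y (\1_(stbox r (- r) r : set ST) y)%:E)%E).
    apply: nnint_le => //.
    - by apply: measurable_indic; exact: measurable_stbox.
    - by move=> z; exact: pos2_ge0.
    - move=> z; rewrite indicE; have [zr|zr] := leP `|z : X| r.
        rewrite mem_set ?bump_le1//; split.
          by move=> i; rewrite (le_trans (ler_norm_space z i)).
        by rewrite -ler_norml (le_trans (ler_norm_time z)).
      by rewrite (bump_supp lam0 (ltW zr)).
  rewrite integral_indic//; last exact: measurable_stbox.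
  by rewrite setIT; exact: stbox_ltoo.
have [c c0 cE] := nnint_fine (fun z : ST => pos2_ge0 (1 - lam ^+ 2 * stdot (z : X) (z : X))) fin.
exists c => //; rewrite lt_neqAle c0 andbT eq_sym; apply/eqP => c00.
pose n2 : R := N.+2%:R; have n20 : 0 < n2 by [].
pose s := (lam * n2)^-1; have s0 : 0 < s by rewrite invr_gt0 mulr_gt0.
suff : (0 < \int[mu]_y (stbump lam y)%:E)%E.
  by rewrite (_ : (\int[mu]_y _)%E = c%:E)%E// c00 ltxx.
apply: (@lt_le_trans _ _ ((1 / 4)%:E * mu (stbox s (- s) s : set ST))%E).
  rewrite stbox_measure ?(ltW s0)//; last by rewrite ge0_cp// ltW.
  rewrite -EFinM lte_fin !mulr_gt0// ?exprn_gt0 ?mulr_gt0//; last lra.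
have mbox := @measurable_stbox R N s (- s) s.
have <- : (\int[mu]_y (1 / 4 * \1_(stbox s (- s) s : set ST) y)%:E =
    (1 / 4)%:E * mu (stbox s (- s) s : set ST))%E.
  rewrite nnintZ; [|exact: measurable_indic|by []|by lra].
  by rewrite integral_indic// setIT.
apply: nnint_le.
- by apply: measurable_funM => //; exact: measurable_indic.
- exact: mb.
- by move=> z; rewrite mulr_ge0//; lra.
move=> z; rewrite indicE; have [[zi zt]|zs] := pselect (stbox s (- s) s z); last first.
  by rewrite memNset// mulr0 pos2_ge0.
rewrite mem_set// mulr1.
have qz : stdot (z : X) z <= N.+1%:R * s ^+ 2.
  have -> : N.+1%:R * s ^+ 2 = \sum_(i < N) s ^+ 2 + s ^+ 2.
    by rewrite sumr_const card_ord -mulrSr mulr_natl.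
  rewrite /stdot lerD//.
    apply: ler_sum => i _; rewrite -expr2 -real_normK ?num_real//.
    by rewrite lerXn2r ?nnegrE ?(ltW s0).
  rewrite -expr2 -real_normK ?num_real// lerXn2r ?nnegrE ?(ltW s0)//.
  by rewrite ler_norml.
have lq : lam ^+ 2 * stdot (z : X) z <= 1 / 2.
  apply: (le_trans (ler_wpM2l (sqr_ge0 lam) qz)).
  have -> : lam ^+ 2 * (N.+1%:R * s ^+ 2) = N.+1%:R / n2 ^+ 2.
    by rewrite /s; field; rewrite !gt_eqF.
  rewrite ler_pdivrMr ?exprn_gt0// mul1r ler_pdivlMl//.
  have -> : n2 = N.+1%:R + 1 by rewrite natr1.
  have : (0 : R) <= N.+1%:R by [].
  by move: (N.+1%:R : R) => x x0; nra.
rewrite /stbump /pos2 pos_id; last lra.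
apply: (@le_trans _ _ ((1 / 2) ^+ 2)); first by rewrite expr2; lra.
by rewrite lerXn2r ?nnegrE//; lra.
Qed.

End mollifier.

Section smooth_mollification.
Context {R : realType} {N : nat}.
Local Notation ST := ('rV[R]_N * measurableTypeR R)%type.
Local Notation X := ('rV[R]_N * R)%type.
Local Notation mu := (@spacetime_measure R N).

Definition bump_const (lam : R) : R := fine (\int[mu]_y (stbump lam y)%:E).
Definition molk (lam : R) (y : X) : R := (bump_const lam)^-1 * stbump lam y.
Definition dmolk (lam : R) (y h : X) : R := (bump_const lam)^-1 * dstbump lam y h.

Variable lam : R.
Hypothesis lam0 : 0 < lam.

Lemma bump_constE : (\int[mu]_y (stbump lam y)%:E = (bump_const lam)%:E)%E.
Proof.
by have [c c0 cE] := @bump_mass R N lam lam0; rewrite /bump_const cE.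
Qed.

Lemma bump_const_gt0 : 0 < bump_const lam.
Proof.
by have [c c0 cE] := @bump_mass R N lam lam0; rewrite /bump_const cE.
Qed.

Lemma molk_kernel : kernel_of_radius lam^-1 (molk lam : ST -> R).
Proof.
have c0 := bump_const_gt0; have mb := @measurable_bump R N lam.
have b0 (y : X) : 0 <= stbump lam y by exact: pos2_ge0.
have ic0 : 0 <= (bump_const lam)^-1 by rewrite invr_ge0 ltW.
split.
- exact: measurable_funM.
- by move=> y; rewrite mulr_ge0.
- exists (bump_const lam)^-1 => y.
  by rewrite /molk -[leRHS]mulr1 ler_wpM2l// bump_le1.
- by move=> y ly; rewrite /molk (bump_supp lam0 ly) mulr0.
- by rewrite nnintZ// bump_constE -EFinM mulVf// gt_eqF.
Qed.

Lemma dmolk_linear (y : X) a u v :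
  dmolk lam y (a *: u + v) = a * dmolk lam y u + dmolk lam y v.
Proof. by rewrite /dmolk dbump_linear; ring. Qed.

Lemma dmolkN (y h : X) : dmolk lam y (- h) = - dmolk lam y h.
Proof.
have d0 : dmolk lam y 0 = 0.
  have := dmolk_linear y 1 0 0; rewrite scaler0 addr0 mul1r => h0.
  by apply: (addrI (dmolk lam y 0)); rewrite addr0 -h0.
by rewrite -[- h]addr0 -scaleN1r dmolk_linear d0 mulN1r addr0.
Qed.

Lemma dmolk_supp (y h : X) : lam^-1 <= `|y| -> dmolk lam y h = 0.
Proof.
move=> ly; rewrite /dmolk /dstbump pos_eq0 ?mulr0 ?mul0r ?mulr0//.
exact: bump_arg_le0.
Qed.

Lemma measurable_dmolk (h : X) : measurable_fun setT (fun w : ST => dmolk lam (w : X) h).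
Proof. by apply: measurable_funM => //; exact: measurable_dbump. Qed.

Lemma molk_taylor : exists2 K, 0 <= K &
  (forall (y h : X), `|dmolk lam y h| <= K * `|h|) /\
  (forall (y h : X), `|h| <= 1 ->
     `|molk lam (y + h) - molk lam y - dmolk lam y h| <= K * `|h| ^+ 2).
Proof.
have [K K0 [K1 K2]] := @bump_taylor R N lam lam0.
have ic0 : 0 <= (bump_const lam)^-1 by rewrite invr_ge0 ltW// bump_const_gt0.
exists ((bump_const lam)^-1 * K); first by rewrite mulr_ge0.
split=> [y h|y h h1].
  by rewrite /dmolk normrM ger0_norm// -mulrA ler_wpM2l.
rewrite /molk /dmolk -!mulrBr normrM ger0_norm// -mulrA ler_wpM2l//.
exact: K2.
Qed.

(** The kernel centred at [z], as a test function of the other variable. *)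
Lemma is_C1_molk_shift (z : X) :
  is_C1 (fun w : X => molk lam (w - z)) (fun w h => dmolk lam (w - z) h).
Proof.
have [K K0 [K1 K2]] := molk_taylor.
have taylor w h : `|h| <= 1 ->
    `|molk lam (w + h - z) - molk lam (w - z) - dmolk lam (w - z) h| <= K * `|h| ^+ 2.
  move=> h1; rewrite (_ : w + h - z = (w - z) + h); last by rewrite addrAC.
  exact: K2.
split=> [w|].
  apply: (@is_diff_taylor R _ _ _ K) => //; last exact: taylor.
  by move=> a u v; exact: dmolk_linear.
apply: (@taylor_continuous R _ (fun w : X => molk lam (w - z)) _ K) => //.
by move=> w a u v; exact: dmolk_linear.
Qed.

Section mollified_C1.
Variables (f : ST -> R) (mf : measurable_fun setT f).
Hypothesis foo : (\int[mu]_y `|f y|%:E < +oo)%E.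

Definition dmollify (z h : X) : R :=
  - \int[mu]_w (f w * dmolk lam ((w : X) - z) h).

Let mm (z : X) : measurable_fun setT (fun w : ST => molk lam ((w : X) - z)).
Proof. exact: (measurable_fun_shift (- z) (kernel_meas molk_kernel)). Qed.

Let md (z h : X) : measurable_fun setT (fun w : ST => dmolk lam ((w : X) - z) h).
Proof. exact: (measurable_fun_shift (- z) (measurable_dmolk h)). Qed.

Let im (z : X) : mu.-integrable setT (EFin \o (fun w : ST => f w * molk lam ((w : X) - z))).
Proof.
have [_ p0 [B pB] _ _] := molk_kernel.
apply: (@integrable_bounded_mul _ _ _ _ _ _ B) => //.
by move=> y; rewrite ger0_norm.
Qed.

Let idm (z h : X) : mu.-integrable setT (EFin \o (fun w : ST => f w * dmolk lam ((w : X) - z) h)).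
Proof.
have [K K0 [K1 K2]] := molk_taylor.
exact: (@integrable_bounded_mul _ _ _ _ _ _ (K * `|h|)).
Qed.

Lemma dmollify_linear z a u v :
  dmollify z (a *: u + v) = a * dmollify z u + dmollify z v.
Proof.
rewrite /dmollify mulrN -opprD; congr (- _).
rewrite -RintegralZl// -RintegralD//; last first.
  rewrite (_ : _ \o _ = (fun w : ST => a%:E * (f w * dmolk lam ((w : X) - z) u)%:E)%E)//.
  exact: (integrableZl measurableT a (idm z u)).
by apply: eq_Rintegral => w _; rewrite dmolk_linear; ring.
Qed.

Lemma is_C1_mollify : is_C1 (mollify (molk lam) f) dmollify.
Proof.
have [K K0 [K1 K2]] := molk_taylor.
have [c c0 cE] := nnint_fine (fun y => normr_ge0 (f y)) foo.
have bd z h : `|dmollify z h| <= (K * c) * `|h|.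
  rewrite /dmollify normrN mulrAC.
  by apply: le_Rint_bound => //; rewrite mulr_ge0.
have taylor z h : `|h| <= 1 ->
    `|mollify (molk lam) f (z + h) - mollify (molk lam) f z - dmollify z h|
      <= (K * c) * `|h| ^+ 2.
  move=> h1; rewrite !(mollify_shiftE _ molk_kernel mf).
  have -> : \int[mu]_w (f w * molk lam ((w : X) - (z + h))) -
     \int[mu]_w (f w * molk lam ((w : X) - z)) - dmollify z h =
     \int[mu]_w (f w * (molk lam ((w : X) - (z + h)) - molk lam ((w : X) - z)
       - dmolk lam ((w : X) - z) (- h))).
    rewrite /dmollify opprK -RintegralB// -RintegralD//; last first.
      exact: (integrableB measurableT (im _) (im _)).
    by apply: eq_Rintegral => w _; rewrite dmolkN; ring.
  rewrite mulrAC; apply: le_Rint_bound => //.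
  - apply: measurable_funB; first exact: measurable_funB.
    exact: md.
  - by rewrite mulr_ge0// exprn_ge0.
  - move=> w; rewrite opprD addrA.
    by rewrite -[X in _ * X ^+ 2]normrN; apply: K2; rewrite normrN.
have Kc0 : 0 <= K * c by rewrite mulr_ge0.
split=> [z|].
  apply: (@is_diff_taylor R _ _ _ (K * c)) => //; last exact: taylor.
  by move=> a u v; exact: dmollify_linear.
apply: (@taylor_continuous R _ (mollify (molk lam) f) _ (K * c)) => //.
by move=> z a u v; exact: dmollify_linear.
Qed.

End mollified_C1.

(** Weak derivatives commute with mollification, away from the boundary. *)
Lemma dmollify_weak (D : set X) (v : X) (u g : ST -> R) (r a b : R) (z : X) :
  measurable_fun setT u -> measurable_fun setT g ->
  weak_derivative D v u g ->
  let C : set X := stbox r a b in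
  C `<=` D ->
  (forall w : X, `|w - z| <= lam^-1 -> C w) ->
  dmollify (fun w => u w * \1_C (w : X)) z v =
  mollify (molk lam) (fun w => g w * \1_C (w : X)) z.
Proof.
move=> mu_ mg wd C CD zC.
have mC : measurable (C : set ST) by exact: measurable_stbox.
have Cz := is_C1_molk_shift z.
have supp : [set w : X | molk lam (w - z) != 0] `<=` C.
  move=> w /=; apply: contraNP => nCw; apply/eqP.
  apply: (kernel_supp molk_kernel); rewrite leNgt; apply/negP => /ltW h.
  exact/nCw/zC.
have cC : compact C by exact: compact_stbox.
have clC : closed C by apply: compact_closed => //; exact: norm_hausdorff.
have tsupp : tsupport (fun w : X => molk lam (w - z)) `<=` C.
  by rewrite [X in _ `<=` X]((closure_id C).1 clC); exact: closure_subset.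
have ctest : C1c D (fun w : X => molk lam (w - z)).
  split; first exact: (is_C1_C1 Cz).
    apply: (subclosed_compact _ cC tsupp); exact: closed_closure.
  exact: subset_trans tsupp CD.
have := wd _ ctest.
rewrite integral_mkcond [in RHS]integral_mkcond => E.
rewrite /dmollify (mollify_shiftE _ molk_kernel); last first.
  by apply: measurable_funM => //; exact: measurable_indic.
have outC (w : X) : ~ C w -> molk lam (w - z) = 0 /\ forall h, dmolk lam (w - z) h = 0.
  move=> nCw; have h : lam^-1 <= `|w - z|.
    by rewrite leNgt; apply/negP => /ltW h; exact/nCw/zC.
  by split => [|k]; [exact: (kernel_supp molk_kernel)|exact: dmolk_supp].
have patch (F G k : X -> R) : (forall w, ~ C w -> k w = 0) ->
   ((fun w => (F w * k w)%:E) \_ D) = (fun w => (F w * \1_C w * k w)%:E).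
  move=> k0; apply/funext => w; rewrite patchE indicE.
  have [Cw|nCw] := pselect (C w).
    by rewrite (mem_set Cw) mem_set ?mulr1//; exact: CD.
  by rewrite (k0 w nCw) !mulr0; case: ifP.
rewrite /Rintegral -fineN; congr fine.
have E1 := patch u u (fun w => 'D_v (fun w' : X => molk lam (w' - z)) w).
have E2 := patch g g (fun w => molk lam (w - z)).
rewrite E1 in E; last first.
  by move=> w nCw; rewrite (is_C1_derive _ _ Cz); apply: (outC w nCw).2.
rewrite E2 in E; last by move=> w nCw; apply: (outC w nCw).1.
rewrite -[RHS]oppeK -E; congr (- _)%E.
by apply: eq_integral => w _; rewrite (is_C1_derive _ _ Cz).
Qed.

End smooth_mollification.

Section profile.
Context {R : realType}.
Variables (del : R) (j : nat).
Hypotheses (del0 : 0 < del) (del1 : del <= 2^-1).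

Definition inv1 (s : R) : R := (1 + s)^-1.
Definition dec (s : R) : R := expR (- del * ln (1 + s)).
Definition rise (s : R) : R := 1 - dec s.
Definition Hf (s : R) : R := s * rise s ^+ j.+2.
Definition gf (s : R) : R :=
  rise s ^+ j.+2 + j.+2%:R * del * (rise s ^+ j.+1 * (dec s * (1 - inv1 s))).
Definition dgf (s : R) : R :=
  j.+2%:R * del * (rise s ^+ j.+1 * (dec s * (inv1 s * (1 + inv1 s - del * (1 - inv1 s)))))
  + j.+2%:R * (j.+1%:R * (del * del)) *
    (rise s ^+ j * (dec s * (dec s * (inv1 s * (1 - inv1 s))))).

Lemma is_derive_inv1 (s : R) : 0 <= s -> is_derive s (1 : R) inv1 (- (inv1 s * inv1 s)).
Proof.
move=> s0; have s1 : 1 + s != 0 by rewrite gt_eqF// ltr_wpDr.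
have d : is_derive s (1 : R) (fun x => 1 + x) 1.
  by rewrite -[X in is_derive _ _ _ X](add0r 1); apply: is_deriveD.
have [h1 h2] := d.
split; first exact: (@derivableV _ _ (fun x : R => 1 + x)).
rewrite (@deriveV _ _ (fun x : R => 1 + x))// h2 /inv1 /GRing.scale/= mulr1.
by rewrite -invfM expr2.
Qed.

Lemma is_derive_dec (s : R) : 0 <= s -> is_derive s (1 : R) dec (- del * (dec s * inv1 s)).
Proof.
move=> s0; have s1 : 0 < 1 + s by rewrite ltr_wpDr.
have d : is_derive s (1 : R) (fun x => 1 + x) 1.
  by rewrite -[X in is_derive _ _ _ X](add0r 1); apply: is_deriveD.
have d1 := @is_derive1_comp R _ _ s _ _ (is_derive1_ln s1) d.
have d2 := is_deriveZ (- del) d1.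
apply: (is_derive_eq (@is_derive1_comp R _ _ s _ _ (is_derive_expR _) d2)).
rewrite /dec /inv1 /GRing.scale/= mulr1.
by rewrite mulrCA.
Qed.

Lemma is_derive_rise (s : R) : 0 <= s -> is_derive s (1 : R) rise (del * (dec s * inv1 s)).
Proof.
move=> s0; have d := is_derive_dec s0.
have -> : rise = cst 1 - dec by [].
apply: (is_derive_eq (is_deriveB _ d)).
by rewrite sub0r mulNr opprK.
Qed.

Lemma is_derive_riseX n (s : R) : 0 <= s ->
  is_derive s (1 : R) (fun s => rise s ^+ n.+1) (n.+1%:R * rise s ^+ n * (del * (dec s * inv1 s))).
Proof.
move=> s0; have d := is_derive_rise s0.
have -> : (fun s => rise s ^+ n.+1) = rise ^+ n.+1 by apply/funext => x; rewrite fctE.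
apply: (is_derive_eq (is_deriveX n.+1 d)).
by rewrite /GRing.scale/=.
Qed.

Lemma mulr_inv1 (s : R) : 0 <= s -> s * inv1 s = 1 - inv1 s.
Proof. by move=> s0; rewrite /inv1; field; rewrite gt_eqF// ltr_wpDr. Qed.

Lemma is_derive_Hf (s : R) : 0 <= s -> is_derive s (1 : R) Hf (gf s).
Proof.
move=> s0; have d := is_derive_riseX j.+1 s0.
have -> : Hf = id * (fun s => rise s ^+ j.+2) by [].
apply: (is_derive_eq (is_deriveM (is_derive_id s 1) d)).
rewrite /gf -(mulr_inv1 s0) /GRing.scale/=; ring.
Qed.

Lemma is_derive_gf (s : R) : 0 <= s -> is_derive s (1 : R) gf (dgf s).
Proof.
move=> s0; have d1 := is_derive_riseX j.+1 s0; have d2 := is_derive_riseX j s0.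
have d3 := is_derive_dec s0; have d4 := is_derive_inv1 s0.
have d4' : is_derive s (1 : R) (cst 1 - inv1) (0 - - (inv1 s * inv1 s)).
  exact: is_deriveB.
have d5 := is_deriveM d3 d4'.
have d6 := is_deriveZ (j.+2%:R * del) (is_deriveM d2 d5).
have -> : gf = (fun s => rise s ^+ j.+2) +
  (j.+2%:R * del) \*: ((fun s => rise s ^+ j.+1) * (dec * (cst 1 - inv1))) by [].
apply: (is_derive_eq (is_deriveD d1 d6)).
have e1 : (cst 1 - inv1) s = 1 - inv1 s by [].
have e2 : (dec * (cst 1 - inv1)) s = dec s * (1 - inv1 s) by [].
by rewrite /dgf /GRing.scale/= e1 e2; ring.
Qed.

Lemma derivable_continuous (f : R -> R) (s df : R) : is_derive s (1 : R) f df -> {for s, continuous f}.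
Proof. by move=> [d _]; apply: differentiable_continuous; exact/derivable1_diffP. Qed.

Section bounds.
Variables (s : R) (s0 : 0 <= s).

Lemma inv1_gt0 : 0 < inv1 s. Proof. by rewrite invr_gt0 ltr_wpDr. Qed.
Lemma inv1_le1 : inv1 s <= 1. Proof. by rewrite invf_le1 ?lerDl// ltr_wpDr. Qed.
Lemma dec_gt0 : 0 < dec s. Proof. exact: expR_gt0. Qed.

Lemma ln1p_ge0 : 0 <= ln (1 + s). Proof. by apply: ln_ge0; rewrite lerDl. Qed.

Lemma dec_le1 : dec s <= 1.
Proof.
by rewrite -(expR0 R) ler_expR mulNr oppr_le0 mulr_ge0 ?ln1p_ge0// ltW.
Qed.

Lemma inv1_le_dec : inv1 s <= dec s.
Proof.
have s1 : 0 < 1 + s by rewrite ltr_wpDr.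
rewrite /inv1 /dec -[X in X^-1](lnK s1) -expRN ler_expR mulNr lerN2.
by rewrite ler_piMl ?ln1p_ge0// (le_trans del1)// invf_le1// ler1n.
Qed.

Lemma rise_ge0 : 0 <= rise s. Proof. by rewrite subr_ge0 dec_le1. Qed.
Lemma rise_le1 : rise s <= 1. Proof. by rewrite gerBl ltW// dec_gt0. Qed.
Lemma rise_le : rise s <= s * inv1 s.
Proof. by rewrite mulr_inv1// lerD2l lerN2 inv1_le_dec. Qed.

Lemma slope_le_rise : del * (dec s * (1 - inv1 s)) <= rise s.
Proof.
have s1 : 0 < 1 + s by rewrite ltr_wpDr.
have e1 : 1 + del * (1 - inv1 s) <= (dec s)^-1.
  rewrite /dec -expRN mulNr opprK (le_trans _ (expR_ge1Dx _))// lerD2l.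
  rewrite ler_wpM2l ?(ltW del0)//.
  have w0 := inv1_gt0.
  have h : ln (1 + (inv1 s - 1)) <= inv1 s - 1 by apply: le_ln1Dx; lra.
  rewrite (_ : 1 + (inv1 s - 1) = inv1 s) in h; last by ring.
  by move: h; rewrite /inv1 lnV// => h; lra.
have := ler_wpM2l (ltW dec_gt0) e1.
rewrite mulfV ?gt_eqF ?dec_gt0// /rise mulrDr mulr1 => h.
have -> : del * (dec s * (1 - inv1 s)) = dec s * (del * (1 - inv1 s)) by ring.
lra.
Qed.

Lemma inv1_compl_ge0 : 0 <= 1 - inv1 s. Proof. by rewrite subr_ge0 inv1_le1. Qed.

Lemma gf_ge : rise s ^+ j.+2 <= gf s.
Proof.
rewrite lerDl !mulr_ge0// ?exprn_ge0 ?rise_ge0 ?inv1_compl_ge0// ltW//.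
exact: dec_gt0.
Qed.

Lemma gf_ge0 : 0 <= gf s.
Proof. by rewrite (le_trans _ gf_ge)// exprn_ge0// rise_ge0. Qed.

Lemma gf_le : gf s <= j.+3%:R * rise s ^+ j.+2.
Proof.
rewrite /gf -[j.+3%:R]natr1 [leRHS]mulrDl mul1r [leLHS]addrC lerD2r.
rewrite -[leLHS]mulrA ler_wpM2l//.
have -> : del * (rise s ^+ j.+1 * (dec s * (1 - inv1 s))) =
  (del * (dec s * (1 - inv1 s))) * rise s ^+ j.+1 by ring.
by rewrite [leRHS]exprS ler_wpM2r ?slope_le_rise// exprn_ge0// rise_ge0.
Qed.

Lemma dgf_ge : j.+2%:R * del / 2 * (rise s ^+ j.+1 * (dec s * inv1 s)) <= dgf s.
Proof.
have w0 := inv1_gt0; have v0 := dec_gt0; have wc := inv1_compl_ge0.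
have d2 : del * (1 - inv1 s) <= 1 / 2.
  have := del1; move: (inv1 s) w0 wc => w; nra.
apply: ler_wpDr.
  by rewrite !mulr_ge0 ?exprn_ge0 ?rise_ge0// ?(ltW del0) ?(ltW w0) ?(ltW v0).
rewrite -[X in X <= _]mulrA -!mulrA ler_wpM2l// ler_wpM2l ?(ltW del0)//.
have -> : 2^-1 * (rise s ^+ j.+1 * (dec s * inv1 s)) =
   rise s ^+ j.+1 * (dec s * (inv1 s * 2^-1)) by ring.
rewrite ler_wpM2l ?exprn_ge0 ?rise_ge0// ler_wpM2l ?(ltW v0)// ler_wpM2l ?(ltW w0)//.
lra.
Qed.

End bounds.

Lemma rise_gt0 s : 0 < s -> 0 < rise s.
Proof.
move=> s0; rewrite subr_gt0 -[X in _ < X](expR0 R) ltr_expR mulNr oppr_lt0.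
by rewrite mulr_gt0// ln_gt0// ltrDl.
Qed.

Lemma dgf_ge0 s : 0 <= s -> 0 <= dgf s.
Proof.
move=> s0; apply: le_trans (dgf_ge s0).
have w0 := inv1_gt0 s0; have v0 := dec_gt0 s.
by rewrite !mulr_ge0 ?exprn_ge0 ?rise_ge0 ?invr_ge0 ?(ltW del0) ?(ltW w0) ?(ltW v0)// addr_ge0.
Qed.

Lemma dgf_gt0 s : 0 < s -> 0 < dgf s.
Proof.
move=> s0; apply: lt_le_trans (dgf_ge (ltW s0)).
have w0 := inv1_gt0 (ltW s0); have v0 := dec_gt0 s.
apply: mulr_gt0; first by rewrite !mulr_gt0.
by rewrite !mulr_gt0 ?exprn_gt0 ?rise_gt0.
Qed.

Lemma gf_gt0 s : 0 < s -> 0 < gf s.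
Proof.
move=> s0; apply: lt_le_trans (gf_ge (ltW s0)).
by rewrite exprn_gt0 ?rise_gt0.
Qed.

Lemma gf0 : gf 0 = 0.
Proof.
by rewrite /gf /rise /dec addr0 ln1 mulr0 expR0 subrr !expr0n/= !mul0r mulr0 addr0.
Qed.

Lemma gf_bounded s : 0 <= s -> gf s <= j.+3%:R.
Proof.
move=> s0; apply: (le_trans (gf_le s0)); rewrite -[leRHS]mulr1 ler_wpM2l//.
by rewrite exprn_ile1 ?rise_ge0 ?rise_le1.
Qed.

Lemma dgf_bounded : exists B : R, forall s, 0 <= s -> dgf s <= B.
Proof.
exists (j.+2%:R * del * 2 + j.+2%:R * (j.+1%:R * (del * del))) => s s0.
have w0 := inv1_gt0 s0; have v0 := dec_gt0 s; have wc := inv1_compl_ge0 s0.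
have w1 := inv1_le1 s0; have v1 := dec_le1 s0; have d0 := ltW del0.
have le1 (a b : R) : 0 <= a -> 0 <= b -> a <= 1 -> b <= 1 -> a * b <= 1.
  by move=> a0 b0 a1 b1; rewrite -[leRHS]mulr1 ler_pM.
have r0 n : 0 <= rise s ^+ n by rewrite exprn_ge0// rise_ge0.
have r1 n : rise s ^+ n <= 1 by rewrite exprn_ile1 ?rise_ge0 ?rise_le1.
have x0 : 0 <= inv1 s * (1 - inv1 s) by rewrite mulr_ge0 ?(ltW w0).
have dw : 0 <= del * (1 - inv1 s) by rewrite mulr_ge0.
have dw1 : del * (1 - inv1 s) <= 1.
  apply: le1 => //; first by rewrite (le_trans del1)// invf_le1// ler1n.
  by rewrite gerBl ltW.
apply: lerD.
  rewrite ler_wpM2l ?mulr_ge0//.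
  have y0 : 0 <= 1 + inv1 s - del * (1 - inv1 s) by lra.
  have y2 : 1 + inv1 s - del * (1 - inv1 s) <= 2 by lra.
  rewrite -[leRHS]mul1r ler_pM ?mulr_ge0 ?(ltW v0) ?(ltW w0)//.
  rewrite -[leRHS]mul1r ler_pM ?mulr_ge0 ?(ltW v0) ?(ltW w0)//.
  by rewrite -[leRHS]mul1r ler_pM ?mulr_ge0 ?(ltW v0) ?(ltW w0)//.
rewrite -[leRHS]mulr1 ler_wpM2l ?mulr_ge0//.
have wc1 : 1 - inv1 s <= 1 by lra.
have p1 := le1 _ _ (ltW w0) wc w1 wc1.
have p20 : 0 <= dec s * (inv1 s * (1 - inv1 s)) by rewrite mulr_ge0 ?(ltW v0).
have p2 := le1 _ _ (ltW v0) x0 v1 p1.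
have p30 : 0 <= dec s * (dec s * (inv1 s * (1 - inv1 s))) by rewrite mulr_ge0 ?(ltW v0).
have p3 := le1 _ _ (ltW v0) p20 v1 p2.
exact: le1.
Qed.

End profile.

Section real_inequalities.
Context {R : realType}.

Lemma powRD_gt0 (x r s : R) : 0 < x -> x `^ (r + s) = x `^ r * x `^ s.
Proof. by move=> x0; rewrite powRD// (gt_eqF x0) implybT. Qed.

Lemma le_powR_exp (x r s : R) : 0 < x -> x <= 1 -> r <= s -> x `^ s <= x `^ r.
Proof.
move=> x0 x1 rs; rewrite /powR gt_eqF// ler_expR ler_wnM2r//.
exact: ln_le0.
Qed.

Lemma le_powR_base (r x y : R) : 0 <= r -> 0 <= x -> x <= y -> x `^ r <= y `^ r.
Proof.
by move=> r0 x0 xy; apply: ge0_ler_powR => //; rewrite nnegrE// (le_trans x0).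
Qed.

(** Young's inequality, with the weight [Y] absorbed in the power of [a]. *)
Lemma young_absorb (m c0 : R) : 1 < m -> 0 < c0 ->
  exists2 C : R, 0 <= C & forall a X Y, 0 <= a -> 0 <= X -> 0 < Y ->
    X * a - c0 * Y * a `^ (m / (m - 1)) <= C * (X `^ m * Y `^ (1 - m)).
Proof.
move=> m1 c00; pose m' := m / (m - 1).
have m0 : 0 < m by lra.
have m10 : 0 < m - 1 by lra.
have m'0 : 0 < m' by rewrite divr_gt0.
pose t := (c0 * m') `^ m'^-1.
have cm0 : 0 < c0 * m' by rewrite mulr_gt0.
have t0 : 0 < t by rewrite powR_gt0.
have tm : t `^ m' = c0 * m'.
  by rewrite /t -powRrM mulVf ?gt_eqF// powRr1// ltW.
exists (m^-1 * (t `^ m)^-1); first by rewrite mulr_ge0 ?invr_ge0 ?powR_ge0// ltW.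
move=> a X Y a0 X0 Y0.
have B0 : 0 <= X / (Y * t) by rewrite divr_ge0// ltW// mulr_gt0.
have conj : m'^-1 + m^-1 = 1 by rewrite /m'; field; rewrite !gt_eqF.
have := conjugate_powR (mulr_ge0 (ltW t0) a0) B0 m'0 m0 conj.
have Yt0 := mulr_gt0 Y0 t0.
have EB : (X / (Y * t)) `^ m = X `^ m * (Y `^ (- m) * t `^ (- m)).
  rewrite powRM ?invr_ge0 ?(ltW Yt0)//; congr (_ * _).
  by rewrite -(powR_inv1 (ltW Yt0)) -powRrM mulN1r powRM// ltW.
rewrite powRM ?(ltW t0)// tm EB.
move=> h; have := ler_wpM2l (ltW Y0) h.
have -> : Y * (t * a * (X / (Y * t))) = X * a by field; rewrite !gt_eqF.
have -> : Y * (c0 * m' * a `^ m' / m' + X `^ m * (Y `^ (- m) * t `^ (- m)) / m) =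
  c0 * Y * a `^ m' + m^-1 * (t `^ m)^-1 * (X `^ m * (Y * Y `^ (- m))).
  by rewrite !powRN; field; rewrite !gt_eqF// powR_gt0.
have -> : Y * Y `^ (- m) = Y `^ (1 - m) by rewrite powRD_gt0// powRr1// ltW.
rewrite /m'; lra.
Qed.

Lemma lip_of_derive (f f' : R -> R) (B : R) :
  (forall s : R, 0 <= s -> is_derive s (1 : R) f (f' s)) ->
  (forall s : R, 0 <= s -> `|f' s| <= B) ->
  forall s t : R, 0 <= s -> 0 <= t -> `|f s - f t| <= B * `|s - t|.
Proof.
move=> df fB.
have key a b : 0 <= a -> a <= b -> `|f b - f a| <= B * `|b - a|.
  move=> a0 ab.
  have [||c ci ->] := @MVT_segment R f f' a b ab.
  - by move=> x; rewrite in_itv/= => /andP[/ltW xa _]; apply: df; apply: le_trans xa.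
  - apply: derivable_within_continuous => x; rewrite in_itv/= => /andP[xa _].
    by have [] := df x (le_trans a0 xa).
  move: ci; rewrite in_itv/= => /andP[ac _].
  by rewrite normrM ler_wpM2r// fB// (le_trans a0).
move=> s t s0 t0; have [st|/ltW ts] := leP s t; last exact: key.
by rewrite distrC [X in _ * X]distrC; exact: key.
Qed.

Section profile_bounds.
Variables (del p q m : R) (j : nat).
Hypotheses (del0 : 0 < del) (del1 : del <= 2^-1).
Hypotheses (hp : 0 < p) (hq : 0 < q) (m1 : 1 < m).
Hypotheses (pq2 : 2 < p + q) (pqm : (1 + del) * (2 * m - 2) <= p + q).
Hypothesis (jpq : p + q <= j.+2%:R).

Let e s := rise del s.
Let w s := @inv1 R s.

Lemma rise_pow_le (s : R) : 0 < s -> (e s) ^+ j.+2 <= (s * w s) `^ (p + q).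
Proof.
move=> s0; have e0 : 0 < e s by exact: rise_gt0.
rewrite -powR_mulrn ?(ltW e0)//.
apply: (@le_trans _ _ (e s `^ (p + q))).
  by apply: le_powR_exp => //; exact: rise_le1.
apply: le_powR_base; [by rewrite addr_ge0// ltW|exact: ltW|].
by apply: rise_le => //; exact: ltW.
Qed.

Lemma Hf_bound (s : R) : 0 <= s ->
  Hf del j s <= Num.sqrt (s `^ p * (s `^ q * gf del j s)).
Proof.
rewrite le_eqVlt => /predU1P[<-|s0].
  by rewrite /Hf mul0r sqrtr_ge0.
have s0' := ltW s0; have e0 : 0 < e s by exact: rise_gt0.
have H0 : 0 <= Hf del j s by rewrite mulr_ge0// exprn_ge0// ltW.
rewrite -[leLHS](ger0_norm H0) -sqrtr_sqr ler_wsqrtr//.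
rewrite mulrA -powRD_gt0//.
apply: (@le_trans _ _ (s `^ (p + q) * e s ^+ j.+2)); last first.
  by rewrite ler_wpM2l ?powR_ge0// gf_ge.
rewrite /Hf exprMn expr2 -/(e s).
have -> : s * s * (e s ^+ j.+2) ^+ 2 = (s * s * e s ^+ j.+2) * e s ^+ j.+2 by ring.
rewrite ler_wpM2r ?exprn_ge0 ?(ltW e0)//.
have -> : p + q = 2%:R + (p + q - 2) by ring.
rewrite powRD_gt0// powR_mulrn// expr2 ler_wpM2l ?mulr_ge0//.
rewrite -powR_mulrn ?(ltW e0)//.
apply: (@le_trans _ _ (e s `^ (p + q - 2))).
  by apply: le_powR_exp => //; [exact: rise_le1|move: jpq; lra].
apply: le_powR_base; [by rewrite subr_ge0 ltW|exact: ltW|].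
have h : rise del s <= s * inv1 s by exact: rise_le.
apply: (le_trans h).
by rewrite ler_piMr// inv1_le1.
Qed.

Lemma dec_inv1 (s : R) : 0 <= s -> dec del s = w s `^ del.
Proof.
move=> s0; have s1 : 0 < 1 + s by lra.
by rewrite /dec /powR gt_eqF ?inv1_gt0// /w /inv1 lnV// mulrN mulNr.
Qed.

Lemma gf_dgf_bound : exists2 C : R, 0 <= C & forall s : R, 0 < s ->
  gf del j s `^ m * dgf del j s `^ (1 - m) <=
  C * Num.sqrt (s `^ p * (s `^ q * gf del j s)).
Proof.
pose M := 2 * m - 2; have M0 : 0 < M by have := m1; rewrite /M; lra.
pose kap := j.+2%:R * del / 2; have kap0 : 0 < kap by rewrite divr_gt0// mulr_gt0.
pose c1 := (j.+3%:R : R); have c10 : 0 < c1 by [].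
pose C2 := c1 `^ (M + 1) * (kap `^ M)^-1.
have C20 : 0 <= C2 by rewrite mulr_ge0 ?invr_ge0 ?powR_ge0.
exists (Num.sqrt C2); first exact: sqrtr_ge0.
move=> s s0; have s0' := ltW s0; have e0 : 0 < e s by exact: rise_gt0.
have w0 : 0 < w s by exact: inv1_gt0.
have w1 : w s <= 1 by exact: inv1_le1.
have G0 : 0 < gf del j s by exact: gf_gt0.
have D0 : 0 < dgf del j s by exact: dgf_gt0.
have v0 := dec_gt0 del s.
rewrite -sqrtrM//.
rewrite -[leLHS]ger0_norm ?mulr_ge0 ?powR_ge0// -sqrtr_sqr ler_wsqrtr//.
set G := gf del j s; set D := dgf del j s.
have -> : (G `^ m * D `^ (1 - m)) ^+ 2 = G `^ (M + 1) * G * (D `^ M)^-1.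
  rewrite exprMn -!powR_mulrn ?powR_ge0// -!powRrM -powRN.
  have -> : m * 2 = (M + 1) + 1 by rewrite /M; ring.
  rewrite powRD_gt0// powRr1 ?(ltW G0)//.
  by congr (_ * _ `^ _); rewrite /M; ring.
rewrite (mulrA (s `^ p)) -powRD_gt0//.
have main : G `^ (M + 1) * (D `^ M)^-1 <= C2 * s `^ (p + q).
  rewrite ler_pdivrMr ?powR_gt0//.
  have hG : G `^ (M + 1) <= c1 `^ (M + 1) * (e s ^+ j.+2) `^ (M + 1).
    rewrite -powRM ?exprn_ge0 ?(ltW e0) ?(ltW c10)//.
    by apply: le_powR_base; [lra|exact: ltW|exact: gf_le].
  have hD : kap `^ M * ((e s ^+ j.+1) `^ M * (dec del s * w s) `^ M) <= D `^ M.
    rewrite -[X in _ * X]powRM ?exprn_ge0 ?(ltW e0)//; last by rewrite mulr_ge0// ltW.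
    rewrite -powRM ?(ltW kap0)//; last first.
      by rewrite mulr_ge0 ?exprn_ge0 ?(ltW e0)// mulr_ge0// ltW.
    apply: le_powR_base; [exact: ltW| |exact: dgf_ge].
    by rewrite mulr_ge0 ?(ltW kap0)// mulr_ge0 ?exprn_ge0 ?(ltW e0)// mulr_ge0// ltW.
  have he : (e s ^+ j.+2) `^ (M + 1) <=
      s `^ (p + q) * ((e s ^+ j.+1) `^ M * (dec del s * w s) `^ M).
    rewrite (powRD_gt0 M 1 (exprn_gt0 j.+2 e0)) powRr1 ?exprn_ge0 ?(ltW e0)//.
    have h1 : (e s ^+ j.+2) `^ M <= (e s ^+ j.+1) `^ M.
      apply: le_powR_base; [exact: ltW|by rewrite exprn_ge0// ltW|].
      by rewrite exprS ler_piMl ?exprn_ge0 ?(ltW e0)//; exact: rise_le1.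
    have h2 : e s ^+ j.+2 <= s `^ (p + q) * (dec del s * w s) `^ M.
      apply: (le_trans (rise_pow_le s0)); rewrite powRM ?(ltW w0)//.
      rewrite ler_wpM2l ?powR_ge0// dec_inv1// -[X in _ * X](powRr1 (ltW w0)).
      rewrite -powRD_gt0// -powRrM; apply: le_powR_exp => //.
      by rewrite addrC.
    rewrite [leRHS]mulrCA.
    by rewrite ler_pM ?powR_ge0 ?exprn_ge0 ?(ltW e0).
  apply: (le_trans hG); rewrite /C2.
  rewrite -!mulrA ler_wpM2l ?powR_ge0//.
  rewrite ler_pdivlMl ?powR_gt0//.
  apply: (@le_trans _ _ (kap `^ M * (s `^ (p + q) * ((e s ^+ j.+1) `^ M * (dec del s * w s) `^ M)))).
    by rewrite ler_wpM2l ?powR_ge0.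
  by rewrite mulrCA ler_wpM2l ?powR_ge0.
have -> : G `^ (M + 1) * G / D `^ M = G `^ (M + 1) * (D `^ M)^-1 * G by ring.
by rewrite (mulrA C2) ler_wpM2r// ltW.
Qed.

End profile_bounds.
End real_inequalities.

Section mollification_limits.
Context {R : realType} {N : nat}.
Local Notation ST := ('rV[R]_N * measurableTypeR R)%type.
Local Notation X := ('rV[R]_N * R)%type.
Local Notation mu := (@spacetime_measure R N).

Definition bounded_lipschitz (B : R) (b : R -> R) :=
  (forall s, 0 <= s -> `|b s| <= B) /\
  (forall s t, 0 <= s -> 0 <= t -> `|b s - b t| <= B * `|s - t|).

Lemma lip_measurable (b : R -> R) (B : R) :
  (forall s t, 0 <= s -> 0 <= t -> `|b s - b t| <= B * `|s - t|) ->
  measurable_fun setT (b \o pos).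
Proof.
move=> lip; apply: continuous_measurable_fun => s; apply/cvgrPdist_le => e e0.
have pc := @pos_continuous R s.
have e1 : 0 < e / (`|B| + 1) by rewrite divr_gt0// ltr_wpDl.
near=> t; rewrite /= (le_trans (lip _ _ (pos_ge0 _) (pos_ge0 _)))//.
apply: (@le_trans _ _ ((`|B| + 1) * `|pos s - pos t|)).
  by rewrite ler_wpM2r// (le_trans (ler_norm _))// lerDl.
rewrite -ler_pdivlMl ?ltr_wpDl// mulrC.
by near: t; move/cvgrPdist_le : pc; apply.
Unshelve. all: by end_near. Qed.

Lemma measurable_lip_comp (b : R -> R) (B : R) (f : ST -> R) :
  (forall s t, 0 <= s -> 0 <= t -> `|b s - b t| <= B * `|s - t|) ->
  measurable_fun setT f -> (forall z, 0 <= f z) ->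
  measurable_fun setT (fun z => b (f z)).
Proof.
move=> lip mf f0.
rewrite (_ : (fun z => _) = (b \o pos) \o f).
  by apply: (measurableT_comp _ mf); exact: lip_measurable lip.
by apply/funext => z /=; rewrite pos_id.
Qed.

Lemma mollify_ge0 (dl : R) (rho f : ST -> R) z : kernel_of_radius dl rho ->
  (forall z, 0 <= f z) -> 0 <= mollify rho f z.
Proof.
by move=> [_ r0 _ _ _] f0; apply: Rintegral_ge0 => y _; rewrite mulr_ge0.
Qed.

Lemma vanishes_radius (T : X -> \bar R) (e : R) : vanishes_at0 T -> 0 < e ->
  exists2 l0 : R, 0 < l0 & forall lam, l0 <= lam ->
    forall y, `|y| < lam^-1 -> (T y <= e%:E)%E.
Proof.
move=> vT e0; have [dl dl0 Tdl] := vT e e0; exists dl^-1; first by rewrite invr_gt0.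
move=> lam ll y yl; apply: Tdl; apply: (lt_le_trans yl).
by rewrite invf_ple ?posrE// (lt_le_trans _ ll)// invr_gt0.
Qed.

Lemma mollify_local_L1 (u : ST -> R) (n : nat) (e : R) :
  measurable_fun setT u -> (\int[mu]_z `|u z|%:E < +oo)%E -> 0 < e ->
  exists2 l0 : R, 0 < l0 & forall lam, l0 <= lam ->
    (\int[mu]_z (\1_(bigbox n : set ST) z * `|mollify (molk lam) u z - u z|)%:E
      <= e%:E)%E.
Proof.
move=> mu_ uoo e0.
have mbox := @measurable_bigbox R N n.
have mind : measurable_fun setT (\1_(bigbox n : set ST) : ST -> R).
  exact: measurable_indic.
have indfin : (\int[mu]_z (\1_(bigbox n : set ST) z)%:E < +oo)%E.
  by rewrite integral_indic// setIT; exact: stbox_ltoo.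
have vT : vanishes_at0 (fun y : X => \int[mu]_z
    (\1_(bigbox n : set ST) z * `|u ((z : X) + y) - u z|)%:E)%E.
  apply: (@vanishes_weighted R N _ u (cst 0) (fun z => `|u z|)) => //.
  - exact: measurable_abs.
  - by rewrite integral0.
  - move=> eta eta0; exists 1 => // z z'.
    by rewrite /= mulr0 add0r mul1r ler_piMl.
have [l0 l00 Hl] := vanishes_radius vT e0; exists l0 => // lam ll.
have lam0 : 0 < lam by exact: lt_le_trans ll.
apply: (mollify_close (ltW e0) (molk_kernel lam0)) => // y yl.
exact: Hl ll _ yl.
Qed.

Lemma mollify_comp_close (a u : ST -> R) (b : R -> R) (B e : R) :
  measurable_fun setT a -> (\int[mu]_z `|a z|%:E < +oo)%E ->
  measurable_fun setT u -> (forall z, 0 <= u z) -> (\int[mu]_z `|u z|%:E < +oo)%E ->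
  0 <= B -> bounded_lipschitz B b -> 0 < e ->
  exists2 l0 : R, 0 < l0 & forall lam, l0 <= lam ->
    (\int[mu]_z (`|a z| * `|b (mollify (molk lam) u z) - b (u z)|)%:E <= e%:E)%E.
Proof.
move=> ma aoo mu_ u0 uoo B0 [bB bL] e0.
have mabs := measurable_abs ma.
pose A n : set ST := ~` ([set z | `|a z| < n%:R] `&` bigbox n).
have mA n : measurable (A n).
  apply: measurableC; apply: measurableI; last exact: measurable_bigbox.
  exact: measurable_sublevel.
have Az z : \forall n \near \oo, ~ A n z.
  have [k _ zk] : (\bigcup_k bigbox k) (z : X) by rewrite bigcup_bigbox.
  near=> n; apply; split.
    rewrite /= (lt_le_trans (truncnS_gt _))// ler_nat.
    by near: n; exact: nbhs_infty_ge.
  by apply: bigbox_le zk; near: n; exact: nbhs_infty_ge.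
have B1 : 0 < 2 * (2 * B + 1) by rewrite mulr_gt0// ltr_wpDl// mulr_ge0.
have [n An] := tail_integral (divr_gt0 e0 B1) mabs (fun z => normr_ge0 _) aoo mA Az.
have nB1 : 0 < 2 * (n%:R * B + 1) by rewrite mulr_gt0// ltr_wpDl// mulr_ge0.
have [l0 l00 Hl] := mollify_local_L1 n mu_ uoo (divr_gt0 e0 nB1).
exists l0 => // lam ll; have lam0 : 0 < lam by exact: lt_le_trans ll.
have kr := @molk_kernel R N lam lam0.
have mmol := measurable_mollify kr mu_ uoo.
have mol0 z : 0 <= mollify (molk lam) u z by exact: mollify_ge0 kr u0.
have mbox := @measurable_bigbox R N n.
have mbm := measurable_lip_comp bL mmol mol0.
have mbu := measurable_lip_comp bL mu_ u0.
pose P1 z := \1_(bigbox n : set ST) z * `|mollify (molk lam) u z - u z|.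
pose P2 z := `|a z| * \1_(A n) z.
have mP1 : measurable_fun setT P1.
  apply: measurable_funM; first exact: measurable_indic.
  by apply: measurable_abs; exact: measurable_funB.
have mP2 : measurable_fun setT P2 by apply: measurable_funM => //; exact: measurable_indic.
apply: (@le_trans _ _ (\int[mu]_z (n%:R * B * P1 z)%:E + \int[mu]_z (2 * B * P2 z)%:E)%E).
  apply: nnint_leD.
  - by apply: measurable_funM => //; apply: measurable_abs; exact: measurable_funB.
  - exact: measurable_funM.
  - exact: measurable_funM.
  - by move=> z; rewrite mulr_ge0.
  - by move=> z; rewrite !mulr_ge0.
  - by move=> z; rewrite !mulr_ge0.
  move=> z; have dB : `|b (mollify (molk lam) u z) - b (u z)| <= 2 * B.
    by rewrite (le_trans (ler_normB _ _))// mulr2n mulrDl mul1r lerD// bB.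
  have dL := bL _ _ (mol0 z) (u0 z).
  rewrite /P1 /P2 !indicE; have [zA|zA] := pselect (A n z).
    rewrite (mem_set zA) mulr1 ler_wpDl//; first by rewrite !mulr_ge0.
    by rewrite mulrC ler_wpM2r.
  rewrite (memNset zA) !mulr0 addr0.
  have [za zn] : ([set z | `|a z| < n%:R] `&` bigbox n) z by exact: contrapT.
  by rewrite (mem_set zn) mul1r -mulrA ler_pM// ltW.
rewrite nnintZ//; [|by move=> z; rewrite mulr_ge0|by rewrite mulr_ge0].
rewrite nnintZ//; [|by move=> z; rewrite mulr_ge0|by rewrite mulr_ge0].
apply: (@le_trans _ _ ((n%:R * B)%:E * (e / (2 * (n%:R * B + 1)))%:E +
   (2 * B)%:E * (e / (2 * (2 * B + 1)))%:E)%E).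
  by apply: leeD; apply: lee_wpmul2l; rewrite ?lee_fin ?mulr_ge0//; exact: Hl.
rewrite -!EFinM -EFinD lee_fin.
have half (x : R) : 0 <= x -> x * (e / (2 * (x + 1))) <= e / 2.
  move=> x0; rewrite mulrA ler_pdivrMr ?mulr_gt0 ?ltr_wpDl//.
  have -> : e / 2 * (2 * (x + 1)) = x * e + e by field.
  by rewrite lerDl ltW.
by rewrite [leRHS]splitr lerD// half// mulr_ge0.
Unshelve. all: by end_near. Qed.

(** The pairing condition of [vanishes_weighted]: it covers both a bounded
    function with an integrable one, and two conjugate exponents. *)
Definition pairing (a f : ST -> R) :=
  exists A1 Phi : ST -> R,
  [/\ measurable_fun setT A1, measurable_fun setT Phi,
      (forall z, 0 <= A1 z) /\ (forall z, 0 <= Phi z),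
      (\int[mu]_z (A1 z)%:E < +oo)%E /\ (\int[mu]_z (Phi z)%:E < +oo)%E &
      forall eta, 0 < eta -> exists2 C, 0 <= C &
        forall z z', `|a z| * `|f z'| <= eta * A1 z + C * Phi z'].

Lemma pairing_integrable (a f : ST -> R) :
  measurable_fun setT a -> measurable_fun setT f -> pairing a f ->
  (\int[mu]_z `|a z * f z|%:E < +oo)%E.
Proof.
move=> ma mf [A1 [Phi [mA1 mPhi [A10 Phi0] [A1oo Phioo] H]]].
have [C C0 HC] := H 1 ltr01.
apply: (@le_lt_trans _ _ (\int[mu]_z (1 * A1 z)%:E + \int[mu]_z (C * Phi z)%:E)%E).
  apply: nnint_leD.
  - by apply: measurable_abs; exact: measurable_funM.
  - exact: measurable_funM.
  - exact: measurable_funM.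
  - by move=> z.
  - by move=> z; rewrite mul1r.
  - by move=> z; rewrite mulr_ge0.
  - by move=> z; rewrite normrM; exact: HC.
rewrite nnintZ// nnintZ// mul1e lte_add_pinfty//.
by rewrite lte_mul_pinfty// ?lee_fin// fin_numE.
Qed.

Lemma mollify_pair_close (a f : ST -> R) (e : R) :
  measurable_fun setT a -> measurable_fun setT f ->
  (\int[mu]_z `|a z|%:E < +oo)%E -> (\int[mu]_z `|f z|%:E < +oo)%E ->
  pairing a f -> 0 < e ->
  exists2 l0 : R, 0 < l0 & forall lam, l0 <= lam ->
    (\int[mu]_z (`|a z| * `|mollify (molk lam) f z - f z|)%:E <= e%:E)%E.
Proof.
move=> ma mf aoo foo [A1 [Phi [mA1 mPhi [A10 Phi0] [A1oo Phioo] H]]] e0.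
have vT := vanishes_weighted (measurable_abs ma) mf mA1 mPhi
  (fun z => normr_ge0 (a z)) A10 Phi0 aoo A1oo Phioo H.
have [l0 l00 Hl] := vanishes_radius vT e0; exists l0 => // lam ll.
have lam0 : 0 < lam by exact: lt_le_trans ll.
apply: (mollify_close (ltW e0) (molk_kernel lam0)) => //.
  exact: measurable_abs.
by move=> y yl; exact: Hl ll _ yl.
Qed.

Lemma mollify_pair_comp_close (a f u : ST -> R) (b : R -> R) (B e : R) :
  measurable_fun setT a -> measurable_fun setT f ->
  (\int[mu]_z `|a z|%:E < +oo)%E -> (\int[mu]_z `|f z|%:E < +oo)%E ->
  pairing a f ->
  measurable_fun setT u -> (forall z, 0 <= u z) -> (\int[mu]_z `|u z|%:E < +oo)%E ->
  0 <= B -> bounded_lipschitz B b -> 0 < e ->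
  exists2 l0 : R, 0 < l0 & forall lam, l0 <= lam ->
    (\int[mu]_z `|a z * (b (mollify (molk lam) u z) * mollify (molk lam) f z)
       - a z * (b (u z) * f z)|%:E <= e%:E)%E.
Proof.
move=> ma mf aoo foo paf mu_ u0 uoo B0 bBL e0; have [bB bL] := bBL.
have mfa : measurable_fun setT (fun z => a z * f z) by exact: measurable_funM.
have faoo := pairing_integrable ma mf paf.
have e20 : 0 < e / 2 by rewrite divr_gt0.
have B10 : 0 < B + 1 by rewrite ltr_wpDl.
have [l1 l10 H1] := mollify_comp_close mfa faoo mu_ u0 uoo B0 bBL e20.
have [l2 l20 H2] := mollify_pair_close ma mf aoo foo paf (divr_gt0 e20 B10).
exists (Num.max l1 l2); first by rewrite lt_max l10.
move=> lam; rewrite ge_max => /andP[ll1 ll2].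
have lam0 : 0 < lam by exact: lt_le_trans ll1.
have kr := @molk_kernel R N lam lam0.
have mmu := measurable_mollify kr mu_ uoo.
have mmf := measurable_mollify kr mf foo.
have mol0 z : 0 <= mollify (molk lam) u z by exact: mollify_ge0 kr u0.
have mbm := measurable_lip_comp bL mmu mol0.
have mbu := measurable_lip_comp bL mu_ u0.
have mdf : measurable_fun setT (fun z => `|a z| * `|mollify (molk lam) f z - f z|).
  apply: measurable_funM; first exact: measurable_abs.
  by apply: measurable_abs; exact: measurable_funB.
apply: (@le_trans _ _ (\int[mu]_z (B * (`|a z| * `|mollify (molk lam) f z - f z|))%:E +
  \int[mu]_z (`|a z * f z| * `|b (mollify (molk lam) u z) - b (u z)|)%:E)%E).
  apply: nnint_leD.
  - apply: measurable_abs; apply: measurable_funB; apply: measurable_funM => //;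
    exact: measurable_funM.
  - exact: measurable_funM.
  - apply: measurable_funM; first exact: measurable_abs.
    by apply: measurable_abs; exact: measurable_funB.
  - by [].
  - by move=> z; rewrite !mulr_ge0.
  - by move=> z; rewrite mulr_ge0.
  move=> z; set v := mollify _ u z; set g := mollify _ f z.
  have -> : a z * (b v * g) - a z * (b (u z) * f z) =
    b v * (a z * (g - f z)) + a z * f z * (b v - b (u z)) by ring.
  rewrite (le_trans (ler_normD _ _))// !normrM lerD2r ler_wpM2r ?mulr_ge0//.
  by apply: bB; exact: mol0.
rewrite [leRHS](_ : _ = (e / 2)%:E + (e / 2)%:E)%E; last by rewrite -EFinD -splitr.
apply: leeD; last exact: H1.
rewrite nnintZ//.
apply: (@le_trans _ _ (B%:E * (e / 2 / (B + 1))%:E)%E).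
  by apply: lee_wpmul2l; [rewrite lee_fin|exact: H2].
rewrite -EFinM lee_fin mulrA ler_pdivrMr// mulrC ler_wpM2l ?(ltW e20)//.
by rewrite lerDl.
Qed.

Lemma Rint_close (F G : ST -> R) (e : R) :
  mu.-integrable setT (EFin \o F) -> mu.-integrable setT (EFin \o G) -> 0 <= e ->
  (\int[mu]_z `|F z - G z|%:E <= e%:E)%E ->
  `|\int[mu]_z F z - \int[mu]_z G z| <= e.
Proof.
move=> iF iG e0 FG; rewrite -RintegralB//.
have iFG : mu.-integrable setT (EFin \o (fun z => F z - G z)).
  exact: (integrableB measurableT iF iG).
apply: (le_trans (le_normr_Rintegral measurableT iFG)).
rewrite -lee_fin /Rintegral fineK//.
rewrite ge0_fin_numE; first by move/integrableP : iFG => [].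
by apply: integral_ge0 => z _; rewrite lee_fin.
Qed.

End mollification_limits.

Section integration_by_parts_in_time.
Context {R : realType} {N : nat}.
Local Notation ST := ('rV[R]_N * measurableTypeR R)%type.
Local Notation X := ('rV[R]_N * R)%type.
Local Notation mu := (@spacetime_measure R N).

Lemma is_derive_time (phi : X -> R) (Dphi : X -> X -> R) (x : 'rV[R]_N) (t : R) :
  is_C1 phi Dphi ->
  is_derive t (1 : R) (fun t => phi (x, t)) (Dphi (x, t) (e_time R N)).
Proof.
move=> C; have [dphi _] := C; have [d1 d2] := dphi (x, t).
have dd : derivable phi (x, t) (e_time R N) by exact: diff_derivable.
have E : (fun h : R => h^-1 *: (((fun t => phi (x, t)) \o shift t) (h *: (1 : R)) - phi (x, t))) =
  (fun h : R => h^-1 *: ((phi \o shift (x, t)) (h *: (e_time R N)) - phi (x, t))).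
  apply/funext => h; congr (_ *: (_ - _)); rewrite /=; congr phi.
  by rewrite /e_time; congr pair; rewrite /= scaler0 add0r.
split.
  by move: dd; rewrite /derivable -E.
by rewrite -(is_C1_derive (x, t) (e_time R N) C) /derive -E.
Qed.

Lemma integral_time_derivative0 (phi : X -> R) (Dphi : X -> X -> R) (a b : R) :
  is_C1 phi Dphi -> a < b ->
  (forall z, ~ (a < z.2 < b) -> phi z = 0 /\ Dphi z (e_time R N) = 0) ->
  mu.-integrable setT (EFin \o (fun z : ST => Dphi (z : X) (e_time R N))) ->
  \int[mu]_z Dphi (z : X) (e_time R N) = 0.
Proof.
move=> C ab out iD.
rewrite /Rintegral.
rewrite -[X in fine X](@integral12_prod_meas1 _ _ _ _ R (lebesgue_rV R N) lebesgue_measure _ iD).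
rewrite integral0_eq//= => x _; rewrite /fubini_F /=.
have cD (t : R) : {for t, continuous (fun t => Dphi (x, t) (e_time R N))}.
  have [_ cD] := C.
  apply: (@continuous_comp _ _ _ (fun t : R => (x, t)) (fun z => Dphi z (e_time R N))); last exact: cD.
  exact: (cvg_pair (cvg_cst x) (@cvg_id _ (nbhs t))).
have der t := @is_derive_time phi Dphi x t C.
have cphi t : {for t, continuous (fun t => phi (x, t))}.
  exact: derivable_continuous (der t).
rewrite (_ : (\int[lebesgue_measure]_y _)%E =
   \int[lebesgue_measure]_(t in `[a, b]) (Dphi (x, t) (e_time R N))%:E)%E; last first.
  rewrite [RHS]integral_mkcond; apply: eq_integral => t _; rewrite patchE.
  case: ifPn => // /negP nt; congr EFin; apply: (out (x, t) _).2 => /= /andP[t1 t2].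
  by apply: nt; rewrite inE/= in_itv/= !ltW.
rewrite (@continuous_FTC2 R (fun t => Dphi (x, t) (e_time R N)) (fun t => phi (x, t)))//.
- by rewrite (out (x, b) _).1 ?(out (x, a) _).1 ?subee//= ltxx ?andbF.
- by apply: continuous_subspaceT => t; exact: cD.
- split.
  + by move=> t _; have [] := der t.
  + exact: cvg_at_right_filter (cphi a).
  + exact: cvg_at_left_filter (cphi b).
- by move=> t _; rewrite derive1E; have [] := der t.
Qed.

End integration_by_parts_in_time.

Section eventually.
Context {R : realType}.

Definition for_large (P : R -> Prop) := exists2 l0 : R, 0 < l0 & forall lam, l0 <= lam -> P lam.

Lemma for_large_and P Q : for_large P -> for_large Q -> for_large (fun l => P l /\ Q l).
Proof.
move=> [a a0 Pa] [b b0 Qb]; exists (Num.max a b); first by rewrite lt_max a0.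
by move=> l; rewrite ge_max => /andP[al bl]; split; [exact: Pa|exact: Qb].
Qed.

Lemma for_large_ord n (P : 'I_n -> R -> Prop) : (forall i, for_large (P i)) ->
  for_large (fun l => forall i, P i l).
Proof.
elim: n P => [|n IHn] P HP; first by exists 1 => // l _ [].
have [a a0 Pa] := for_large_and (IHn _ (fun i => HP (lift ord0 i))) (HP ord0).
exists a => // l /Pa[h1 h2] i; case: (unliftP ord0 i) => [k ->|->//]; exact: h1.
Qed.

End eventually.

Section Rint_sum.
Context d (T : measurableType d) {R : realType} (mu : {measure set T -> \bar R}).

Lemma integrable_sumR n (F : 'I_n -> T -> R) :
  (forall i, mu.-integrable setT (EFin \o F i)) ->
  mu.-integrable setT (EFin \o (fun z => \sum_(i < n) F i z)).
Proof.
elim: n F => [|n IHn] F iF.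
  rewrite (_ : _ \o _ = cst 0%E); last by apply/funext => z /=; rewrite big_ord0.
  exact: integrable0.
rewrite (_ : _ \o _ = (EFin \o (fun z => F ord0 z)) \+
  (EFin \o (fun z => (\sum_(i < n) F (lift ord0 i) z)%R)))%E; last first.
  by apply/funext => z /=; rewrite big_ord_recl.
apply: integrableD => //; exact: IHn.
Qed.

Lemma Rint_sum n (F : 'I_n -> T -> R) :
  (forall i, mu.-integrable setT (EFin \o F i)) ->
  \int[mu]_z (\sum_(i < n) F i z) = \sum_(i < n) \int[mu]_z F i z.
Proof.
elim: n F => [|n IHn] F iF.
  rewrite big_ord0; under eq_Rintegral do rewrite big_ord0.
  by rewrite Rintegral_cst// mul0r.
under eq_Rintegral do rewrite big_ord_recl.
rewrite RintegralD//; last exact: integrable_sumR.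
by rewrite big_ord_recl IHn.
Qed.

End Rint_sum.

Section energy.
Context {R : realType} {N : nat}.
Local Notation ST := ('rV[R]_N * measurableTypeR R)%type.
Local Notation X := ('rV[R]_N * R)%type.
Local Notation mu := (@spacetime_measure R N).
Local Notation L1 f := (measurable_fun setT (f : ST -> R) /\ (\int[mu]_z `|f z|%:E < +oo)%E).

Lemma pairing_scale (a f k : ST -> R) (M : R) : 0 <= M ->
  (forall z, `|k z| <= M) -> pairing a f -> pairing (fun z => a z * k z) f.
Proof.
move=> M0 kM [A1 [Phi [mA1 mPhi [A10 Phi0] [A1oo Phioo] H]]].
exists A1, Phi; split => // eta eta0.
have M1 : 0 < M + 1 by rewrite ltr_wpDl.
have [C C0 HC] := H (eta / (M + 1)) (divr_gt0 eta0 M1).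
exists ((M + 1) * C); first by rewrite mulr_ge0// ltW.
move=> z z'; apply: (@le_trans _ _ ((M + 1) * (`|a z| * `|f z'|))).
  rewrite normrM.
  have -> : `|a z| * `|k z| * `|f z'| = `|k z| * (`|a z| * `|f z'|) by ring.
  by rewrite ler_wpM2r ?mulr_ge0// (le_trans (kM z))// lerDl.
rewrite (_ : eta * A1 z + (M + 1) * C * Phi z' =
    (M + 1) * (eta / (M + 1) * A1 z + C * Phi z')); last by field; rewrite gt_eqF.
exact: ler_wpM2l (ltW M1) _ _ (HC z z').
Qed.

Lemma pairing_bounded (a f : ST -> R) (M : R) : 0 <= M ->
  (forall z, `|a z| <= M) -> L1 f -> pairing a f.
Proof.
move=> M0 aM [mf foo]; exists (cst 0), (fun z => `|f z|); split => //.
- exact: measurable_abs.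
- by rewrite integral0.
move=> eta _; exists M => // z z'.
by rewrite mulr0 add0r ler_wpM2r.
Qed.

End energy.

Section energy_inequality.
Context {R : realType} {N : nat}.
Local Notation ST := ('rV[R]_N * measurableTypeR R)%type.
Local Notation X := ('rV[R]_N * R)%type.
Local Notation mu := (@spacetime_measure R N).
Local Notation L1 f := (measurable_fun setT (f : ST -> R) /\ (\int[mu]_z `|f z|%:E < +oo)%E).

Lemma L1_bounded_mul (a k : ST -> R) (M : R) : L1 a -> measurable_fun setT k ->
  (forall z, `|k z| <= M) -> L1 (fun z => a z * k z).
Proof.
move=> [ma aoo] mk kM; split; first exact: measurable_funM.
apply/(integrable_nnint mu (measurable_funM ma mk)).
exact: integrable_bounded_mul kM.
Qed.

Lemma L1_integrable (a : ST -> R) : L1 a -> mu.-integrable setT (EFin \o a).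
Proof. by move=> [ma aoo]; apply/(integrable_nnint mu ma). Qed.

Section limits.
Variables (u : ST -> R) (Lu : L1 u) (u0 : forall z, 0 <= u z).

Let mollified lam := mollify (molk lam) u.

Lemma mollified_facts lam : 0 < lam ->
  measurable_fun setT (mollified lam : ST -> R) /\ (forall z, 0 <= mollified lam z).
Proof.
move=> lam0; have kr := @molk_kernel R N lam lam0; have [mu_ uoo] := Lu; split.
  exact: measurable_mollify kr mu_ uoo.
by move=> z; exact: mollify_ge0 kr u0.
Qed.

Lemma lim_comp (a : ST -> R) (b : R -> R) (B e : R) :
  L1 a -> 0 <= B -> bounded_lipschitz B b -> 0 < e ->
  for_large (fun lam => mu.-integrable setT (EFin \o (fun z => a z * b (mollified lam z))) /\
    `|\int[mu]_z (a z * b (mollified lam z)) - \int[mu]_z (a z * b (u z))| <= e).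
Proof.
move=> La B0 bBL e0; have [ma aoo] := La; have [mu_ uoo] := Lu; have [bB bL] := bBL.
have [l0 l00 Hl] := mollify_comp_close ma aoo mu_ u0 uoo B0 bBL e0.
exists l0 => // lam ll; have lam0 : 0 < lam by exact: lt_le_trans ll.
have [mv v0] := mollified_facts lam0.
have mbm := measurable_lip_comp bL mv v0.
have mbu := measurable_lip_comp bL mu_ u0.
have i1 : mu.-integrable setT (EFin \o (fun z => a z * b (mollified lam z))).
  by apply: L1_integrable; apply: (@L1_bounded_mul _ _ B) => // z; exact: bB.
have i2 : mu.-integrable setT (EFin \o (fun z => a z * b (u z))).
  by apply: L1_integrable; apply: (@L1_bounded_mul _ _ B) => // z; exact: bB.
split => //; apply: (Rint_close i1 i2 (ltW e0)).
apply: le_trans (Hl _ ll).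
apply: nnint_le.
- by apply: measurable_abs; apply: measurable_funB; exact: measurable_funM.
- apply: measurable_funM; first exact: measurable_abs.
  by apply: measurable_abs; exact: measurable_funB.
- by move=> z; exact: normr_ge0.
- by move=> z; rewrite -mulrBr normrM.
Qed.

Lemma lim_pair (a f : ST -> R) (b : R -> R) (B e : R) :
  L1 a -> L1 f -> pairing a f -> 0 <= B -> bounded_lipschitz B b -> 0 < e ->
  for_large (fun lam =>
    mu.-integrable setT (EFin \o (fun z => a z * (b (mollified lam z) * mollify (molk lam) f z))) /\
    `|\int[mu]_z (a z * (b (mollified lam z) * mollify (molk lam) f z))
       - \int[mu]_z (a z * (b (u z) * f z))| <= e).
Proof.
move=> [ma aoo] [mf foo] paf B0 bBL e0; have [mu_ uoo] := Lu; have [bB bL] := bBL.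
have [l0 l00 Hl] := mollify_pair_comp_close ma mf aoo foo paf mu_ u0 uoo B0 bBL e0.
exists l0 => // lam ll; have lam0 : 0 < lam by exact: lt_le_trans ll.
have [mv v0] := mollified_facts lam0.
have mmf := measurable_mollify (@molk_kernel R N lam lam0) mf foo.
have mbm := measurable_lip_comp bL mv v0.
have mbu := measurable_lip_comp bL mu_ u0.
have m1 : measurable_fun setT (fun z => a z * (b (mollified lam z) * mollify (molk lam) f z)).
  by apply: measurable_funM => //; exact: measurable_funM.
have m2 : measurable_fun setT (fun z => a z * (b (u z) * f z)).
  by apply: measurable_funM => //; exact: measurable_funM.
have L2 : L1 (fun z => a z * (b (u z) * f z)).
  have := @L1_bounded_mul (fun z => a z * f z) (fun z => b (u z)) B.
  move=> h; have {h}[||z|_ h] := h.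
  - split; first exact: measurable_funM.
    exact: pairing_integrable.
  - exact: mbu.
  - exact: bB.
  split => //; rewrite (_ : (\int[mu]_z _)%E = \int[mu]_z `|a z * f z * b (u z)|%:E)%E//.
  by apply: eq_integral => z _; congr (`|_|%:E); ring.
have i1 : mu.-integrable setT (EFin \o (fun z => a z * (b (mollified lam z) * mollify (molk lam) f z))).
  apply: L1_integrable; split => //.
  apply: (@le_lt_trans _ _ (\int[mu]_z `|a z * (b (mollified lam z) * mollify (molk lam) f z)
       - a z * (b (u z) * f z)|%:E + \int[mu]_z `|a z * (b (u z) * f z)|%:E)%E).
    apply: nnint_leD.
    - exact: measurable_abs.
    - by apply: measurable_abs; exact: measurable_funB.
    - exact: measurable_abs.
    - by move=> z; exact: normr_ge0.
    - by move=> z; exact: normr_ge0.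
    - by move=> z; exact: normr_ge0.
    move=> z; apply: le_trans (ler_normD _ _).
    by rewrite subrK.
  rewrite lte_add_pinfty//; last exact: L2.2.
  by apply: (le_lt_trans (Hl _ ll)); rewrite ltry.
split => //; apply: (Rint_close i1 (L1_integrable L2) (ltW e0)).
exact: Hl.
Qed.

Lemma lim_lip (a : ST -> R) (h : R -> R) (B M e : R) :
  L1 a -> (forall z, `|a z| <= M) -> 0 <= B -> h 0 = 0 ->
  (forall s t, 0 <= s -> 0 <= t -> `|h s - h t| <= B * `|s - t|) -> 0 < e ->
  for_large (fun lam => mu.-integrable setT (EFin \o (fun z => a z * h (mollified lam z))) /\
    `|\int[mu]_z (a z * h (mollified lam z)) - \int[mu]_z (a z * h (u z))| <= e).
Proof.
move=> La aM B0 h0 hL e0; have [ma aoo] := La; have [mu_ uoo] := Lu.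
have M0 : 0 <= M by apply: le_trans (aM 0).
have B1 : 0 < B + 1 by rewrite ltr_wpDl.
have pau : pairing a u by exact: (pairing_bounded M0 aM Lu).
have [l0 l00 Hl] := mollify_pair_close ma mu_ aoo uoo pau (divr_gt0 e0 B1).
exists l0 => // lam ll; have lam0 : 0 < lam by exact: lt_le_trans ll.
have [mv v0] := mollified_facts lam0.
have mbm := measurable_lip_comp hL mv v0.
have mbu := measurable_lip_comp hL mu_ u0.
have i2 : mu.-integrable setT (EFin \o (fun z => a z * h (u z))).
  apply: L1_integrable; split; first exact: measurable_funM.
  apply: (@le_lt_trans _ _ (\int[mu]_z (M * B * `|u z|)%:E)%E).
    apply: nnint_le.
    - by apply: measurable_abs; exact: measurable_funM.
    - by apply: measurable_funM => //; exact: measurable_abs.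
    - by move=> z; exact: normr_ge0.
    - move=> z; rewrite normrM -mulrA ler_pM//.
      by have := hL (u z) 0 (u0 z) (lexx 0); rewrite h0 !subr0.
  rewrite nnintZ//; [|exact: measurable_abs|by rewrite mulr_ge0].
  by rewrite lte_mul_pinfty// ?lee_fin ?mulr_ge0// fin_numE.
have mdu : measurable_fun setT (fun z => `|a z| * `|mollified lam z - u z|).
  apply: measurable_funM; first exact: measurable_abs.
  by apply: measurable_abs; exact: measurable_funB.
have close : (\int[mu]_z `|a z * h (mollified lam z) - a z * h (u z)|%:E <= e%:E)%E.
  apply: (@le_trans _ _ (\int[mu]_z (B * (`|a z| * `|mollified lam z - u z|))%:E)%E).
    apply: nnint_le.
    - by apply: measurable_abs; apply: measurable_funB; exact: measurable_funM.
    - exact: measurable_funM.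
    - by move=> z; exact: normr_ge0.
    - move=> z; rewrite -mulrBr normrM mulrCA ler_wpM2l//.
      by apply: hL.
  rewrite nnintZ//.
  apply: (@le_trans _ _ (B%:E * (e / (B + 1))%:E)%E).
    by apply: lee_wpmul2l; [rewrite lee_fin|exact: Hl].
  rewrite -EFinM lee_fin mulrA ler_pdivrMr// mulrC ler_wpM2l ?(ltW e0)//.
  by rewrite lerDl.
have i1 : mu.-integrable setT (EFin \o (fun z => a z * h (mollified lam z))).
  apply: L1_integrable; split; first exact: measurable_funM.
  apply: (@le_lt_trans _ _ (\int[mu]_z `|a z * h (mollified lam z) - a z * h (u z)|%:E
    + \int[mu]_z `|a z * h (u z)|%:E)%E).
    apply: nnint_leD.
    - by apply: measurable_abs; exact: measurable_funM.
    - by apply: measurable_abs; apply: measurable_funB; exact: measurable_funM.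
    - by apply: measurable_abs; exact: measurable_funM.
    - by move=> z; exact: normr_ge0.
    - by move=> z; exact: normr_ge0.
    - by move=> z; exact: normr_ge0.
    by move=> z; apply: le_trans (ler_normD _ _); rewrite subrK.
  rewrite lte_add_pinfty//; last by move/integrableP : i2 => [].
  by apply: (le_lt_trans close); rewrite ltry.
by split => //; exact: (Rint_close i1 i2 (ltW e0) close).
Qed.

End limits.

Variables (u sg ut : ST -> R) (Du Av : 'I_N -> ST -> R).
Hypotheses (Lu : L1 u) (u0 : forall z, 0 <= u z) (Lsg : L1 sg) (Lut : L1 ut).
Hypotheses (LDu : forall i, L1 (Du i)) (LAv : forall i, L1 (Av i)).
Hypothesis pAD : forall i, pairing (Av i) (Du i).

Variables (psi : X -> R) (Dpsi : X -> X -> R) (M a b : R).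
Hypotheses (Cpsi : is_C1 psi Dpsi) (psi0 : forall z, 0 <= psi z).
Hypotheses (psiM : forall z, `|psi z| <= M) (Lpsi : L1 (psi : ST -> R)).
Hypothesis mDpsi : forall v : X, measurable_fun setT (fun z : ST => Dpsi (z : X) v).
Hypotheses (DpsiM : forall z i, `|Dpsi z (e_space R i)| <= M).
Hypotheses (DtpsiM : forall z, `|Dpsi z (e_time R N)| <= M).
Hypothesis LDtpsi : L1 (fun z : ST => Dpsi (z : X) (e_time R N)).
Hypotheses (ab : a < b) (suppab : forall z, ~ (a < z.2 < b) ->
  psi z = 0 /\ Dpsi z (e_time R N) = 0).
Hypothesis Dpsi0 : forall z v, psi z = 0 -> Dpsi z v = 0.
Hypothesis cpsi : compact (tsupport psi).

Variables (H g dg : R -> R) (B : R).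
Hypotheses (B0 : 0 <= B) (H0 : H 0 = 0).
Hypothesis dH : forall s : R, 0 <= s -> is_derive s (1 : R) H (g s).
Hypothesis dg_ : forall s : R, 0 <= s -> is_derive s (1 : R) g (dg s).
Hypothesis cdg : forall s : R, 0 <= s -> {for s, continuous dg}.
Hypotheses (g0 : forall s, 0 <= s -> 0 <= g s).
Hypotheses (gBL : bounded_lipschitz B g) (dgBL : bounded_lipschitz B dg).

Hypothesis weak : forall phi : X -> R, C1c setT phi -> (forall z, 0 <= phi z) ->
  [set z | phi z != 0] `<=` [set z | psi z != 0] ->
  \int[mu]_z (sg z * phi z) <=
  \int[mu]_z (ut z * phi z) - \int[mu]_z (\sum_(i < N) Av i z * 'D_(e_space R i) phi z).
Hypothesis derx : for_large (fun lam => forall z, psi z != 0 -> forall i,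
  dmollify lam u z (e_space R i) = mollify (molk lam) (Du i) z).
Hypothesis dert : for_large (fun lam => forall z, psi z != 0 ->
  dmollify lam u z (e_time R N) = mollify (molk lam) ut z).

Lemma energy_inequality :
  \int[mu]_z (sg z * psi z * g (u z)) +
  \sum_(i < N) \int[mu]_z (Av i z * psi z * (dg (u z) * Du i z)) <=
  (- (\int[mu]_z (Dpsi (z : X) (e_time R N) * H (u z)))) -
  \sum_(i < N) \int[mu]_z (Av i z * Dpsi (z : X) (e_space R i) * g (u z)).
Proof.
have M0 : 0 <= M by apply: le_trans (psiM 0).
have [mpsi _] := Lpsi.
have HL := lip_of_derive dH gBL.1.
have Lsgp : L1 (fun z => sg z * psi z) := L1_bounded_mul Lsg mpsi psiM.
have Lutp : L1 (fun z => ut z * psi z) := L1_bounded_mul Lut mpsi psiM.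
have LAD i : L1 (fun z => Av i z * Dpsi (z : X) (e_space R i)).
  by apply: (L1_bounded_mul (LAv i) (mDpsi _)) => z; exact: DpsiM.
have LAp i : L1 (fun z => Av i z * psi z) := L1_bounded_mul (LAv i) mpsi psiM.
have pApD i : pairing (fun z => Av i z * psi z) (Du i).
  exact: pairing_scale M0 psiM (pAD i).
have ppt : pairing psi ut by exact: (pairing_bounded M0 psiM Lut).
apply/ler_addgt0Pr => e e0.
pose n := (4 + 2 * N%:R : R); have n0 : 0 < n by rewrite /n ltr_wpDr// mulr_ge0.
pose eta := e / n; have eta0 : 0 < eta by rewrite divr_gt0.
have l1 := lim_comp Lu u0 Lsgp B0 gBL eta0.
have l2 := lim_comp Lu u0 Lutp B0 gBL eta0.
have l3 := lim_pair Lu u0 Lpsi Lut ppt B0 gBL eta0.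
have l4 := lim_lip Lu u0 LDtpsi DtpsiM B0 H0 HL eta0.
have l5 := for_large_ord (fun i => lim_comp Lu u0 (LAD i) B0 gBL eta0).
have l6 := for_large_ord (fun i => lim_pair Lu u0 (LAp i) (LDu i) (pApD i) B0 dgBL eta0).
have [lam lam0 Hl] := for_large_and (for_large_and (for_large_and l1 l2) (for_large_and l3 l4))
  (for_large_and (for_large_and l5 l6) (for_large_and derx dert)).
have {Hl} := Hl lam (lexx lam).
set v := mollify (molk lam) u.
move=> [[[[i1 e1] [i2 e2]] [[i3 e3] [i4 e4]]] [[h5 h6] [hx ht]]].
have [mu_ uoo] := Lu.
have v0 z : 0 <= v z by apply: (mollify_ge0 _ (@molk_kernel R N lam lam0) u0).
have Cv : is_C1 v (dmollify lam u) by exact: is_C1_mollify.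
have Cgv : is_C1 (fun z => g (v z)) (fun z w => dg (v z) * dmollify lam u z w).
  apply: (is_C1_comp Cv) => z; first exact: dg_.
  exact: cdg.
have CHv : is_C1 (fun z => H (v z)) (fun z w => g (v z) * dmollify lam u z w).
  apply: (is_C1_comp Cv) => z; first exact: dH.
  exact: (derivable_continuous (dg_ (v0 z))).
have Cphi := is_C1M Cgv Cpsi.
have supp : [set z | g (v z) * psi z != 0] `<=` [set z | psi z != 0].
  by move=> z /=; apply: contraNneq => ->; rewrite mulr0.
have C1cphi : C1c setT (fun z => g (v z) * psi z).
  split => //; first exact: (is_C1_C1 Cphi).
  by apply: (subclosed_compact _ cpsi (closure_subset supp)); exact: closed_closure.
have W := weak C1cphi (fun z => mulr_ge0 (g0 (v0 z)) (psi0 z)) supp.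
have IBP : \int[mu]_z (psi (z : X) * (g (v z) * mollify (molk lam) ut z)) +
    \int[mu]_z (Dpsi (z : X) (e_time R N) * H (v z)) = 0.
  have CHp := is_C1M CHv Cpsi.
  rewrite -RintegralD//.
  have E (z : X) : psi z * (g (v z) * mollify (molk lam) ut z) + Dpsi z (e_time R N) * H (v z) =
      H (v z) * Dpsi z (e_time R N) + psi z * (g (v z) * dmollify lam u z (e_time R N)).
    have [z0|zn0] := eqVneq (psi z) 0; first by rewrite z0; ring.
    by rewrite (ht z zn0); ring.
  transitivity (\int[mu]_z (H (v z) * Dpsi (z : X) (e_time R N) + psi (z : X) * (g (v z) * dmollify lam u z (e_time R N)))).
    by apply: eq_Rintegral => z _; exact: E.
  apply: (integral_time_derivative0 CHp ab).
    by move=> z /suppab[-> ->]; rewrite mulr0 !mul0r addr0.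
  rewrite (_ : _ \o _ = (EFin \o (fun z => psi (z : X) * (g (v z) * mollify (molk lam) ut z))%R) \+
     (EFin \o (fun z => Dpsi (z : X) (e_time R N) * H (v z))%R))%E.
    exact: integrableD.
  by apply/funext => z /=; rewrite -EFinD E.
have W1 : \int[mu]_z (sg z * (g (v z) * psi z)) = \int[mu]_z (sg z * psi z * g (v z)).
  by apply: eq_Rintegral => z _; ring.
have W2 : \int[mu]_z (ut z * (g (v z) * psi z)) = \int[mu]_z (ut z * psi z * g (v z)).
  by apply: eq_Rintegral => z _; ring.
have W3 : \int[mu]_z (\sum_(i < N) Av i z * 'D_(e_space R i) (fun z => g (v z) * psi z) z) =
  \sum_(i < N) (\int[mu]_z (Av i z * Dpsi (z : X) (e_space R i) * g (v z)) +
    \int[mu]_z (Av i z * psi z * (dg (v z) * mollify (molk lam) (Du i) z))).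
  under [RHS]eq_bigr => i _.
    rewrite -RintegralD//; last 2 first.
    - by have [] := h5 i.
    - by have [] := h6 i.
    over.
  rewrite -Rint_sum.
    apply: eq_Rintegral => z _; apply: eq_bigr => i _.
    rewrite (is_C1_derive z (e_space R i) Cphi).
    have [z0|zn0] := eqVneq (psi z) 0; first by rewrite Dpsi0// z0; ring.
    by rewrite (hx z zn0 i); ring.
  move=> i; rewrite (_ : _ \o _ = (EFin \o (fun z => Av i z * Dpsi (z : X) (e_space R i) * g (v z))%R) \+
    (EFin \o (fun z => Av i z * psi z * (dg (v z) * mollify (molk lam) (Du i) z))%R))%E//.
  by apply: integrableD => //; [have [] := h5 i|have [] := h6 i].
rewrite W1 W2 W3 big_split/= in W.
have T3 : \int[mu]_z (psi (z : X) * (g (u z) * ut z)) = \int[mu]_z (ut z * psi z * g (u z)).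
  by apply: eq_Rintegral => z _; ring.
rewrite T3 in e3.
have s5 : \sum_(i < N) \int[mu]_z (Av i z * Dpsi (z : X) (e_space R i) * g (u z)) - N%:R * eta <=
   \sum_(i < N) \int[mu]_z (Av i z * Dpsi (z : X) (e_space R i) * g (v z)).
  rewrite mulr_natl -[X in _ *+ X](card_ord N) -sumr_const -sumrB; apply: ler_sum => i _.
  by have [_] := h5 i; rewrite ler_norml => /andP[h _]; rewrite lerBlDr addrC -lerBlDr -opprB lerNl.
have s6 : \sum_(i < N) \int[mu]_z (Av i z * psi z * (dg (u z) * Du i z)) - N%:R * eta <=
   \sum_(i < N) \int[mu]_z (Av i z * psi z * (dg (v z) * mollify (molk lam) (Du i) z)).
  rewrite mulr_natl -[X in _ *+ X](card_ord N) -sumr_const -sumrB; apply: ler_sum => i _.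
  by have [_] := h6 i; rewrite ler_norml => /andP[h _]; rewrite lerBlDr addrC -lerBlDr -opprB lerNl.
have eE : e = 4 * eta + 2 * (N%:R * eta) by rewrite /eta /n; field; rewrite gt_eqF.
move: W IBP s5 s6 e1 e2 e3 e4; rewrite !ler_norml eE.
move=> W IBP s5 s6 /andP[? ?] /andP[? ?] /andP[? ?] /andP[? ?].
lra.
Qed.

End energy_inequality.

Section profile_regularity.
Context {R : realType}.

Definition BL (b : R -> R) := exists2 B : R, 0 <= B & bounded_lipschitz B b.

Lemma BL_cst c : BL (cst c).
Proof.
exists `|c| => //; split=> // s t _ _.
by rewrite subrr normr0 mulr_ge0.
Qed.

Lemma BL_D f g : BL f -> BL g -> BL (fun s => f s + g s).
Proof.
move=> [A A0 [fA fL]] [C C0 [gC gL]]; exists (A + C); first exact: addr_ge0.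
split=> [s s0|s t s0 t0].
  by rewrite (le_trans (ler_normD _ _))// lerD ?fA ?gC.
have -> : f s + g s - (f t + g t) = (f s - f t) + (g s - g t) by ring.
by rewrite (le_trans (ler_normD _ _))// mulrDl lerD ?fL ?gL.
Qed.

Lemma BL_M f g : BL f -> BL g -> BL (fun s => f s * g s).
Proof.
move=> [A A0 [fA fL]] [C C0 [gC gL]]; exists (A * C + A * C).
  by rewrite addr_ge0 ?mulr_ge0.
split=> [s s0|s t s0 t0].
  rewrite normrM (@le_trans _ _ (A * C))// ?lerDl ?mulr_ge0//.
  by rewrite ler_pM ?fA ?gC.
have -> : f s * g s - f t * g t = f s * (g s - g t) + g t * (f s - f t) by ring.
rewrite (le_trans (ler_normD _ _))// mulrDl !normrM -mulrA lerD//.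
  by rewrite ler_pM ?fA ?gL.
by rewrite [leRHS]mulrCA ler_pM ?gC ?fL.
Qed.

Lemma BL_X f n : BL f -> BL (fun s => f s ^+ n).
Proof.
move=> Bf; elim: n => [|n IHn].
  rewrite (_ : (fun s => _) = cst 1); first exact: BL_cst.
  by apply/funext => s; rewrite expr0.
rewrite (_ : (fun s => _) = (fun s => f s * f s ^+ n)); first exact: BL_M.
by apply/funext => s; rewrite exprS.
Qed.

Lemma BL_le f A : BL f -> exists2 B : R, A <= B & 0 <= B /\ bounded_lipschitz B f.
Proof.
move=> [C C0 [fC fL]]; exists (`|A| + C).
  by rewrite (le_trans (ler_norm _))// lerDl.
split; first by rewrite addr_ge0.
split=> [s s0|s t s0 t0].
  by rewrite (le_trans (fC _ s0))// lerDr.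
by rewrite (le_trans (fL _ _ s0 t0))// ler_wpM2r// lerDr.
Qed.

Variables (del : R) (j : nat).
Hypotheses (del0 : 0 < del) (del1 : del <= 2^-1).

Lemma BL_inv1 : BL (@inv1 R).
Proof.
exists 1 => //; split=> [s s0|].
  by rewrite ger0_norm ?inv1_le1// ltW// inv1_gt0.
apply: (@lip_of_derive R _ (fun s => - (inv1 s * inv1 s)) 1) => s s0.
  exact: is_derive_inv1.
have w0 := ltW (inv1_gt0 s0); rewrite normrN ger0_norm ?mulr_ge0//.
by rewrite -[leRHS]mul1r ler_pM ?inv1_le1.
Qed.

Lemma BL_dec : BL (dec del).
Proof.
exists 1 => //; split=> [s s0|].
  by rewrite ger0_norm ?dec_le1// ltW// dec_gt0.
apply: (@lip_of_derive R _ (fun s => - del * (dec del s * inv1 s)) 1) => s s0.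
  exact: is_derive_dec.
have w0 := ltW (inv1_gt0 s0); have v0 := ltW (dec_gt0 del s).
rewrite normrM normrN !ger0_norm ?mulr_ge0 ?(ltW del0)//.
rewrite -[leRHS]mul1r ler_pM ?mulr_ge0 ?(ltW del0)//.
  by rewrite (le_trans del1)// invf_le1// ler1n.
by rewrite -[leRHS]mul1r ler_pM ?inv1_le1 ?dec_le1.
Qed.

Lemma BL_compl f : BL f -> BL (fun s => 1 - f s).
Proof.
move=> Bf; have := BL_D (BL_cst 1) (BL_M (BL_cst (-1)) Bf).
by congr BL; apply/funext => s /=; rewrite mulN1r.
Qed.

Lemma BL_dgf : BL (dgf del j).
Proof.
have Bv := BL_dec; have Bw := BL_inv1; have Br := BL_compl Bv.
have Bwc := BL_compl Bw.
apply: BL_D.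
  apply: (BL_M (BL_cst _)); apply: BL_M; first exact: BL_X.
  apply: BL_M => //; apply: BL_M => //.
  have := BL_D (BL_D (BL_cst 1) Bw) (BL_M (BL_cst (- del)) Bwc).
  by congr BL; apply/funext => s /=; rewrite mulNr.
apply: (BL_M (BL_cst _)); apply: BL_M; first exact: BL_X.
by apply: BL_M => //; apply: BL_M => //; apply: BL_M.
Qed.

Lemma gf_dgf_BL : exists2 B : R, 0 <= B &
  bounded_lipschitz B (gf del j) /\ bounded_lipschitz B (dgf del j).
Proof.
have [B Bj [B0 BLd]] := BL_le j.+3%:R BL_dgf.
exists B => //; split => //; split=> [s s0|].
  rewrite ger0_norm ?gf_ge0//; apply: le_trans Bj.
  exact: gf_bounded.
apply: (@lip_of_derive R _ (dgf del j)) => s s0; first exact: is_derive_gf.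
exact: BLd.1.
Qed.

Lemma dgf_continuous (s : R) : 0 <= s -> {for s, continuous (dgf del j)}.
Proof.
move=> s0.
have cv : {for s, continuous (dec del)} by exact: derivable_continuous (is_derive_dec del s0).
have cw : {for s, continuous (@inv1 R)} by exact: derivable_continuous (is_derive_inv1 s0).
have cwc : {for s, continuous (fun s : R => 1 - inv1 s)}.
  by apply: continuousB => //; exact: cst_continuous.
have cr : {for s, continuous (rise del)}.
  by apply: continuousB => //; exact: cst_continuous.
have crX n : {for s, continuous (fun s => rise del s ^+ n)}.
  elim: n => [|n IHn].
    rewrite (_ : (fun s => _) = cst 1); first exact: cst_continuous.
    by apply/funext => x; rewrite expr0.
  rewrite (_ : (fun s => _) = (fun s => rise del s * rise del s ^+ n)).
    exact: continuousM.
  by apply/funext => x; rewrite exprS.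
apply: continuousD.
  apply: continuousM; first exact: cst_continuous.
  apply: continuousM; first exact: crX.
  apply: continuousM => //; apply: continuousM => //.
  apply: continuousB.
    by apply: continuousD => //; exact: cst_continuous.
  by apply: continuousM => //; exact: cst_continuous.
apply: continuousM; first exact: cst_continuous.
apply: continuousM; first exact: crX.
by apply: continuousM => //; apply: continuousM => //; apply: continuousM.
Qed.

End profile_regularity.

Section cutoff.
Context {R : realType} {N : nat}.
Local Notation ST := ('rV[R]_N * measurableTypeR R)%type.
Local Notation X := ('rV[R]_N * R)%type.
Local Notation mu := (@spacetime_measure R N).

Lemma is_C1_X (f : X -> R) Df n : is_C1 f Df ->
  is_C1 (fun z => f z ^+ n.+1) (fun z v => n.+1%:R * f z ^+ n * Df z v).
Proof.
move=> Cf; elim: n => [|n IHn].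
  apply: (is_C1_ext (Df := Df)); first by move=> z v; rewrite expr0 mulr1 mul1r.
  by rewrite (_ : (fun z => _) = f)//; apply/funext => z; rewrite expr1.
rewrite (_ : (fun z => _) = (fun z => f z * f z ^+ n.+1)); last first.
  by apply/funext => z; rewrite exprS.
apply: (is_C1_ext _ (is_C1M Cf IHn)) => z v.
by rewrite -[n.+2%:R]natr1 exprS; ring.
Qed.

Variables (rad T eps : R) (k : nat).
Hypotheses (rad0 : 0 < rad) (T0 : 0 < T) (eps0 : 0 < eps).

Definition sarg (z : X) : R := 1 - (rad ^+ 2)^-1 * dot z.1 z.1.
Definition targ (z : X) : R := 1 - T^-1 * z.2.
Definition spc (z : X) : R := pos2 (sarg z) ^+ k.+1.
Definition onset (z : X) : R := 1 - inv1 (pos2 (z.2 - eps)).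
Definition decay (z : X) : R := pos2 (targ z) ^+ k.+1.
Definition cutoff (z : X) : R := spc z * (onset z * decay z).

Definition dspc (z v : X) : R :=
  k.+1%:R * pos2 (sarg z) ^+ k * (2 * pos (sarg z) * (- (rad ^+ 2)^-1 * (2 * dot z.1 v.1))).
Definition donset (z v : X) : R :=
  inv1 (pos2 (z.2 - eps)) * inv1 (pos2 (z.2 - eps)) * (2 * pos (z.2 - eps) * v.2).
Definition ddecay (z v : X) : R :=
  k.+1%:R * pos2 (targ z) ^+ k * (2 * pos (targ z) * (- T^-1 * v.2)).
Definition dcutoff (z v : X) : R :=
  spc z * (onset z * ddecay z v + decay z * donset z v) + onset z * decay z * dspc z v.

Lemma is_C1_pos2 (f : X -> R) Df : is_C1 f Df ->
  is_C1 (fun z => pos2 (f z)) (fun z v => 2 * pos (f z) * Df z v).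
Proof.
move=> Cf; apply: (@is_C1_comp R _ f Df pos2 (fun s => 2 * pos s) Cf) => z.
  exact: is_derive_pos2.
apply: (@continuousM R _ (cst 2) pos); first exact: cst_continuous.
exact: pos_continuous.
Qed.

Lemma is_C1_dot : is_C1 (fun z : X => dot z.1 z.1) (fun z v => 2 * dot z.1 v.1).
Proof.
apply: (is_C1_ext _ (is_C1_sum (fun i => is_C1M (is_C1_space i) (is_C1_space i)))).
by move=> z v; rewrite /dot mulr_sumr; apply: eq_bigr => i _; ring.
Qed.

Lemma is_C1_affine (c : R) (f : X -> R) Df (d : R) : is_C1 f Df ->
  is_C1 (fun z => c + d * f z) (fun z v => d * Df z v).
Proof.
move=> Cf; apply: (is_C1_ext _ (is_C1D (is_C1_cst c) (is_C1M (is_C1_cst d) Cf))).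
by move=> z v /=; ring.
Qed.

Lemma is_C1_cutoff : is_C1 cutoff dcutoff.
Proof.
have Cs : is_C1 spc dspc.
  have := is_C1_X k (is_C1_pos2 (is_C1_affine 1 (- (rad ^+ 2)^-1) is_C1_dot)).
  have -> : (fun z : X => pos2 (1 + - (rad ^+ 2)^-1 * dot z.1 z.1) ^+ k.+1) = spc.
    by apply/funext => z; rewrite /spc /sarg mulNr.
  by apply: is_C1_ext => z v; rewrite /dspc /sarg mulNr.
have Cd : is_C1 decay ddecay.
  have := is_C1_X k (is_C1_pos2 (is_C1_affine 1 (- T^-1) (@is_C1_time R N))).
  have -> : (fun z : X => pos2 (1 + - T^-1 * z.2) ^+ k.+1) = decay.
    by apply/funext => z; rewrite /decay /targ mulNr.
  by apply: is_C1_ext => z v; rewrite /ddecay /targ mulNr.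
have Co : is_C1 onset donset.
  have C1t := is_C1_pos2 (is_C1_affine (- eps) 1 (@is_C1_time R N)).
  have Ci := @is_C1_comp R _ _ _ (@inv1 R) (fun s => - (inv1 s * inv1 s)) C1t
    (fun z => is_derive_inv1 (pos2_ge0 _)) (fun z => _).
  have := is_C1_affine 1 (-1) (Ci _).
  have -> : (fun z : X => 1 + -1 * inv1 (pos2 (- eps + 1 * z.2))) = onset.
    by apply/funext => z; rewrite /onset mulN1r mul1r [- eps + _]addrC.
  move=> h; apply: (is_C1_ext _ (h _)) => [z v|z].
    by rewrite /donset !mul1r [- eps + _]addrC; ring.
  have ci : {for pos2 (- eps + 1 * z.2), continuous (@inv1 R)}.
    exact: derivable_continuous (is_derive_inv1 (pos2_ge0 _)).
  by apply: continuousN; apply: continuousM.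
have := is_C1M Cs (is_C1M Co Cd).
by apply: is_C1_ext => z v.
Qed.

Lemma spc_ge0 (z : X) : 0 <= spc z. Proof. by rewrite exprn_ge0// pos2_ge0. Qed.
Lemma decay_ge0 (z : X) : 0 <= decay z. Proof. by rewrite exprn_ge0// pos2_ge0. Qed.

Lemma onset_ge0 (z : X) : 0 <= onset z.
Proof. by rewrite subr_ge0 inv1_le1// pos2_ge0. Qed.

Lemma onset_le1 (z : X) : onset z <= 1.
Proof. by rewrite gerBl ltW// inv1_gt0// pos2_ge0. Qed.

Lemma sarg_le1 (z : X) : sarg z <= 1.
Proof.
rewrite gerBl mulr_ge0 ?invr_ge0 ?sqr_ge0//.
by apply: sumr_ge0 => i _; rewrite -expr2 sqr_ge0.
Qed.

Lemma pos_le1 s : s <= 1 -> pos s <= 1 :> R.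
Proof. by move=> s1; rewrite /pos ge_max ler01. Qed.

Lemma pos2_le1 s : s <= 1 -> pos2 s <= 1 :> R.
Proof. by move=> s1; rewrite /pos2 exprn_ile1 ?pos_ge0 ?pos_le1. Qed.

Lemma spc_le1 (z : X) : spc z <= 1.
Proof. by rewrite exprn_ile1 ?pos2_ge0 ?pos2_le1 ?sarg_le1. Qed.

Lemma onset_eq0 (z : X) : z.2 <= eps -> onset z = 0.
Proof.
move=> zt; rewrite /onset /pos2 pos_eq0 ?subr_le0// expr0n/= /inv1 addr0 invr1.
by rewrite subrr.
Qed.

Lemma cutoff_ge0 (z : X) : 0 <= cutoff z.
Proof. by rewrite !mulr_ge0 ?spc_ge0 ?onset_ge0 ?decay_ge0. Qed.

(** For negative times [targ] exceeds one, but there [onset] vanishes. *)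
Lemma onset_decay_le1 (z : X) : onset z * decay z <= 1.
Proof.
have [zt|zt] := leP z.2 eps; first by rewrite onset_eq0// mul0r.
rewrite -[leRHS]mulr1 ler_pM ?onset_ge0 ?onset_le1 ?decay_ge0//.
rewrite exprn_ile1 ?pos2_ge0 ?pos2_le1//.
by rewrite /targ gerBl mulr_ge0 ?invr_ge0 ?(ltW T0)// ltW// (lt_trans eps0).
Qed.

Lemma cutoff_le1 (z : X) : cutoff z <= 1.
Proof.
rewrite -[leRHS]mulr1 ler_pM ?spc_ge0 ?spc_le1 ?onset_decay_le1//.
by rewrite mulr_ge0 ?onset_ge0 ?decay_ge0.
Qed.

Lemma spc_eq0_coord (z : X) (i : 'I_N) : rad <= `|z.1 ord0 i| -> sarg z <= 0.
Proof.
move=> ri; rewrite subr_le0 ler_pdivlMl ?exprn_gt0// mulr1.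
apply: (@le_trans _ _ (z.1 ord0 i * z.1 ord0 i)).
  rewrite -expr2 -[leRHS]real_normK ?num_real//; apply: lerXn2r => //; rewrite nnegrE ?(ltW rad0)//.
rewrite /dot (bigD1 i)//= lerDl; apply: sumr_ge0 => l _.
by rewrite -expr2 sqr_ge0.
Qed.

Lemma cutoff_supp (z : X) : cutoff z != 0 ->
  (forall i, `|z.1 ord0 i| <= rad) /\ eps <= z.2 <= T.
Proof.
rewrite /cutoff !mulf_eq0 !negb_or => /and3P[s0 o0 d0]; split.
  move=> i; rewrite leNgt; apply/negP => /ltW /spc_eq0_coord h.
  by move: s0; rewrite /spc /pos2 (pos_eq0 h) expr0n/= expr0n eqxx.
apply/andP; split.
  by rewrite leNgt; apply/negP => /ltW h; move: o0; rewrite onset_eq0 ?eqxx.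
rewrite leNgt; apply/negP => /ltW h; move: d0.
rewrite /decay /pos2 pos_eq0 ?expr0n/= ?expr0n ?eqxx//.
by rewrite /targ subr_le0 ler_pdivlMl// mulr1.
Qed.

Lemma pos2X_eq0 (s : R) n : (pos2 s ^+ n.+1 == 0) = (pos s == 0).
Proof. by rewrite expf_eq0/= /pos2 expf_eq0. Qed.

Lemma onset_eq0P (z : X) : onset z = 0 -> pos (z.2 - eps) = 0.
Proof.
rewrite /onset => /eqP; rewrite subr_eq0 eq_sym => /eqP h.
have p0 := pos2_ge0 (z.2 - eps).
have : pos2 (z.2 - eps) = 0.
  apply: (addrI 1); rewrite addr0 -[LHS]invrK.
  by rewrite -[X in X^-1]/(inv1 _) h invr1.
by move=> /eqP; rewrite /pos2 expf_eq0/= => /eqP.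
Qed.

Lemma dcutoff_eq0 (z v : X) : cutoff z = 0 -> dcutoff z v = 0.
Proof.
move=> /eqP; rewrite /cutoff !mulf_eq0 => /or3P[] /eqP h0; rewrite /dcutoff.
- have /eqP p0 : pos (sarg z) == 0 by rewrite -(pos2X_eq0 _ k) -/(spc z) h0.
  by rewrite h0 /dspc p0 !(mulr0, mul0r, addr0).
- by rewrite h0 /donset (onset_eq0P h0) !(mulr0, mul0r, addr0).
- have /eqP p0 : pos (targ z) == 0 by rewrite -(pos2X_eq0 _ k) -/(decay z) h0.
  by rewrite h0 /ddecay p0 !(mulr0, mul0r, addr0).
Qed.

Lemma dot_delta (x : 'rV[R]_N) i : dot x (delta_mx ord0 i) = x ord0 i.
Proof.
rewrite /dot (bigD1 i)//= mxE !eqxx mulr1 big1 ?addr0// => l li.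
by rewrite mxE eqxx (negbTE li) mulr0.
Qed.

(** The spatial gradient of the cutoff loses only one power of [pos (sarg z)]. *)
Lemma dcutoff_space (z : X) (i : 'I_N) : `|dcutoff z (e_space R i)| * pos (sarg z) <=
  4 * k.+1%:R / rad * cutoff z.
Proof.
have [z0|zn0] := eqVneq (cutoff z) 0.
  by rewrite (dcutoff_eq0 _ z0) normr0 mul0r z0 mulr0.
have [zx _] := cutoff_supp zn0.
rewrite /dcutoff /ddecay /donset /= !mulr0 addr0 mulr0 add0r /dspc /= dot_delta.
rewrite normrM ger0_norm ?mulr_ge0 ?onset_ge0 ?decay_ge0//.
set P := pos (sarg z); have P0 : 0 <= P by exact: pos_ge0.
have -> : k.+1%:R * pos2 (sarg z) ^+ k * (2 * P * (- (rad ^+ 2)^-1 * (2 * z.1 ord0 i))) =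
  - (4 * k.+1%:R * (rad ^+ 2)^-1 * (pos2 (sarg z) ^+ k * P)) * z.1 ord0 i by ring.
rewrite normrM normrN [X in _ * (X * _) * _]ger0_norm; last first.
  by rewrite !mulr_ge0 ?invr_ge0 ?sqr_ge0 ?exprn_ge0 ?pos2_ge0.
have -> : 4 * k.+1%:R / rad * cutoff z =
   onset z * decay z * (4 * k.+1%:R * (rad ^+ 2)^-1 * (pos2 (sarg z) ^+ k * P) * rad) * P.
  rewrite /cutoff /spc exprS {1}/pos2 -/P; field; rewrite gt_eqF//.
rewrite ler_wpM2r// ler_wpM2l ?mulr_ge0 ?onset_ge0 ?decay_ge0//.
by rewrite ler_wpM2l// !mulr_ge0 ?invr_ge0 ?sqr_ge0 ?exprn_ge0 ?pos2_ge0.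
Qed.

Lemma dcutoff_time (z : X) : - dcutoff z (e_time R N) <=
  2 * k.+1%:R / T * Num.sqrt (cutoff z).
Proof.
have [z0|zn0] := eqVneq (cutoff z) 0.
  by rewrite (dcutoff_eq0 _ z0) z0 oppr0 sqrtr0 mulr0.
have [_ /andP[zt1 zt2]] := cutoff_supp zn0.
have [s0 o0 d0] : [/\ 0 <= pos (sarg z), 0 <= onset z & 0 <= pos (targ z)].
  by split; rewrite ?pos_ge0 ?onset_ge0.
have t1 : pos (targ z) <= 1.
  rewrite pos_le1// /targ gerBl mulr_ge0 ?invr_ge0 ?(ltW T0)// (le_trans _ zt1)//.
  exact: ltW.
have ds : dspc z (e_time R N) = 0.
  rewrite /dspc /= (_ : dot _ _ = 0) ?mulr0//.
  by rewrite /dot big1// => l _; rewrite mxE mulr0.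
have dn0 : 0 <= donset z (e_time R N).
  by rewrite /donset /= mulr1 !mulr_ge0 ?pos_ge0// ltW// inv1_gt0// pos2_ge0.
rewrite /dcutoff ds mulr0 addr0 mulrDr opprD.
apply: (@le_trans _ _ (- (spc z * (onset z * ddecay z (e_time R N))))).
  rewrite gerDl oppr_le0; apply: mulr_ge0; [exact: spc_ge0|apply: mulr_ge0 => //; exact: decay_ge0].
rewrite /ddecay /= mulr1.
have sp0 := spc_ge0 z; have sp1 := spc_le1 z; have o1 := onset_le1 z.
set a := spc z in sp0 sp1 *; set o := onset z in o0 o1 *; set l := pos (targ z) in d0 t1 *.
have -> : - (a * (o * (k.+1%:R * pos2 (targ z) ^+ k * (2 * l * - T^-1)))) =
  2 * k.+1%:R / T * (a * (o * (pos2 (targ z) ^+ k * l))) by ring.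
apply: ler_wpM2l; first by rewrite divr_ge0 ?mulr_ge0 ?(ltW T0).
have -> : pos2 (targ z) ^+ k * l = l ^+ (2 * k).+1 by rewrite /pos2 -/l -exprM exprSr.
rewrite -[leLHS]ger0_norm -?sqrtr_sqr ?mulr_ge0 ?exprn_ge0//.
rewrite ler_wsqrtr// /cutoff -/a -/o /decay /pos2 -/l -!exprM !exprMn.
have sq (x : R) : 0 <= x -> x <= 1 -> x ^+ 2 <= x.
  by move=> x0 x1; rewrite expr2 ler_piMr.
apply: ler_pM; rewrite ?mulr_ge0 ?sqr_ge0 ?exprn_ge0 ?sq//.
apply: ler_pM; rewrite ?sqr_ge0 ?exprn_ge0 ?sq//.
by rewrite -exprM ler_wiXn2l// mulnC leq_mul2r /= ltnS leq_pmull.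
Qed.

Lemma cutoff_low (dl : R) (z : X) : 0 <= dl -> eps + dl <= z.2 -> z.2 <= T / 2 ->
  dot z.1 z.1 <= rad ^+ 2 / 2 ->
  4^-1 ^+ k.+1 * ((1 - inv1 (dl ^+ 2)) * 4^-1 ^+ k.+1) <= cutoff z.
Proof.
move=> dl0 zt zT zx.
have half (s : R) : 2^-1 <= s -> 4^-1 ^+ k.+1 <= pos2 s ^+ k.+1.
  move=> s2; have s0 : 0 <= s by apply: le_trans s2; rewrite invr_ge0.
  apply: lerXn2r; rewrite ?nnegrE ?pos2_ge0 ?invr_ge0//.
  by rewrite /pos2 pos_id// (_ : 4^-1 = 2^-1 ^+ 2) ?lerXn2r ?nnegrE ?invr_ge0//; field.
have s2 : 2^-1 <= sarg z.
  have : (rad ^+ 2)^-1 * dot z.1 z.1 <= 2^-1 by rewrite ler_pdivrMl ?exprn_gt0.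
  by rewrite /sarg; lra.
have t2 : 2^-1 <= targ z.
  have : T^-1 * z.2 <= 2^-1 by rewrite ler_pdivrMl.
  by rewrite /targ; lra.
have dd : dl ^+ 2 <= pos2 (z.2 - eps).
  have zd : dl <= z.2 - eps by rewrite lerBrDl.
  have zd0 := le_trans dl0 zd.
  by rewrite /pos2 pos_id// lerXn2r ?nnegrE.
have o2 : 1 - inv1 (dl ^+ 2) <= onset z.
  rewrite lerB// /inv1 lef_pV2 ?lerD2l// posrE addrC ltr_wpDl ?pos2_ge0 ?sqr_ge0//.
have q0 : 0 <= 4^-1 ^+ k.+1 :> R by rewrite exprn_ge0// invr_ge0.
have o0 : 0 <= 1 - inv1 (dl ^+ 2) by rewrite subr_ge0 inv1_le1// sqr_ge0.
by rewrite ler_pM ?mulr_ge0// ?half// ler_pM// half.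
Qed.

Lemma measurable_sdot (v : 'rV[R]_N) : measurable_fun setT (fun z : ST => dot z.1 v).
Proof.
apply: measurable_sum => i; apply: measurable_funM => //.
exact: measurable_space_coord.
Qed.

Lemma measurable_pos2 (f : ST -> R) : measurable_fun setT f ->
  measurable_fun setT (fun z => pos2 (f z)).
Proof.
by move=> mf; apply: (measurable_funX 2); exact: (measurableT_comp measurable_pos mf).
Qed.

Lemma measurable_sarg : measurable_fun setT (sarg : ST -> R).
Proof.
apply: measurable_funB => //; apply: measurable_funM => //.
apply: measurable_sum => i.
by apply: measurable_funM; exact: measurable_space_coord.
Qed.

Lemma measurable_targ : measurable_fun setT (targ : ST -> R).
Proof.
apply: measurable_funB => //; apply: measurable_funM => //.
Qed.

Lemma measurable_teps : measurable_fun setT (fun z : ST => z.2 - eps : R).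
Proof. by apply: measurable_funB => //; exact: measurable_time_coord. Qed.

Lemma measurable_inv1_pos2 : measurable_fun setT (fun z : ST => inv1 (pos2 (z.2 - eps))).
Proof.
have [B _ [_ lip]] := @BL_inv1 R.
apply: (measurable_lip_comp lip) => [|z]; last exact: pos2_ge0.
exact: (measurable_pos2 measurable_teps).
Qed.

Lemma measurable_spc : measurable_fun setT (spc : ST -> R).
Proof. exact: (measurable_funX _ (measurable_pos2 measurable_sarg)). Qed.

Lemma measurable_decay : measurable_fun setT (decay : ST -> R).
Proof. exact: (measurable_funX _ (measurable_pos2 measurable_targ)). Qed.

Lemma measurable_onset : measurable_fun setT (onset : ST -> R).
Proof. by apply: measurable_funB => //; exact: measurable_inv1_pos2. Qed.

Lemma measurable_cutoff : measurable_fun setT (cutoff : ST -> R).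
Proof.
apply: (measurable_funM measurable_spc).
exact: (measurable_funM measurable_onset measurable_decay).
Qed.

Lemma measurable_dcutoff (v : X) : measurable_fun setT (fun z : ST => dcutoff (z : X) v).
Proof.
have mp (f : ST -> R) : measurable_fun setT f -> measurable_fun setT (fun z => pos (f z)).
  by move=> mf; exact: (measurableT_comp measurable_pos mf).
have mX (f : ST -> R) n : measurable_fun setT f -> measurable_fun setT (fun z => f z ^+ n).
  by move=> mf; exact: (measurable_funX n mf).
apply: measurable_funD; apply: measurable_funM.
- exact: measurable_spc.
- apply: measurable_funD; apply: measurable_funM.
  + exact: measurable_onset.
  + apply: measurable_funM.
      by apply: measurable_funM => //; apply: mX; exact: (measurable_pos2 measurable_targ).
    by apply: measurable_funM => //; apply: measurable_funM => //; apply: mp; exact: measurable_targ.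
  + exact: measurable_decay.
  + apply: measurable_funM; first by apply: measurable_funM; exact: measurable_inv1_pos2.
    by apply: measurable_funM => //; apply: measurable_funM => //; apply: mp; exact: measurable_teps.
- exact: (measurable_funM measurable_onset measurable_decay).
- apply: measurable_funM.
    by apply: measurable_funM => //; apply: mX; exact: (measurable_pos2 measurable_sarg).
  apply: measurable_funM; first by apply: measurable_funM => //; apply: mp; exact: measurable_sarg.
  by apply: measurable_funM => //; apply: measurable_funM => //; exact: measurable_sdot.
Qed.

Lemma cutoff_support : [set z : X | cutoff z != 0] `<=` stbox rad eps T.
Proof. by move=> z /cutoff_supp. Qed.

Lemma compact_tsupport_cutoff : compact (tsupport cutoff).
Proof.
have cC : compact (stbox rad eps T : set X) by exact: compact_stbox.
apply: (subclosed_compact _ cC); first exact: closed_closure.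
have /closure_id -> : closed (stbox rad eps T : set X).
  by apply: compact_closed cC; exact: norm_hausdorff.
exact: (closure_subset cutoff_support).
Qed.

Lemma continuous_bounded_compact (C : set X) (f : X -> R) : compact C -> continuous f ->
  exists2 M, 0 <= M & forall z, C z -> `|f z| <= M.
Proof.
move=> cC cf.
have /compact_bounded[M [_ hM]] : compact (f @` C).
  by apply: continuous_compact => //; apply: continuous_subspaceT.
exists (`|M| + 1); first by rewrite addr_ge0.
move=> z Cz; apply: hM; last by exists z.
by rewrite (le_lt_trans (ler_norm M)) ?ltrDl.
Qed.

Lemma dcutoff_bounded (v : X) : exists2 M, 0 <= M & forall z, `|dcutoff z v| <= M.
Proof.
have [_ cD] := is_C1_cutoff.
have [M M0 hM] := continuous_bounded_compact (@compact_stbox R N rad eps T) (cD v).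
exists M => // z; have [z0|/cutoff_support /hM//] := eqVneq (cutoff z) 0.
by rewrite (dcutoff_eq0 _ z0) normr0.
Qed.

Lemma cutoff_bounds : exists2 M, 0 <= M & [/\ (forall z, `|cutoff z| <= M),
  (forall z i, `|dcutoff z (e_space R i)| <= M) &
  forall z, `|dcutoff z (e_time R N)| <= M].
Proof.
have [Mt Mt0 hMt] := dcutoff_bounded (e_time R N).
have /fin_all_exists2[Mx Mx0 hMx] := fun i : 'I_N => dcutoff_bounded (e_space R i).
have S0 : 0 <= \sum_i Mx i by apply: sumr_ge0.
exists (1 + Mt + \sum_i Mx i); first by rewrite !addr_ge0.
split=> [z|z i|z].
- rewrite ger0_norm ?cutoff_ge0// (le_trans (cutoff_le1 z))//; lra.
- apply: le_trans (hMx i z) _; rewrite (bigD1 i)//= addrCA lerDl addr_ge0 ?addr_ge0//.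
  exact: sumr_ge0.
- by apply: le_trans (hMt z) _; lra.
Qed.

Lemma bounded_support_L1 (f : ST -> R) (M : R) (C : set ST) : measurable C ->
  (mu C < +oo)%E -> measurable_fun setT f -> 0 <= M -> (forall z, `|f z| <= M) ->
  (forall z, ~ C z -> f z = 0) ->
  (\int[mu]_z `|f z|%:E < +oo)%E.
Proof.
move=> mC Coo mf M0 fM f0.
apply: (@le_lt_trans _ _ (\int[mu]_z (M * \1_C z)%:E)%E).
  apply: nnint_le => //.
  - exact: measurable_abs.
  - by apply: measurable_funM => //; exact: measurable_indic.
  - move=> z; rewrite indicE; have [Cz|nCz] := pselect (C z).
      by rewrite mem_set// mulr1.
    by rewrite f0// normr0 mulr_ge0.
rewrite nnintZ//.
rewrite integral_indic// setIT.
by apply: lte_mul_pinfty.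
Qed.

Lemma cutoff_L1 : (\int[mu]_z `|cutoff z|%:E < +oo)%E.
Proof.
have [M M0 [hM _ _]] := cutoff_bounds.
apply: (bounded_support_L1 (C := stbox rad eps T) _ _ measurable_cutoff M0 hM).
- exact: measurable_stbox.
- exact: stbox_ltoo.
- by move=> z zC; apply/eqP; apply: contra_notT zC => /cutoff_support.
Qed.

Lemma dcutoff_L1 v : (\int[mu]_z `|dcutoff (z : X) v|%:E < +oo)%E.
Proof.
have [M M0 hM] := dcutoff_bounded v.
apply: (bounded_support_L1 (C := stbox rad eps T) _ _ (measurable_dcutoff v) M0 hM).
- exact: measurable_stbox.
- exact: stbox_ltoo.
- move=> z zC; apply: dcutoff_eq0; apply/eqP.
  by apply: contra_notT zC => /cutoff_support.
Qed.

Lemma cutoff_time_supp (z : X) : ~ (eps / 2 < z.2 < T + 1) ->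
  cutoff z = 0 /\ dcutoff z (e_time R N) = 0.
Proof.
move=> zt; suff z0 : cutoff z = 0 by split=> //; exact: dcutoff_eq0.
apply/eqP; apply: contra_notT zt => /cutoff_support[_ /andP[z1 z2]].
have := eps0; lra.
Qed.

End cutoff.

Section pointwise_absorption.
Context {R : realType} {N : nat}.
Local Notation X := ('rV[R]_N * R)%type.
Variables (del p q m : R) (j k : nat).
Hypotheses (del0 : 0 < del) (del1 : del <= 2^-1).
Hypotheses (hp : 0 < p) (hq : 0 < q) (m1 : 1 < m).
Hypotheses (pq2 : 2 < p + q) (pqm : (1 + del) * (2 * m - 2) <= p + q).
Hypothesis (jpq : p + q <= j.+2%:R).
Hypothesis (mk : m <= k.+1%:R).

Lemma ler_enorm (a : 'rV[R]_N) i : `|a ord0 i| <= enorm a.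
Proof.
rewrite /enorm -sqrtr_sqr ler_wsqrtr// /dot (bigD1 i)//= -expr2 lerDl.
by apply: sumr_ge0 => l _; rewrite -expr2 sqr_ge0.
Qed.

(** The gradient of the cutoff enters through [b ^ m psi ^ (1 - m)], which the
    factor [pos (sarg z) ^ (2 (k + 1))] of [psi] bounds by [sqrt psi]. *)
Lemma cutoff_gradient_power (rad T eps : R) (z : X) : 0 < rad -> 0 < T -> 0 < eps ->
  0 < cutoff rad T eps k z ->
  (\sum_(i < N) `|dcutoff rad T eps k z (e_space R i)|) `^ m
    * cutoff rad T eps k z `^ (1 - m) <=
  (4 * k.+1%:R * N%:R) `^ m * (rad `^ m)^-1 * Num.sqrt (cutoff rad T eps k z).
Proof.
move=> r0 T0 e0 psi0; set c := 4 * k.+1%:R * N%:R : R; set psi := cutoff _ _ _ _ _ in psi0 *.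
set b := \sum_(i < N) _; pose al := pos (sarg rad z).
have m0 : 0 < m := lt_trans ltr01 m1.
have al0 : 0 < al.
  rewrite lt_neqAle pos_ge0 andbT eq_sym; apply: contraTneq psi0 => al0.
  by rewrite /psi /cutoff /spc /pos2 -/al al0 expr0n/= expr0n mul0r ltxx.
have al1 : al <= 1 by rewrite pos_le1// sarg_le1.
have bal : b <= c / rad * psi / al.
  rewrite ler_pdivlMr// /b mulr_suml.
  apply: (@le_trans _ _ (\sum_(i < N) (4 * k.+1%:R / rad * psi))).
    by apply: ler_sum => i _; exact: dcutoff_space.
  by rewrite sumr_const card_ord -mulr_natr le_eqVlt; apply/orP; left; apply/eqP; rewrite /c; ring.
have b0 : 0 <= b by apply: sumr_ge0.
have c0 : 0 <= c by rewrite !mulr_ge0.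
apply: (@le_trans _ _ ((c / rad * psi / al) `^ m * psi `^ (1 - m))).
  by rewrite ler_wpM2r ?powR_ge0// le_powR_base// ltW.
have cr0 : 0 <= c / rad by rewrite divr_ge0// ltW.
have ps0 := ltW psi0.
have -> : (c / rad * psi / al) `^ m * psi `^ (1 - m) = c `^ m * (rad `^ m)^-1 * (psi * (al `^ m)^-1).
  have ai0 : 0 <= al^-1 by rewrite invr_ge0 ltW.
  have ri0 : 0 <= rad^-1 by rewrite invr_ge0 ltW.
  rewrite (powRM _ (mulr_ge0 cr0 ps0) ai0) (powRM _ cr0 ps0) (powRM _ c0 ri0).
  have inv (x : R) : 0 < x -> x^-1 `^ m = (x `^ m)^-1.
    by move=> x0; rewrite -(powR_inv1 (ltW x0)) -powRrM mulN1r powRN.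
  rewrite !inv//.
  have psiE : psi `^ m * psi `^ (1 - m) = psi.
    by rewrite -powRD_gt0// addrC subrK powRr1.
  by rewrite -[X in _ = _ * (X * _)]psiE; ring.
rewrite ler_wpM2l ?mulr_ge0 ?invr_ge0 ?powR_ge0//.
rewrite ler_pdivrMr ?powR_gt0//.
rewrite -[X in X <= _](sqr_sqrtr ps0) expr2 ler_wpM2l ?sqrtr_ge0//.
apply: (@le_trans _ _ (al ^+ k.+1)).
  rewrite -[leRHS]ger0_norm ?exprn_ge0 ?(ltW al0)// -sqrtr_sqr ler_wsqrtr//.
  rewrite -exprM mulnC exprM -/(pos2 _) /psi /cutoff -[leRHS]mulr1.
  by rewrite ler_wpM2l ?spc_ge0// onset_decay_le1.
rewrite -powR_mulrn ?(ltW al0)//.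
exact: le_powR_exp.
Qed.

Lemma pointwise_absorption (c0 : R) : 0 < c0 -> exists2 C : R, 0 <= C &
  forall (rad T eps : R) (z : X) (s : R) (a b : 'rV[R]_N),
    0 < rad -> 0 < T -> 0 < eps -> 0 <= s ->
    c0 * enorm a `^ (m / (m - 1)) <= dot a b ->
    - (dcutoff rad T eps k z (e_time R N) * Hf del j s)
    - \sum_(i < N) a ord0 i * dcutoff rad T eps k z (e_space R i) * gf del j s
    - \sum_(i < N) a ord0 i * cutoff rad T eps k z * (dgf del j s * b ord0 i) <=
    C * (T^-1 + (rad `^ m)^-1) * Num.sqrt (s `^ p * (s `^ q * gf del j s * cutoff rad T eps k z)).
Proof.
move=> c00.
have [C1 C10 young] := young_absorb m1 c00.
have [C2 C20 gdg] := gf_dgf_bound del0 del1 hp hq m1 pqm jpq.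
pose c := 4 * k.+1%:R * N%:R : R.
have cm0 : 0 <= c `^ m by exact: powR_ge0.
pose C := 2 * k.+1%:R + C1 * C2 * c `^ m.
have C0 : 0 <= C by rewrite addr_ge0// mulr_ge0// mulr_ge0.
exists C => // rad T eps z s a b r0 T0 e0 s0 cab; set psi := cutoff rad T eps k z.
have psi0 : 0 <= psi by exact: cutoff_ge0.
have h3 : \sum_(i < N) a ord0 i * psi * (dgf del j s * b ord0 i) = psi * dgf del j s * dot a b.
  by rewrite /dot mulr_sumr; apply: eq_bigr => i _; ring.
rewrite h3.
have rm0 : 0 <= (rad `^ m)^-1 by rewrite invr_ge0 powR_ge0.
have Ti0 : 0 <= T^-1 by rewrite invr_ge0 ltW.
have ab0 : 0 <= dot a b by apply: le_trans cab; rewrite mulr_ge0 ?powR_ge0// ltW.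
have [psiE|psin0] := eqVneq psi 0.
  rewrite psiE !mul0r mulr0 mulr0 sqrtr0 mulr0 subr0.
  rewrite (dcutoff_eq0 _ psiE) mul0r oppr0 sub0r oppr_le0 sumr_ge0// => i _.
  by rewrite (dcutoff_eq0 _ psiE) mulr0 mul0r.
have psi_gt0 : 0 < psi by rewrite lt_neqAle eq_sym psin0.
move: s0; rewrite le_eqVlt => /predU1P[sE|s0].
  rewrite -sE /Hf mul0r mulr0 oppr0 sub0r gf0.
  rewrite big1 ?oppr0 ?sub0r => [|i _]; last by rewrite mulr0.
  apply: (@le_trans _ _ 0).
    by rewrite oppr_le0; apply: mulr_ge0 => //; apply: mulr_ge0 => //; exact: dgf_ge0.
  by apply: mulr_ge0; rewrite ?sqrtr_ge0// mulr_ge0// addr_ge0.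
have g0 : 0 <= gf del j s by exact: gf_ge0 (ltW s0).
have dg0 : 0 < dgf del j s by exact: dgf_gt0.
set Q := Num.sqrt (s `^ p * (s `^ q * gf del j s)).
have -> : Num.sqrt (s `^ p * (s `^ q * gf del j s * psi)) = Q * Num.sqrt psi.
  by rewrite -sqrtrM ?mulrA// !mulr_ge0 ?powR_ge0.
have Q0 : 0 <= Q by exact: sqrtr_ge0.
have P0 : 0 <= Num.sqrt psi by exact: sqrtr_ge0.
have time : - (dcutoff rad T eps k z (e_time R N) * Hf del j s) <=
    2 * k.+1%:R * T^-1 * (Q * Num.sqrt psi).
  rewrite -mulNr; have HQ : Hf del j s <= Q by exact: (Hf_bound del0 del1 pq2 jpq (ltW s0)).
  have H0 : 0 <= Hf del j s.
    by rewrite mulr_ge0// ?(ltW s0)// exprn_ge0// rise_ge0// ltW.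
  apply: (@le_trans _ _ (2 * k.+1%:R / T * Num.sqrt psi * Hf del j s)).
    by rewrite ler_wpM2r// dcutoff_time.
  rewrite (_ : _ * (Q * _) = 2 * k.+1%:R / T * Num.sqrt psi * Q); last by ring.
  by rewrite ler_wpM2l// mulr_ge0// divr_ge0 ?mulr_ge0// ltW.
have space : - (\sum_(i < N) a ord0 i * dcutoff rad T eps k z (e_space R i) * gf del j s)
    - psi * dgf del j s * dot a b <=
    C1 * C2 * c `^ m * (rad `^ m)^-1 * (Q * Num.sqrt psi).
  set bb := \sum_(i < N) `|dcutoff rad T eps k z (e_space R i)|.
  have bb0 : 0 <= bb by apply: sumr_ge0.
  have en0 : 0 <= enorm a by exact: sqrtr_ge0.
  apply: (@le_trans _ _ (gf del j s * bb * enorm a - c0 * (psi * dgf del j s) * enorm a `^ (m / (m - 1)))).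
    apply: lerD.
      rewrite -sumrN mulrAC -mulrA mulr_sumr -[X in X * _]/(gf del j s) mulr_sumr.
      apply: ler_sum => i _.
      apply: (le_trans (ler_norm _)); rewrite normrN !normrM (ger0_norm g0) mulrC.
      rewrite ler_wpM2l//; rewrite ler_wpM2r//; exact: ler_enorm.
    rewrite lerN2.
    rewrite (_ : c0 * _ * _ = psi * dgf del j s * (c0 * enorm a `^ (m / (m - 1)))); last by ring.
    by rewrite ler_wpM2l// mulr_ge0// ltW.
  have Y0 : 0 < psi * dgf del j s by rewrite mulr_gt0.
  apply: (le_trans (young _ _ _ en0 (mulr_ge0 g0 bb0) Y0)).
  rewrite (_ : C1 * C2 * c `^ m * (rad `^ m)^-1 * (Q * Num.sqrt psi) =
     C1 * ((C2 * Q) * (c `^ m * (rad `^ m)^-1 * Num.sqrt psi))); last by ring.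
  rewrite ler_wpM2l// (powRM _ g0 bb0) (powRM _ psi0 (ltW dg0)).
  rewrite (_ : _ * _ = (gf del j s `^ m * dgf del j s `^ (1 - m)) * (bb `^ m * psi `^ (1 - m))); last by ring.
  apply: ler_pM; rewrite ?mulr_ge0 ?powR_ge0//; first exact: gdg.
  exact: cutoff_gradient_power.
rewrite -addrA; apply: le_trans (lerD time space) _.
rewrite -mulrDl ler_wpM2r ?mulr_ge0//.
have h1 : 2 * k.+1%:R <= C by rewrite lerDl !mulr_ge0.
have h2 : C1 * C2 * c `^ m <= C by rewrite lerDr mulr_ge0.
by rewrite mulrDr lerD// ler_wpM2r.
Qed.

End pointwise_absorption.

Section almost_everywhere_comparison.
Context d (T : measurableType d) {R : realType} (mu : {measure set T -> \bar R}).
Local Open Scope ereal_scope.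
Import HBNNSimple.

Let nn (f : T -> \bar R) :=
  ereal_sup [set sintegral mu h | h in [set h : {nnsfun T >-> R} | forall x, (h x)%:E <= f x]].

(** No measurability is needed: a simple function below [f] lies below [g] once
    it is cut off on a null set. *)
Lemma ae_le_sup_sintegral (f g : T -> \bar R) : (forall x, 0 <= g x) ->
  {ae mu, forall x, f x <= g x} -> nn f <= nn g.
Proof.
move=> g0 [A [mA A0 fgA]]; apply: ub_ereal_sup => _ [h hf <-].
pose h' := proj_nnsfun h (measurableC mA).
have h'E x : h' x = (h x * \1_(~` A) x)%R by rewrite /= mindicE.
have -> : sintegral mu h = sintegral mu h'.
  rewrite -!integralT_nnsfun; apply: ge0_ae_eq_integral => //.
  - by apply/measurable_EFinP.
  - by apply/measurable_EFinP.
  - by move=> x _; rewrite lee_fin.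
  - by move=> x _; rewrite lee_fin.
  exists A; split => // x /=; apply: contra_notP => nAx _.
  change ((h x)%:E = (h' x)%:E).
  by rewrite h'E indicE mem_set// mulr1.
apply: ereal_sup_ubound; exists h' => // x; rewrite h'E indicE.
have [Ax|nAx] := pselect (A x).
  by rewrite memNset ?mulr0//=; apply.
rewrite mem_set// mulr1; apply: le_trans (hf x) _.
by apply: contra_notP nAx => nfg; exact: fgA.
Qed.

Lemma ae_le_integral (D : set T) (f g : T -> \bar R) :
  {ae mu, forall x, D x -> f x <= g x} ->
  \int[mu]_(x in D) f x <= \int[mu]_(x in D) g x.
Proof.
move=> fg; rewrite /integral -/(nn _) -/(nn _).
have fg' : {ae mu, forall x, (f \_ D) x <= (g \_ D) x}.
  apply: filterS fg => x fgx; rewrite /patch; case: ifPn => // /set_mem Dx.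
  exact: fgx.
apply: leeB; apply: ae_le_sup_sintegral => //.
- by apply: filterS fg' => x fgx; rewrite !funeposE ge_max !le_max fgx lexx orbT.
- by apply: filterS fg' => x fgx; rewrite !funenegE ge_max !le_max leeN2 fgx lexx orbT.
Qed.

Lemma ae_eq_integral_nm (D : set T) (f g : T -> \bar R) :
  {ae mu, forall x, D x -> f x = g x} ->
  \int[mu]_(x in D) f x = \int[mu]_(x in D) g x.
Proof.
move=> fg; apply/eqP; rewrite eq_le; apply/andP; split; apply: ae_le_integral.
  by apply: filterS fg => x fgx /fgx ->.
by apply: filterS fg => x fgx /fgx ->.
Qed.

End almost_everywhere_comparison.

Section time_slices.
Context {R : realType} {N : nat}.
Local Notation ST := ('rV[R]_N * measurableTypeR R)%type.
Local Notation X := ('rV[R]_N * R)%type.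
Local Notation mu := (@spacetime_measure R N).
Local Notation leb := (lebesgue_rV R N).
Local Open Scope ereal_scope.

Lemma integral_slices (f : ST -> \bar R) : measurable_fun setT f ->
  (forall z, 0 <= f z) ->
  \int[mu]_z f z = \int[lebesgue_measure]_t \int[leb]_x f (x, t).
Proof.
move=> mf f0; rewrite /spacetime_measure.
exact: (@fubini_tonelli2 _ _ _ _ R leb lebesgue_measure f mf f0).
Qed.

Lemma measurable_slice_integral (f : ST -> \bar R) : measurable_fun setT f ->
  (forall z, 0 <= f z) ->
  measurable_fun [set: measurableTypeR R] (fun t : measurableTypeR R => \int[leb]_x f (x, t)).
Proof. exact: (@measurable_fun_fubini_tonelli_G _ _ _ _ _ leb f). Qed.

Lemma measurable_slice (f : ST -> \bar R) (t : R) : measurable_fun setT f ->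
  measurable_fun setT (fun x : 'rV[R]_N => f (x, t)).
Proof. by move=> mf; apply: (measurableT_comp mf); exact: pair2_measurable. Qed.

Lemma ae_slices (P : X -> Prop) : {ae mu, forall z, P z} ->
  {ae lebesgue_measure, forall t : measurableTypeR R, {ae leb, forall x, P (x, t)}}.
Proof.
move=> [A [mA A0 PA]].
have mi : measurable_fun setT (fun z : ST => (\1_A z : R)%:E).
  by apply/measurable_EFinP; exact: measurable_indic.
have i0 (z : ST) : 0 <= (\1_A z : R)%:E by rewrite lee_fin.
have I0 : \int[lebesgue_measure]_t `|\int[leb]_x (\1_A (x, t) : R)%:E| = 0.
  transitivity (\int[mu]_z (\1_A z : R)%:E).
    rewrite (integral_slices mi i0); apply: eq_integral => t _.
    by rewrite gee0_abs//; apply: integral_ge0 => x _; exact: i0.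
  by rewrite integral_indic// setIT.
have mG := measurable_slice_integral mi i0.
move/(ae_eq_integral_abs _ measurableT mG) : I0 => I0.
apply: filterS I0 => t /(_ Logic.I) /= It.
have mt : measurable_fun setT (fun x : 'rV[R]_N => (\1_A (x, t) : R)%:E).
  exact: (measurable_slice t mi).
have /(ae_eq_integral_abs _ measurableT mt) : \int[leb]_x `|(\1_A (x, t) : R)%:E| = 0.
  rewrite -[RHS]It; apply: eq_integral => x _.
  by rewrite gee0_abs//; exact: (i0 (x, t)).
move=> Jt; apply: filterS Jt => x /(_ Logic.I) /= /eqP.
rewrite eqe indicE; case: (boolP (_ \in _)) => [|nA _]; first by rewrite oner_eq0.
by apply: contrapT => nP; move/negP : nA; apply; apply/mem_set; exact: PA.
Qed.

Lemma slices_null (E : set ST) : measurable E ->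
  {ae lebesgue_measure, forall t : measurableTypeR R, {ae leb, forall x, ~ E (x, t)}} ->
  mu E = 0.
Proof.
move=> mE hE.
have mi : measurable_fun setT (fun z : ST => (\1_E z : R)%:E).
  by apply/measurable_EFinP; exact: measurable_indic.
have i0 (z : ST) : 0 <= (\1_E z : R)%:E by rewrite lee_fin.
transitivity (\int[mu]_z (\1_E z : R)%:E); first by rewrite integral_indic// setIT.
rewrite (integral_slices mi i0).
transitivity (\int[lebesgue_measure]_(t in setT) (fun _ : measurableTypeR R => 0 : \bar R) t).
  apply: ae_eq_integral_nm; apply: filterS hE => t ht _.
  transitivity (\int[leb]_(x in setT) (fun _ : 'rV[R]_N => 0 : \bar R) x).
    apply: ae_eq_integral_nm; apply: filterS ht => x hx _.
    by rewrite indicE memNset.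
  by rewrite integral0.
by rewrite integral0.
Qed.

End time_slices.

Section measurable_versions.
Context {R : realType} {N : nat}.
Local Notation ST := ('rV[R]_N * measurableTypeR R)%type.
Local Notation X := ('rV[R]_N * R)%type.
Local Notation mu := (@spacetime_measure R N).

Lemma measurable_halfspace : measurable (open_halfspace : set ST).
Proof.
rewrite (_ : open_halfspace = snd @^-1` `]0, +oo[%classic).
  by rewrite -[X in measurable X]setTI; apply: measurable_time_coord.
by apply/seteqP; split => z /=; rewrite /open_halfspace/= in_itv/= andbT.
Qed.

Lemma measurable_version (D : set ST) (f : ST -> R) : measurable D ->
  ae_measurable mu D f -> exists2 g : ST -> R, measurable_fun setT g &
    {ae mu, forall z, D z -> f z = g z}.
Proof.
move=> mD [g mg fg]; exists (g \_ D); first exact/(measurable_restrictT _ mD).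
by apply: filterS fg => z fgz Dz; rewrite patchE mem_set// fgz.
Qed.

Lemma measurable_version_ereal (D : set ST) (f : ST -> \bar R) : measurable D ->
  ae_measurable mu D f -> exists2 g : ST -> \bar R, measurable_fun setT g &
    {ae mu, forall z, D z -> f z = g z}.
Proof.
move=> mD [g mg fg]; exists (g \_ D); first exact/(measurable_restrictT _ mD).
by apply: filterS fg => z fgz Dz; rewrite patchE mem_set// fgz.
Qed.

Lemma stbox_subset (r a b : R) : 0 < a -> stbox r a b `<=` (open_halfspace : set X).
Proof. by move=> a0 z [_ /andP[az _]]; exact: lt_le_trans az. Qed.

Lemma le_powR1 (x r : R) : 0 <= x -> 1 <= r -> x <= 1 + x `^ r.
Proof.
move=> x0 r1; have [x1|/ltW x1] := leP x 1; first by rewrite (le_trans x1)// lerDl powR_ge0.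
rewrite (@le_trans _ _ (x `^ r)) ?lerDr//.
by rewrite -[leLHS](powRr1 x0) ler_powR.
Qed.

Definition box_Lp (r : R) (g : ST -> R) := forall rad a b : R, 0 < a ->
  (\int[mu]_z (`|g z * \1_(stbox rad a b : set ST) z| `^ r)%:E < +oo)%E.

Definition box_L1 (g : ST -> R) := forall rad a b : R, 0 < a ->
  (\int[mu]_z `|g z * \1_(stbox rad a b : set ST) z|%:E < +oo)%E.

Lemma box_Lp_L1 (r : R) (g : ST -> R) : 1 <= r -> measurable_fun setT g ->
  box_Lp r g -> box_L1 g.
Proof.
move=> r1 mg gr rad a b a0.
have mC : measurable (stbox rad a b : set ST) by exact: measurable_stbox.
have mgC : measurable_fun setT (fun z : ST => g z * \1_(stbox rad a b : set ST) z).
  by apply: measurable_funM => //; exact: measurable_indic.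
have mpow : measurable_fun setT
    (fun z : ST => `|g z * \1_(stbox rad a b : set ST) z| `^ r).
  exact: (measurableT_comp (measurable_powR _) (measurable_abs mgC)).
apply: (@le_lt_trans _ _ (\int[mu]_z (\1_(stbox rad a b : set ST) z)%:E +
    \int[mu]_z (`|g z * \1_(stbox rad a b : set ST) z| `^ r)%:E)%E).
  apply: nnint_leD => //.
  - exact: measurable_abs.
  - move=> z; rewrite indicE; case: (boolP (_ \in _)) => _.
      by rewrite !mulr1 le_powR1.
    by rewrite !mulr0 normr0 add0r powR_ge0.
rewrite lte_add_pinfty//; last exact: gr.
by rewrite integral_indic// setIT; exact: stbox_ltoo.
Qed.

Lemma Lploc_version (r : R) (f : ST -> R) : 0 < r -> Lploc r open_halfspace f ->
  exists g : ST -> R, [/\ measurable_fun setT g,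
    {ae mu, forall z, open_halfspace z -> f z = g z} & box_Lp r g].
Proof.
move=> r0 [mf fr]; have [g mg fg] := measurable_version measurable_halfspace mf.
exists g; split => // rad a b a0.
apply: le_lt_trans (fr (stbox rad a b) (@compact_stbox _ _ _ _ _) (stbox_subset a0)).
rewrite [leRHS]integral_mkcond; apply: ae_le_integral.
apply: filterS fg => z fgz _; rewrite patchE indicE.
case: (boolP (_ \in _)) => [/set_mem Cz|_].
  by rewrite mulr1 fgz//; exact: stbox_subset Cz.
by rewrite mulr0 normr0 powR0// gt_eqF.
Qed.

(** The positive and negative parts are compared separately, so measurability
    plays no part. *)
Lemma integral_fin_num (f : ST -> \bar R) (D : set ST) :
  (\int[mu]_(z in D) `|f z| < +oo)%E -> (\int[mu]_(z in D) f z)%E \is a fin_num.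
Proof.
move=> foo; rewrite fin_numE; apply/andP; split.
  rewrite -ltNye; apply: (@lt_le_trans _ _ (\int[mu]_(z in D) (- `|f z|))%E).
    rewrite integral_ge0N// ltNye_eq fin_numN ge0_fin_numE ?foo//.
    exact: integral_ge0.
  by apply: ae_le_integral; apply: nearW => z _; rewrite leeNl -abseN; exact: lee_abs.
rewrite -ltey; apply: le_lt_trans foo; apply: ae_le_integral.
by apply: nearW => z _; exact: lee_abs.
Qed.

End measurable_versions.

Section clean_solutions.
Context {R : realType} {N : nat}.
Local Notation ST := ('rV[R]_N * measurableTypeR R)%type.
Local Notation X := ('rV[R]_N * R)%type.
Local Notation mu := (@spacetime_measure R N).
Local Notation D := (open_halfspace : set ST).

(** Everywhere measurable representatives of a solution and of the data
    attached to it. *)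
Record clean_solution (m c0 : R) (v sg vt : ST -> R) (Dv F : 'I_N -> ST -> R) : Prop := {
  clean_meas : [/\ measurable_fun setT v, measurable_fun setT sg,
    measurable_fun setT vt, (forall i, measurable_fun setT (Dv i)) &
    (forall i, measurable_fun setT (F i))] ;
  clean_ge0 : forall z, 0 <= v z ;
  clean_L1 : [/\ box_L1 v, box_L1 sg & box_L1 vt] ;
  clean_Lm : forall i, box_Lp m (Dv i) ;
  clean_Lm' : forall i, box_Lp (m / (m - 1)) (F i) ;
  clean_dx : forall i, weak_derivative D (e_space R i) v (Dv i) ;
  clean_dt : weak_derivative D (e_time R N) v vt ;
  clean_coercive : {ae mu, forall z : ST, D z ->
    c0 * enorm (\row_i F i z) `^ (m / (m - 1)) <= dot (\row_i F i z) (\row_i Dv i z)} ;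
  clean_weak : forall (rad a b : R), 0 < a -> forall phi : X -> R, C1c setT phi ->
    (forall z, 0 <= phi z) -> [set z | phi z != 0] `<=` stbox rad a b ->
    \int[mu]_z (sg z * \1_(stbox rad a b : set ST) z * phi z) <=
    \int[mu]_z (vt z * \1_(stbox rad a b : set ST) z * phi z) -
    \int[mu]_z (\sum_(i < N)
      F i z * \1_(stbox rad a b : set ST) z * 'D_(e_space R i) phi z) }.

Lemma derive_outside (C : set X) (phi : X -> R) (z v : X) : closed C ->
  [set z | phi z != 0] `<=` C -> ~ C z -> 'D_v phi z = 0.
Proof.
move=> cC phiC nC.
have -> : 'D_v phi z = 'D_v (cst 0 : X -> R) z; last exact: derive_cst.
apply: near_eq_derive.
have : nbhs z (~` C) by apply: open_nbhs_nbhs; split => //; exact: closed_openC.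
apply: filterS => w nCw /=; apply/eqP; apply: contra_notT nCw => w0.
exact: phiC.
Qed.

Lemma closed_stbox (rad a b : R) : closed (stbox rad a b : set X).
Proof. by apply: compact_closed; [exact: norm_hausdorff|exact: compact_stbox]. Qed.

Lemma weak_derivative_version (v : X) (f g f' g' : ST -> R) :
  {ae mu, forall z : ST, D z -> f z = f' z} -> {ae mu, forall z : ST, D z -> g z = g' z} ->
  weak_derivative D v f g -> weak_derivative D v f' g'.
Proof.
move=> ff gg fg psi psiC.
transitivity (\int[mu]_(z in D) (f z * 'D_v psi z)%:E)%E.
  by apply: ae_eq_integral_nm; apply: filterS ff => z fz Dz; rewrite fz.
rewrite (fg psi psiC); congr (- _)%E.
by apply: ae_eq_integral_nm; apply: filterS gg => z fz Dz; rewrite fz.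
Qed.

Lemma integral_box_version (f : ST -> \bar R) (g : ST -> R) (rad a b : R) : 0 < a ->
  {ae mu, forall z : ST, D z -> f z = (g z)%:E} ->
  (forall z, ~ stbox rad a b z -> D z -> f z = 0%E) ->
  (\int[mu]_(z in D) f z = \int[mu]_z (g z * \1_(stbox rad a b : set ST) z)%:E)%E.
Proof.
move=> a0 fg f0; rewrite integral_mkcond; apply: ae_eq_integral_nm.
apply: filterS fg => z fgz _; rewrite patchE indicE.
have [Dz|nDz] := pselect (D z).
  rewrite mem_set//; case: (boolP (_ \in _)) => [_|/negP nC].
    by rewrite mulr1 fgz.
  by rewrite mulr0 f0// => Cz; apply: nC; exact/mem_set.
have nC : ~ stbox rad a b (z : X) by move=> /(stbox_subset a0).
by rewrite (memNset nC) (memNset nDz) mulr0.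
Qed.

Lemma archi_boundP_ge (x : R) : exists n : nat, x <= n%:R.
Proof.
exists (Num.bound x); have [x0|/ltW x0] := leP 0 x; last by apply: le_trans x0 _.
exact: ltW (archi_boundP x0).
Qed.

Lemma fine_version (f : ST -> \bar R) : L1loc D f ->
  exists g : ST -> R, [/\ measurable_fun setT g, box_L1 g &
    {ae mu, forall z : ST, D z -> f z = (g z)%:E}].
Proof.
move=> [mf fL]; have [h mh fh] := measurable_version_ereal measurable_halfspace mf.
have hC rad a b : 0 < a -> (\int[mu]_z `|h z * (\1_(stbox rad a b : set ST) z)%:E| < +oo)%E.
  move=> a0; apply: le_lt_trans (fL (stbox rad a b) (@compact_stbox _ _ _ _ _) (stbox_subset a0)).
  rewrite [leRHS]integral_mkcond; apply: ae_le_integral.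
  apply: filterS fh => z fhz _; rewrite patchE indicE.
  case: (boolP (_ \in _)) => [/set_mem Cz|_]; last by rewrite mule0 abse0.
  have Dz : D z := stbox_subset a0 Cz.
  by rewrite mule1 fhz.
have mg : measurable_fun setT (fun z => fine (h z)) by exact: measurableT_comp.
exists (fun z => fine (h z)); split => //.
  move=> rad a b a0; apply: le_lt_trans (hC rad a b a0); apply: ae_le_integral.
  apply: nearW => z _; rewrite indicE; case: (boolP (_ \in _)) => _.
    by rewrite mulr1 mule1; case: (h z) => [r| |]//=; rewrite normr0 leey.
  by rewrite mulr0 normr0 abse_ge0.
have fin : {ae mu, forall (z : ST) (n : nat), (h z * (\1_(stbox n%:R n.+1%:R^-1 n%:R : set ST) z)%:E)%E \is a fin_num}.
  apply/ae_foralln => n.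
  have mi : mu.-integrable setT (fun z => h z * (\1_(stbox n%:R n.+1%:R^-1 n%:R : set ST) z)%:E)%E.
    apply/integrableP; split; last by apply: hC; rewrite invr_gt0.
    apply: emeasurable_funM => //; apply/measurable_EFinP; apply: measurable_indic.
    exact: measurable_stbox.
  by apply: filterS (integrable_ae measurableT mi) => z; exact.
move: fin fh; apply: filterS2 => z fin fhz Dz.
rewrite fhz// fineK//.
have [n nz] : exists n : nat, stbox n%:R n.+1%:R^-1 n%:R (z : X).
  have z0 : 0 < z.2 := Dz.
  have [n hn] := archi_boundP_ge (`|z : X| + (z.2 : R)^-1).
  exists n; split.
    move=> i; apply: (le_trans (ler_norm_space z i)); apply: le_trans hn.
    by rewrite lerDl invr_ge0 ltW.
  apply/andP; split; last first.
    apply: le_trans hn; apply: (le_trans (ler_norm _)); apply: (le_trans (ler_norm_time z)).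
    by rewrite lerDl invr_ge0 ltW.
  rewrite -[leRHS]invrK lef_pV2 ?posrE ?invr_gt0//.
  apply: (@le_trans _ _ n%:R); last by rewrite ler_nat.
  by apply: le_trans hn; rewrite lerDr.
by have := fin n; rewrite indicE mem_set// mule1.
Qed.

Lemma clean_solution_exists (A : 'rV[R]_N -> R -> 'rV[R]_N -> 'rV[R]_N) (m p q : R)
    (K : 'rV[R]_N -> R) (u0 : 'rV[R]_N -> R) (u : X -> R) :
  weakly_coercive m A -> weak_solution A m K p q u0 u ->
  exists (c0 : R) (v sg vt : ST -> R) (Dv F : 'I_N -> ST -> R),
  [/\ 0 < c0, clean_solution m c0 v sg vt Dv F,
    {ae mu, forall z : ST, D z -> u z = v z} &
    {ae mu, forall z : ST, D z -> (convolution K p u z * (u z `^ q)%:E)%E = (sg z)%:E}].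
Proof.
move=> hA [Du [ut /=[u_ge0 [Wu WDu Wut WDuP WutP] _ [LF Lsrc] weak]]].
have {}u_ge0 : {ae mu, forall z : ST, D z -> 0 <= u z} by exact: u_ge0.
have [c0 c00 coer] := wc_coercive hA; have m1 := wc_exponent hA.
have m0 : 0 < m := lt_trans ltr01 m1.
have m'0 : 0 < m / (m - 1) by rewrite divr_gt0// subr_gt0.
have m'1 : 1 <= m / (m - 1) by rewrite ler_pdivlMr ?subr_gt0// mul1r gerBl.
have [v0 [mv0 uv0 Lv0]] := Lploc_version m0 Wu.
have [vt [mvt uvt Lvt]] := Lploc_version m0 Wut.
have /fin_all_exists[Dv hDv] := fun i => Lploc_version m0 (WDu i).
have /fin_all_exists[F hF] := fun i => Lploc_version m'0 (LF i).
have [sg [msg Lsg ssg]] := fine_version Lsrc.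
pose v (z : ST) := pos (v0 z).
have mv : measurable_fun setT v by exact: (measurableT_comp (@measurable_pos R) mv0).
have uv : {ae mu, forall z : ST, D z -> u z = v z}.
  move: u_ge0 uv0; apply: filterS2 => z uz uvz Dz.
  by rewrite /v -uvz// pos_id// uz.
have {}uvt : {ae mu, forall z : ST, D z -> ut z = vt z} by exact: uvt.
have vx i : {ae mu, forall z : ST, D z -> Du z ord0 i = Dv i z} by have [] := hDv i.
have fx i : {ae mu, forall z : ST, D z -> (A z.1 (u z) (Du z)) ord0 i = F i z} by have [] := hF i.
have Lv : box_Lp m v.
  move=> rad a b a0; apply: le_lt_trans (Lv0 rad a b a0); apply: ae_le_integral.
  apply: nearW => z _; rewrite lee_fin; apply: le_powR_base => //; first exact: ltW.
  rewrite !normrM ler_wpM2r// /v /pos; case: (leP 0 (v0 z)) => //.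
  by rewrite normr0.
exists c0, v, sg, vt, Dv, F; split => //; split.
- by split=> // i; [case: (hDv i)|case: (hF i)].
- by move=> z; exact: pos_ge0.
- split=> //; [apply: box_Lp_L1 Lv|apply: box_Lp_L1 Lvt] => //; exact: ltW.
- by move=> i; case: (hDv i).
- by move=> i; case: (hF i).
- by move=> i; apply: weak_derivative_version uv (vx i) (WDuP i).
- by apply: weak_derivative_version uv uvt WutP.
- have vxA : {ae mu, forall (z : ST) i, D z -> Du z ord0 i = Dv i z} by apply: filter_forall => i.
  have fxA : {ae mu, forall (z : ST) i, D z -> (A z.1 (u z) (Du z)) ord0 i = F i z} by apply: filter_forall => i.
  move: u_ge0 vxA fxA; apply: filterS3 => z uz vz fz Dz.
  have -> : \row_i F i z = A z.1 (u z) (Du z) by apply/rowP => i; rewrite mxE fz.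
  have -> : \row_i Dv i z = Du z by apply/rowP => i; rewrite mxE vz.
  by apply: coer; exact: uz.
- move=> rad a b a0 phi C1phi phi0 phiC.
  have [[_ Iut] [_ Idot] ineq] := weak phi C1phi phi0.
  have [[dphi _] _ _] := C1phi.
  have cphi : continuous phi by move=> z; exact: differentiable_continuous.
  have out z : ~ stbox rad a b z -> phi z = 0.
    by move=> nC; apply/eqP; apply: contra_notT nC => z0; exact: phiC.
  have dout z w : ~ stbox rad a b z -> 'D_w phi z = 0.
    by apply: (derive_outside (C := stbox rad a b)) => //; exact: closed_stbox.
  have [M M0 hM] := continuous_bounded_compact (@compact_stbox R N rad a b) cphi.
  have phiM z : `|phi z| <= M.
    by have [/hM//|/out ->] := pselect (stbox rad a b z); rewrite normr0.
  have E1 : (\int[mu]_(z in D) ((convolution K p u z * (u z `^ q)%:E) * (phi z)%:E) =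
      \int[mu]_z (sg z * \1_(stbox rad a b : set ST) z * phi z)%:E)%E.
    rewrite (integral_box_version (rad := rad) (b := b) (g := fun z => sg z * phi z) a0).
    - by apply: eq_integral => z _; rewrite mulrAC.
    - by apply: filterS ssg => z sz Dz; rewrite sz.
    - by move=> z nC _; rewrite (out _ nC) mule0.
  have E2 : (\int[mu]_(z in D) (ut z * phi z)%:E =
      \int[mu]_z (vt z * \1_(stbox rad a b : set ST) z * phi z)%:E)%E.
    rewrite (integral_box_version (rad := rad) (b := b) (g := fun z => vt z * phi z) a0).
    - by apply: eq_integral => z _; rewrite mulrAC.
    - by apply: filterS uvt => z sz Dz; rewrite sz.
    - by move=> z nC _; rewrite (out _ nC) mulr0.
  have E3 : (\int[mu]_(z in D) (dot (A z.1 (u z) (Du z)) (grad phi z))%:E =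
      \int[mu]_z (\sum_(i < N) F i z * \1_(stbox rad a b : set ST) z *
        'D_(e_space R i) phi (z : X))%:E)%E.
    rewrite (integral_box_version (rad := rad) (b := b) (g := fun z => \sum_(i < N) F i z * 'D_(e_space R i) phi (z : X)) a0).
    - apply: eq_integral => z _; congr EFin; rewrite mulr_suml.
      by apply: eq_bigr => i _; rewrite mulrAC.
    - have fxA : {ae mu, forall (z : ST) i, D z -> (A z.1 (u z) (Du z)) ord0 i = F i z}.
        by apply: filter_forall => i.
      apply: filterS fxA => z fz Dz; congr EFin.
      by apply: eq_bigr => i _; rewrite fz// mxE.
    - move=> z nC _; congr EFin; apply: big1 => i _.
      by rewrite mxE dout// mulr0.
  have f1 : (\int[mu]_z (sg z * \1_(stbox rad a b : set ST) z * phi z)%:E)%E \is a fin_num.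
    apply: integral_fin_num.
    apply: (@le_lt_trans _ _ (\int[mu]_z (M * `|sg z * \1_(stbox rad a b : set ST) z|)%:E)%E).
      apply: ae_le_integral; apply: nearW => z _.
      by rewrite lee_fin normrM mulrC ler_wpM2r.
    rewrite nnintZ//; first by apply: lte_mul_pinfty => //; exact: Lsg.
    apply: measurable_abs; apply: measurable_funM => //; apply: measurable_indic.
    exact: measurable_stbox.
  have f2 := integral_fin_num Iut; have f3 := integral_fin_num Idot.
  move: f2 f3 ineq; rewrite E1 E2 E3 => f2 f3 ineq.
  by rewrite /Rintegral -lee_fin EFinB !fineK.
Qed.

End clean_solutions.

Section energy_bound.
Context {R : realType} {N : nat}.
Local Notation ST := ('rV[R]_N * measurableTypeR R)%type.
Local Notation X := ('rV[R]_N * R)%type.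
Local Notation mu := (@spacetime_measure R N).
Local Notation D := (open_halfspace : set ST).
Local Notation L1 f := (measurable_fun setT (f : ST -> R) /\ (\int[mu]_z `|f z|%:E < +oo)%E).

Lemma pairing_conjugate (m : R) (a f : ST -> R) : 1 < m ->
  measurable_fun setT a -> measurable_fun setT f ->
  (\int[mu]_z (`|a z| `^ (m / (m - 1)))%:E < +oo)%E ->
  (\int[mu]_z (`|f z| `^ m)%:E < +oo)%E -> pairing a f.
Proof.
move=> m1 ma mf aoo foo.
have mp (g : ST -> R) (r : R) : measurable_fun setT g -> measurable_fun setT (fun z => `|g z| `^ r).
  by move=> mg; exact: (measurableT_comp (measurable_powR _) (measurable_abs mg)).
exists (fun z => `|a z| `^ (m / (m - 1))), (fun z => `|f z| `^ m); split => //.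
- exact: mp.
- exact: mp.
- move=> eta eta0; have [C C0 hC] := young_absorb m1 eta0; exists C => // z z'.
  have := hC `|a z| `|f z'| 1 (normr_ge0 _) (normr_ge0 _) ltr01.
  by rewrite powR1 !mulr1 mulrC; lra.
Qed.

Lemma le_rearrange (x y z w : R) : x + y <= - z - w -> x <= - (z + (w + y)).
Proof. by lra. Qed.

Lemma L1D (f g : ST -> R) : L1 f -> L1 g -> L1 (fun z => f z + g z).
Proof.
move=> [mf foo] [mg goo]; have mfg := measurable_funD mf mg; split => //.
apply: (@le_lt_trans _ _ (\int[mu]_z `|f z|%:E + \int[mu]_z `|g z|%:E)%E).
  apply: nnint_leD; [exact: measurable_abs|exact: measurable_abs|exact: measurable_abs|..] => // z.
  exact: ler_normD.
exact: lte_add_pinfty.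
Qed.

Lemma L1_sum (f : 'I_N -> ST -> R) : (forall i, L1 (f i)) -> L1 (fun z => \sum_(i < N) f i z).
Proof.
move=> Lf; have mS : measurable_fun setT (fun z => \sum_(i < N) f i z).
  by apply: measurable_sum => i; case: (Lf i).
split => //; apply/(integrable_nnint mu mS); apply: integrable_sumR => i.
exact: L1_integrable.
Qed.

Lemma near_box (rad T eps lam : R) (z w : X) : 0 < eps -> 1 <= lam -> 2 / eps <= lam ->
  stbox rad eps T z -> `|w - z| <= lam^-1 -> stbox (rad + 1) (eps / 2) (T + 1) w.
Proof.
move=> e0 l1 le [zx /andP[zt1 zt2]] wz.
have l0 : 0 < lam by apply: lt_le_trans l1.
have li1 : lam^-1 <= 1 by rewrite invf_le1.
have lie : lam^-1 <= eps / 2.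
  by rewrite -[leRHS]invrK lef_pV2 ?posrE ?invr_gt0 ?divr_gt0// invf_div.
have hx i : `|(w - z).1 ord0 i| <= lam^-1 by exact: le_trans (ler_norm_space (w - z) i) wz.
have ht : `|(w - z).2| <= lam^-1 by exact: le_trans (ler_norm_time (w - z)) wz.
split.
  move=> i; have := hx i; rewrite !mxE => h.
  have -> : w.1 ord0 i = z.1 ord0 i + (w.1 ord0 i - z.1 ord0 i) by ring.
  apply: (le_trans (ler_normD _ _)); apply: lerD (zx i) _.
  exact: le_trans h li1.
move: ht => /= ht; have h1 := le_trans ht li1; have h2 := le_trans ht lie.
move: h1 h2; rewrite !ler_norml => /andP[h1 h2] /andP[h3 h4].
apply/andP; split; lra.
Qed.

Variables (del p q m c0 : R) (j k : nat).
Hypotheses (del0 : 0 < del) (del1 : del <= 2^-1).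
Hypotheses (hp : 0 < p) (hq : 0 < q) (m1 : 1 < m) (c00 : 0 < c0).
Hypotheses (pq2 : 2 < p + q) (pqm : (1 + del) * (2 * m - 2) <= p + q).
Hypothesis (jpq : p + q <= j.+2%:R).
Hypothesis (mk : m <= k.+1%:R).

Lemma energy_bound : exists2 C : R, 0 < C &
  forall (v sg vt : ST -> R) (Dv F : 'I_N -> ST -> R), clean_solution m c0 v sg vt Dv F ->
  forall rad T eps : R, 0 < rad -> 0 < T -> 0 < eps -> eps <= T ->
  L1 (fun z : ST => sg z * cutoff rad T eps k z * gf del j (v z)) /\
  (\int[mu]_z (sg z * cutoff rad T eps k z * gf del j (v z))%:E <=
   \int[mu]_z (C * (T^-1 + (rad `^ m)^-1) *
     Num.sqrt (v z `^ p * (v z `^ q * gf del j (v z) * cutoff rad T eps k z)))%:E)%E.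
Proof.
have [C1 C10 ptw] := pointwise_absorption (N := N) del0 del1 hp hq m1 pq2 pqm jpq mk c00.
exists (C1 + 1); first by rewrite ltr_wpDl.
move=> v sg vt Dv F cl rad T eps r0 T0 e0 eT.
have [[mv msg mvt mDv mF] v0 [Lv Lsg Lvt] LDv LF cdx cdt coer weak] := cl.
pose C : set ST := stbox (rad + 1) (eps / 2) (T + 1).
have e20 : 0 < eps / 2 by rewrite divr_gt0.
have mC : measurable C by exact: measurable_stbox.
have mcut (f : ST -> R) : measurable_fun setT f -> measurable_fun setT (fun z => f z * \1_C z).
  by move=> mf; apply: measurable_funM => //; exact: measurable_indic.
set psi := cutoff rad T eps k; pose Dpsi := @dcutoff R N rad T eps k.
have psiC z : psi z != 0 -> C z.
  move=> /(cutoff_support r0 T0)[zx /andP[zt1 zt2]]; split.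
    by move=> i; apply: (le_trans (zx i)); rewrite lerDl.
  by apply/andP; split; lra.
have psi_out z : ~ C z -> psi z = 0.
  by move=> nC; apply/eqP; apply: contra_notT nC => /psiC.
have psi1 z : \1_C z * psi z = psi z.
  have [Cz|nC] := pselect (C z); first by rewrite indicE mem_set// mul1r.
  by rewrite psi_out// mulr0.
have [B B0 [gBL dgBL]] := gf_dgf_BL j del0 del1.
have [M M0 [psiM DpsiM DtpsiM]] := cutoff_bounds (N := N) k r0 T0 e0.
have mpsi : measurable_fun setT (psi : ST -> R) by exact: measurable_cutoff.
have mDpsi w : measurable_fun setT (fun z : ST => Dpsi (z : X) w) by exact: measurable_dcutoff.
pose u z := v z * \1_C z.
have u0 z : 0 <= u z by rewrite mulr_ge0.
have dH (s : R) : 0 <= s -> is_derive s (1 : R) (Hf del j) (gf del j s) by exact: is_derive_Hf.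
have HL := lip_of_derive dH gBL.1.
have H0 : Hf del j 0 = 0 by rewrite /Hf mul0r.
have Lu : L1 u by split; [exact: mcut|exact: Lv].
have LDvC i : L1 (fun z => Dv i z * \1_C z).
  by split; [exact: mcut|apply: (box_Lp_L1 (ltW m1)) => //; exact: LDv].
have m'1 : 1 <= m / (m - 1) by rewrite ler_pdivlMr ?subr_gt0// mul1r gerBl.
have LFC i : L1 (fun z => F i z * \1_C z).
  by split; [exact: mcut|apply: (box_Lp_L1 m'1) => //; exact: LF].
have pFD i : pairing (fun z => F i z * \1_C z) (fun z => Dv i z * \1_C z).
  by apply: (pairing_conjugate m1); [exact: mcut|exact: mcut|exact: LF|exact: LDv].
have LsgC : L1 (fun z => sg z * \1_C z) by split; [exact: mcut|exact: Lsg].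
have lamge : for_large (fun lam : R => 1 <= lam /\ 2 / eps <= lam).
  exists (1 + 2 / eps); first by rewrite ltr_wpDr// divr_ge0// ltW.
  have h : 0 <= 2 / eps by rewrite divr_ge0// ltW.
  by move=> lam hl; split; lra.
have dg (s : R) : 0 <= s -> is_derive s (1 : R) (gf del j) (dgf del j s) by exact: is_derive_gf.
have derx : for_large (fun lam => forall z, psi z != 0 -> forall i,
    dmollify lam u z (e_space R i) = mollify (molk lam) (fun z => Dv i z * \1_C z) z).
  have [l0 l00 hl] := lamge; exists l0 => // lam /hl[lam1 lame] z z0 i.
  have lam0 : 0 < lam by apply: lt_le_trans lam1.
  apply: (dmollify_weak lam0 mv (mDv i) (cdx i)); first exact: stbox_subset.
  by move=> w; apply: near_box lame _ => //; exact: (cutoff_support r0 T0 z0).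
have dert : for_large (fun lam => forall z, psi z != 0 ->
    dmollify lam u z (e_time R N) = mollify (molk lam) (fun z => vt z * \1_C z) z).
  have [l0 l00 hl] := lamge; exists l0 => // lam /hl[lam1 lame] z z0.
  have lam0 : 0 < lam by apply: lt_le_trans lam1.
  apply: (dmollify_weak lam0 mv mvt cdt); first exact: stbox_subset.
  by move=> w; apply: near_box lame _ => //; exact: (cutoff_support r0 T0 z0).
have weakC (phi : X -> R) : C1c setT phi -> (forall z, 0 <= phi z) ->
    [set z | phi z != 0] `<=` [set z | psi z != 0] ->
    \int[mu]_z (sg z * \1_C z * phi z) <=
    \int[mu]_z (vt z * \1_C z * phi z) -
    \int[mu]_z (\sum_(i < N) F i z * \1_C z * 'D_(e_space R i) phi z).
  move=> C1phi phi0 sub; apply: weak => // z /sub; exact: psiC.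
have g0 (s : R) : 0 <= s -> 0 <= gf del j s by exact: gf_ge0.
have LsgC2 : L1 (fun z => sg z * \1_C z * psi z * gf del j (u z)).
  have mg := measurable_lip_comp gBL.2 Lu.1 u0.
  by apply: (L1_bounded_mul (L1_bounded_mul LsgC mpsi psiM) mg) => z; exact: gBL.1.
have sgE : (fun z => sg z * \1_C z * psi z * gf del j (u z)) =
    (fun z => sg z * psi z * gf del j (v z)).
  apply/funext => z; rewrite -[sg z * _ * _]mulrA psi1.
  have [Cz|nC] := pselect (C z); first by rewrite /u indicE mem_set// mulr1.
  by rewrite psi_out// mulr0 !mul0r.
have ab : eps / 2 < T + 1 by lra.
have en := energy_inequality Lu u0 LsgC (conj (mcut _ mvt) (Lvt _ _ _ e20)) LDvC LFC pFD
  (is_C1_cutoff rad T eps k) (cutoff_ge0 rad T eps k) psiM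
  (conj mpsi (cutoff_L1 k r0 T0 e0)) mDpsi DpsiM DtpsiM
  (conj (mDpsi _) (dcutoff_L1 eps k r0 T0 _)) ab (cutoff_time_supp k r0 T0 e0)
  (fun z w => @dcutoff_eq0 R N rad T eps k z w)
  (compact_tsupport_cutoff r0 T0) B0 H0 dH dg (fun s s0 => dgf_continuous s0) g0 gBL dgBL
  weakC derx dert.
have mgu := measurable_lip_comp gBL.2 Lu.1 u0.
have mdgu := measurable_lip_comp dgBL.2 Lu.1 u0.
have LHu : L1 (fun z => Hf del j (u z)).
  have mHu := measurable_lip_comp HL Lu.1 u0; split => //.
  apply: (@le_lt_trans _ _ (\int[mu]_z (B * `|u z|)%:E)%E).
    apply: nnint_le => //; [exact: measurable_abs| |].
      by apply: measurable_funM => //; apply: measurable_abs; exact: Lu.1.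
    by move=> z; have := HL _ _ (u0 z) (lexx 0); rewrite H0 !subr0.
  rewrite nnintZ//; first by apply: lte_mul_pinfty => //; exact: Lu.2.
  by apply: measurable_abs; exact: Lu.1.
pose Zf z := Dpsi (z : X) (e_time R N) * Hf del j (u z).
pose Wf i z := F i z * \1_C z * Dpsi (z : X) (e_space R i) * gf del j (u z).
pose Yf i z := F i z * \1_C z * psi z * (dgf del j (u z) * (Dv i z * \1_C z)).
have LZ : L1 Zf.
  have -> : Zf = (fun z => Hf del j (u z) * Dpsi (z : X) (e_time R N)).
    by apply/funext => z; rewrite /Zf mulrC.
  exact: (L1_bounded_mul LHu (mDpsi (e_time R N)) DtpsiM).
have LW i : L1 (Wf i).
  apply: (L1_bounded_mul (L1_bounded_mul (LFC i) (mDpsi _) (fun z => DpsiM z i)) mgu) => z.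
  exact: gBL.1.
have LY i : L1 (Yf i).
  have LFD : L1 (fun z => (F i z * \1_C z) * (Dv i z * \1_C z)).
    split; first by apply: measurable_funM; exact: mcut.
    by apply: pairing_integrable (pFD i); exact: mcut.
  have -> : Yf i = (fun z => F i z * \1_C z * (Dv i z * \1_C z) * psi z * dgf del j (u z)).
    by apply/funext => z; rewrite /Yf; ring.
  exact: (L1_bounded_mul (L1_bounded_mul LFD mpsi psiM) mdgu (fun z => dgBL.1 _ (u0 z))).
pose P z := Zf z + (\sum_(i < N) Wf i z + \sum_(i < N) Yf i z).
have LS := L1D (L1_sum LW) (L1_sum LY).
have LP : L1 P := L1D LZ LS.
have PE : \int[mu]_z P z = \int[mu]_z Zf z + (\sum_(i < N) \int[mu]_z Wf i z + \sum_(i < N) \int[mu]_z Yf i z).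
  rewrite (RintegralD measurableT (L1_integrable LZ) (L1_integrable LS)); congr (_ + _).
  rewrite (RintegralD measurableT (L1_integrable (L1_sum LW)) (L1_integrable (L1_sum LY))).
  by congr (_ + _); apply: Rint_sum => i; exact: L1_integrable.
have NPE : \int[mu]_z (-1 * P z) = - \int[mu]_z P z.
  by rewrite (RintegralZl (-1) measurableT (L1_integrable LP)) mulN1r.
have LNP : L1 (fun z => -1 * P z).
  have [mP Poo] := LP; split; first exact: measurable_funM.
  rewrite (_ : (\int[mu]_z _)%E = (\int[mu]_z `|P z|%:E)%E)//.
  by apply: eq_integral => z _; rewrite mulN1r normrN.
have EFinR (f : ST -> R) : L1 f -> ((\int[mu]_z f z)%:E = \int[mu]_z (f z)%:E)%E.
  move=> [mf foo]; rewrite /Rintegral fineK//.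
  by apply: (integral_fin_num (f := fun z => (f z)%:E)).
have L1ext (f g : ST -> R) : f = g -> L1 f -> L1 g by move=> ->.
have LX := L1ext _ _ sgE LsgC2.
split; first exact: LX.
have RE : \int[mu]_z (sg z * psi z * gf del j (v z)) = \int[mu]_z (sg z * \1_C z * psi z * gf del j (u z)).
  rewrite /Rintegral; congr fine; apply: eq_integral => z _; congr EFin.
  exact: esym (congr1 (fun h : ST -> R => h z) sgE).
rewrite -(EFinR _ LX) RE.
apply: (@le_trans _ _ (\int[mu]_z (-1 * P z))%:E).
  rewrite lee_fin NPE PE.
  exact: le_rearrange en.
rewrite (EFinR _ LNP); apply: ae_le_integral; apply: filterS coer => z cz _.
rewrite lee_fin.
have [Cz|nC] := pselect (C z); last first.
  rewrite /P /Zf /Wf /Yf (psi_out _ nC) /Dpsi (dcutoff_eq0 _ (psi_out _ nC)) mul0r.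
  rewrite !big1 => [|i _|i _]; [|by rewrite mulr0 mul0r|by rewrite (dcutoff_eq0 _ (psi_out _ nC)) mulr0 mul0r].
  by rewrite !addr0 mulr0 !mulr_ge0 ?sqrtr_ge0 ?addr_ge0 ?invr_ge0 ?powR_ge0// ltW.
have Dz : D z := stbox_subset e20 Cz.
have := ptw rad T eps z (v z) _ _ r0 T0 e0 (v0 z) (cz Dz).
rewrite -/psi -/Dpsi => h.
have uE : u z = v z by rewrite /u indicE mem_set// mulr1.
apply: (@le_trans _ _ (C1 * (T^-1 + (rad `^ m)^-1) * Num.sqrt (v z `^ p * (v z `^ q * gf del j (v z) * psi z)))); last first.
  rewrite ler_wpM2r ?sqrtr_ge0// ler_wpM2r ?lerDl//.
  by rewrite addr_ge0 ?invr_ge0 ?powR_ge0// ltW.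
apply: le_trans h; rewrite le_eqVlt; apply/orP; left; apply/eqP.
rewrite /P mulN1r opprD opprD addrA /Zf uE; congr (_ - _ - _).
  by apply: eq_bigr => i _; rewrite /Wf uE indicE mem_set// mulr1 mxE.
by apply: eq_bigr => i _; rewrite /Yf uE indicE mem_set// !mulr1 !mxE.
Qed.

End energy_bound.

Section kernel_lower_bound.
Context {R : realType} {N : nat}.

Lemma kernel_near0 (K : 'rV[R]_N -> R) :
  (0 < limf_einf (EFin \o K) (dnbhs (0%R : 'rV[R]_N)))%E ->
  exists dl c : R, [/\ 0 < dl, 0 < c &
    forall z : 'rV[R]_N, z != 0 -> `|z| < dl -> c <= K z].
Proof.
rewrite limf_einfE => /ereal_sup_gt[_ [V V0 <-] Vpos].
have [dl /= dl0 hdl] : nbhs_ball (0 : 'rV[R]_N) [set z | z != 0 -> V z].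
  apply/nbhs_ballP; exact: V0.
have inV z : z != 0 -> `|z| < dl -> V z.
  by move=> z0 zdl; apply: hdl => //; rewrite /= -ball_normE/= sub0r normrN.
case E : (ereal_inf _) Vpos => [c| |] // Vpos.
  exists dl, c; split => // z z0 zdl; rewrite -lee_fin -E.
  by apply: ereal_inf_lbound; exists z => //; exact: inV.
exists dl, 1; split => // z z0 zdl; rewrite -lee_fin.
apply: (@le_trans _ _ +oo%E); first exact: leey.
by rewrite -E; apply: ereal_inf_lbound; exists z => //; exact: inV.
Qed.

Lemma enorm_le (z : 'rV[R]_N) (L : R) : 0 <= L -> (forall i, `|z ord0 i| <= L) ->
  enorm z <= N%:R * L.
Proof.
move=> L0 zL; have NL0 : 0 <= N%:R * L by rewrite mulr_ge0.
rewrite -[leRHS](ger0_norm NL0) -sqrtr_sqr ler_wsqrtr//.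
apply: (@le_trans _ _ (\sum_(i < N) L ^+ 2)).
  apply: ler_sum => i _; rewrite -expr2 -[leLHS]real_normK ?num_real//.
  by rewrite lerXn2r ?nnegrE.
rewrite sumr_const card_ord -[leLHS]mulr_natl exprMn ler_wpM2r ?sqr_ge0//.
by rewrite -natrX ler_nat -[leqLHS]muln1 expnS expn1; case: (N) => // n; rewrite leq_mul2l.
Qed.

(** Near the origin by the liminf, far away by the decay hypothesis, and in
    between by compactness. *)
Lemma kernel_lower_bound (beta : R) (K : 'rV[R]_N -> R) : 0 < beta ->
  admissible_kernel beta K -> exists2 c : R, 0 < c &
  forall (rad : R) (z : 'rV[R]_N), 1 <= rad -> z != 0 ->
    (forall i, `|z ord0 i| <= 2 * rad) -> c * rad `^ (- beta) <= K z.
Proof.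
move=> b0 [Kc K0 /kernel_near0[dl [c1 [dl0 c10 near0]]] [rho [c2 [rho0 c20 far]]]].
pose A : set 'rV[R]_N := [set z : 'rV[R]_N | (forall i, `[- rho, rho]%classic (z ord0 i)) /\ dl <= `|z|].
have cA : compact A.
  apply: (@subclosed_compact _ _ [set z : 'rV[R]_N | forall i, `[- rho, rho]%classic (z ord0 i)]).
  - apply: closedI.
      apply: compact_closed; first exact: norm_hausdorff.
      by apply: (@rV_compact R N (fun=> `[- rho, rho]%classic)) => i; exact: segment_compact.
    apply: (@closed_comp _ _ (fun z : 'rV[R]_N => `|z|) [set x | dl <= x]); last exact: closed_ge.
    by move=> z _; exact: norm_continuous.
  - by apply: (@rV_compact R N (fun=> `[- rho, rho]%classic)) => i; exact: segment_compact.
  - by move=> z [].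
have An0 z : A z -> z != 0.
  by move=> [_ dz]; apply: contraTneq dz => ->; rewrite normr0 -ltNge.
have [M M0 hM] : exists2 M, 0 < M & forall z, A z -> (K z)^-1 <= M.
  have /compact_bounded[M [_ hM]] : compact ((fun z => (K z)^-1) @` A).
    apply: continuous_compact => //; apply: continuous_in_subspaceT => z /set_mem Az.
    by apply: continuousV; [rewrite gt_eqF// K0// An0|exact: Kc (An0 _ Az)].
  exists (`|M| + 1); first by rewrite ltr_wpDl.
  move=> z Az; apply: (le_trans (ler_norm _)); apply: hM; last by exists z.
  by rewrite (le_lt_trans (ler_norm M)) ?ltrDl.
pose c := Num.min c1 (Num.min M^-1 (c2 * (N.+1%:R * 2) `^ (- beta))).
have n0 : 0 < N.+1%:R * 2 :> R by rewrite mulr_gt0.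
exists c; first by rewrite !lt_min c10 invr_gt0 M0 mulr_gt0// powR_gt0.
move=> rad z r1 z0 zr; have r0 : 0 < rad by apply: lt_le_trans r1.
have cE : [/\ c <= c1, c <= M^-1 & c <= c2 * (N.+1%:R * 2) `^ (- beta)].
  by rewrite /c !ge_min !lexx !orbT.
have c0 : 0 <= c by rewrite !le_min ltW//= invr_ge0 ltW//= mulr_ge0 ?powR_ge0// ltW.
have rb : rad `^ (- beta) <= 1.
  rewrite powRN invf_le1 ?powR_gt0// -[leLHS](powRr0 rad).
  by apply: ler_powR => //; exact: ltW.
have cr : c * rad `^ (- beta) <= c by rewrite ler_piMr.
have [c1E c2E c3E] := cE.
have [zf|zn] := ltP rho (enorm z).
  apply: le_trans (far z zf).
  apply: (@le_trans _ _ (c2 * (N.+1%:R * 2) `^ (- beta) * rad `^ (- beta))).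
    by rewrite ler_wpM2r ?powR_ge0.
  rewrite -mulrA ler_wpM2l ?(ltW c20)// -powRM ?(ltW n0) ?(ltW r0)//.
  have e0 : 0 < enorm z by apply: lt_trans zf.
  rewrite !powRN lef_pV2 ?posrE ?powR_gt0 ?mulr_gt0//.
  apply: le_powR_base; [exact: ltW|exact: ltW|].
  apply: (@le_trans _ _ (N%:R * (2 * rad))).
    by apply: enorm_le => //; rewrite mulr_ge0// ltW.
  by rewrite -mulrA ler_wpM2r ?ler_nat// mulr_ge0// ltW.
have [zd|zd] := ltP `|z| dl.
  by apply: (le_trans cr); apply: (le_trans c1E); exact: near0.
have Az : A z.
  split=> // i; rewrite /= in_itv/= -ler_norml (le_trans _ zn)//.
  exact: ler_enorm.
apply: (le_trans cr); apply: (le_trans c2E).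
by rewrite -[leRHS]invrK lef_pV2 ?posrE ?invr_gt0 ?K0// hM.
Qed.

End kernel_lower_bound.

Section integral_amgm.
Context d (T : measurableType d) {R : realType} (mu : {measure set T -> \bar R}).

Lemma sqrt_mul_le (x y eta : R) : 0 <= x -> 0 <= y -> 0 < eta ->
  Num.sqrt (x * y) <= eta * x + (4 * eta)^-1 * y.
Proof.
move=> x0 y0 e0.
have s0 : 0 <= eta * x + (4 * eta)^-1 * y.
  by rewrite addr_ge0// mulr_ge0 ?invr_ge0 ?mulr_ge0// ltW.
rewrite -[leRHS](ger0_norm s0) -sqrtr_sqr ler_wsqrtr//.
rewrite -subr_ge0 (_ : _ - _ = (eta * x - (4 * eta)^-1 * y) ^+ 2) ?sqr_ge0//.
by field; rewrite gt_eqF.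
Qed.

Lemma measurable_sqrt (f : T -> R) : measurable_fun setT f ->
  measurable_fun setT (fun z => Num.sqrt (f z)).
Proof.
by move=> mf; exact: (measurableT_comp (continuous_measurable_fun (@sqrt_continuous R)) mf).
Qed.

Lemma integral_null_ae (f : T -> R) : measurable_fun setT f -> (forall z, 0 <= f z) ->
  (\int[mu]_z (f z)%:E = 0)%E -> {ae mu, forall z, f z = 0}.
Proof.
move=> mf f0 I0; have mE := measurable_EFin_fun mf.
have /(ae_eq_integral_abs _ measurableT mE) : (\int[mu]_z `|(f z)%:E| = 0)%E.
  by rewrite -[RHS]I0; apply: eq_integral => z _; rewrite gee0_abs// lee_fin.
by apply: filterS => z /(_ Logic.I) /= [].
Qed.

(** The weight in the pointwise inequality is chosen as a multiple of the
    integral of [h], which makes the second term a constant. *)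
Lemma integral_sqrt_mul_le (f h : T -> R) (lam : R) : 0 < lam ->
  measurable_fun setT f -> measurable_fun setT h ->
  (forall z, 0 <= f z) -> (forall z, 0 <= h z) ->
  (\int[mu]_z (Num.sqrt (f z * h z))%:E <=
   lam%:E * (\int[mu]_z (f z)%:E * \int[mu]_z (h z)%:E) + ((4 * lam)^-1)%:E)%E.
Proof.
move=> lam0 mf mh f0 h0.
have If0 : (0 <= \int[mu]_z (f z)%:E)%E by apply: integral_ge0 => z _; rewrite lee_fin.
have Ih0 : (0 <= \int[mu]_z (h z)%:E)%E by apply: integral_ge0 => z _; rewrite lee_fin.
have lam4 : 0 < (4 * lam)^-1 by rewrite invr_gt0 mulr_gt0.
have zero : {ae mu, forall z, f z * h z = 0} ->
    (\int[mu]_z (Num.sqrt (f z * h z))%:E <=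
    lam%:E * (\int[mu]_z (f z)%:E * \int[mu]_z (h z)%:E) + ((4 * lam)^-1)%:E)%E.
  move=> fh; apply: (@le_trans _ _ 0%E).
    rewrite -(integral0 mu setT); apply: ae_le_integral.
    by apply: filterS fh => z -> _; rewrite sqrtr0.
  apply: adde_ge0; last by rewrite lee_fin ltW.
  by apply: mule_ge0; [rewrite lee_fin ltW|exact: mule_ge0].
have [V0|Vn0] := eqVneq (\int[mu]_z (h z)%:E)%E 0%E.
  apply: zero; apply: filterS (integral_null_ae mh h0 V0) => z ->.
  by rewrite mulr0.
have [W0|Wn0] := eqVneq (\int[mu]_z (f z)%:E)%E 0%E.
  apply: zero; apply: filterS (integral_null_ae mf f0 W0) => z ->.
  by rewrite mul0r.
have Vpos : (0 < \int[mu]_z (h z)%:E)%E by rewrite lt_neqAle eq_sym Vn0.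
have Wpos : (0 < \int[mu]_z (f z)%:E)%E by rewrite lt_neqAle eq_sym Wn0.
have [Voo|Vfin] := eqVneq (\int[mu]_z (h z)%:E)%E +oo%E.
  by rewrite Voo gt0_muley// gt0_muley ?lte_fin// addye ?leey.
have Vlt : (\int[mu]_z (h z)%:E < +oo)%E by rewrite ltey.
have [V V0 VE] := nnint_fine h0 Vlt.
have Vp : 0 < V by rewrite -lte_fin -VE.
pose eta := lam * V; have eta0 : 0 < eta by rewrite mulr_gt0.
apply: (@le_trans _ _ (\int[mu]_z (eta * f z)%:E + \int[mu]_z ((4 * eta)^-1 * h z)%:E)%E).
  apply: nnint_leD.
  - by apply: measurable_sqrt; exact: measurable_funM.
  - exact: measurable_funM.
  - exact: measurable_funM.
  - by move=> z; exact: sqrtr_ge0.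
  - by move=> z; rewrite mulr_ge0// ltW.
  - by move=> z; rewrite mulr_ge0// invr_ge0 mulr_ge0// ltW.
  - by move=> z; exact: sqrt_mul_le.
have e4 : 0 <= (4 * eta)^-1 by rewrite invr_ge0 mulr_ge0// ltW.
rewrite nnintZ ?(ltW eta0)// nnintZ// VE; apply: leeD.
  by rewrite [X in (_ <= _ * X)%E]muleC muleA -EFinM.
rewrite -EFinM lee_fin le_eqVlt; apply/orP; left; apply/eqP.
by rewrite /eta; field; rewrite !gt_eqF.
Qed.

End integral_amgm.

Section source_lower_bound.
Context {R : realType} {N : nat}.
Local Notation ST := ('rV[R]_N * measurableTypeR R)%type.
Local Notation X := ('rV[R]_N * R)%type.
Local Notation mu := (@spacetime_measure R N).
Local Notation leb := (lebesgue_rV R N).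
Local Notation D := (open_halfspace : set ST).

Lemma ae_of_time (P : R -> Prop) :
  {ae lebesgue_measure, forall t : measurableTypeR R, P t} ->
  {ae mu, forall z : ST, P z.2}.
Proof.
move=> [B [mB B0 PB]]; exists (setT `*` B); split.
- exact: measurableX.
- exact: spacetime_null_time.
- by move=> z /= nP; split => //; exact: PB.
Qed.

Definition cube (r : R) : set 'rV[R]_N := [set y | forall i, `|y ord0 i| <= r].

Lemma measurable_cube r : measurable (cube r).
Proof.
rewrite (_ : cube r = [set y | forall i, `[- r, r]%classic (y ord0 i)]).
  exact: (measurable_rV_box (A := fun=> `[- r, r]%classic)).
by apply/seteqP; split=> y yr i; have := yr i; rewrite /= in_itv/= ler_norml.
Qed.

Definition cube_mass (p : R) (v : ST -> R) (r t : R) : \bar R :=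
  (\int[leb]_y (v (y, t) `^ p * \1_(cube r) y)%:E)%E.

Lemma measurable_powR_slice (v : ST -> R) (p t : R) : measurable_fun setT v ->
  measurable_fun setT (fun y : 'rV[R]_N => v (y, t) `^ p).
Proof.
move=> mv; apply: (measurableT_comp (measurable_powR _)).
by apply: (measurableT_comp mv); exact: pair2_measurable.
Qed.

Lemma source_lower_bound (beta c p q : R) (K : 'rV[R]_N -> R) (u v sg : ST -> R) :
  (1 <= N)%N -> 0 < c -> (forall x : 'rV[R]_N, x != 0 -> 0 < K x) ->
  (forall (rad : R) (z : 'rV[R]_N), 1 <= rad -> z != 0 ->
    (forall i, `|z ord0 i| <= 2 * rad) -> c * rad `^ (- beta) <= K z) ->
  measurable_fun setT v -> 
  {ae mu, forall z : ST, D z -> u z = v z} ->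
  {ae mu, forall z : ST, D z -> (convolution K p u z * (u z `^ q)%:E)%E = (sg z)%:E} ->
  forall rad, 1 <= rad -> {ae mu, forall z : ST, D z -> cube rad z.1 ->
    ((c * rad `^ (- beta))%:E * (cube_mass p v rad z.2 * (v z `^ q)%:E) <= (sg z)%:E)%E}.
Proof.
move=> N1 c0 K0 Kc mv uv ssg rad r1.
have ut := ae_of_time (ae_slices uv).
have r0 : 0 <= rad := le_trans ler01 r1.
have kap0 : 0 <= c * rad `^ (- beta) by rewrite mulr_ge0 ?powR_ge0// ltW.
move: ut uv ssg; apply: filterS3 => z uvt uvz sgz Dz zr.
rewrite -sgz// uvz// muleA; apply: lee_wpmul2r; first by rewrite lee_fin powR_ge0.
rewrite /cube_mass -nnintZ//; first last.
- by move=> y; rewrite mulr_ge0// powR_ge0.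
- apply: measurable_funM; first exact: measurable_powR_slice.
  by apply: measurable_indic; exact: measurable_cube.
pose i0 := Ordinal N1.
have neq : {ae leb, forall y : 'rV[R]_N, y ord0 i0 <> z.1 ord0 i0}.
  exists [set y : 'rV[R]_N | y ord0 i0 = z.1 ord0 i0]; split.
  - rewrite (_ : mkset _ = (fun y : 'rV[R]_N => y ord0 i0) @^-1` [set z.1 ord0 i0])//.
    by rewrite -[X in measurable X]setTI; apply: measurable_coord.
  - exact: lebesgue_rV_hyperplane.
  - by move=> y /= /contrapT.
rewrite /convolution; apply: ae_le_integral; move: uvt neq; apply: filterS2 => y uvy yz _.
have uvE : u (y, z.2) = v (y, z.2) by exact: uvy.
have zy0 : z.1 - y != 0.
  by rewrite subr_eq0; apply/eqP => zy; apply: yz; rewrite zy.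
rewrite lee_fin uvE indicE; case: (boolP (_ \in _)) => [/set_mem yr|_]; last first.
  by rewrite !mulr0 mulr_ge0 ?powR_ge0// ltW// K0.
rewrite mulr1 ler_wpM2r ?powR_ge0//; apply: Kc => // i.
rewrite !mxE (le_trans (ler_normB _ _))//.
by have := yr i; have := zr i; lra.
Qed.

End source_lower_bound.

Lemma absorb_half (R : realFieldType) (kap y a : R) : 0 < kap ->
  kap * y <= kap / 2 * y + a / (2 * kap) -> y <= a / kap ^+ 2.
Proof.
move=> kap0 h; rewrite ler_pdivlMr ?exprn_gt0//.
have : kap / 2 * y <= a / (2 * kap) by lra.
rewrite ler_pdivlMr ?mulr_gt0// => h4; apply: le_trans h4.
by rewrite le_eqVlt; apply/orP; left; apply/eqP; field.
Qed.

Section interaction_decay.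
Context {R : realType} {N : nat}.
Local Notation ST := ('rV[R]_N * measurableTypeR R)%type.
Local Notation X := ('rV[R]_N * R)%type.
Local Notation mu := (@spacetime_measure R N).
Local Notation leb := (lebesgue_rV R N).
Local Notation D := (open_halfspace : set ST).

Variables (del p q m c0 : R) (j k : nat).
Hypotheses (del0 : 0 < del) (del1 : del <= 2^-1).
Hypotheses (hp : 0 < p) (hq : 0 < q) (m1 : 1 < m) (c00 : 0 < c0).
Hypotheses (pq2 : 2 < p + q) (pqm : (1 + del) * (2 * m - 2) <= p + q).
Hypothesis (jpq : p + q <= j.+2%:R).
Hypothesis (mk : m <= k.+1%:R).
Variables (v sg vt : ST -> R) (Dv F : 'I_N -> ST -> R).
Hypothesis cl : clean_solution m c0 v sg vt Dv F.
Variables (c beta : R).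
Hypothesis c_gt0 : 0 < c.
Hypothesis src : forall rad, 1 <= rad -> {ae mu, forall z : ST, D z -> cube rad z.1 ->
    ((c * rad `^ (- beta))%:E * (cube_mass p v rad z.2 * (v z `^ q)%:E) <= (sg z)%:E)%E}.

Definition weighted_mass (w : X -> R) (t : R) : \bar R :=
  (\int[leb]_x (v (x, t) `^ q * gf del j (v (x, t)) * w (x, t))%:E)%E.

Definition interaction (rad : R) (w : X -> R) : \bar R :=
  (\int[lebesgue_measure]_t (cube_mass p v rad t * weighted_mass w t))%E.

Let mv : measurable_fun setT v. Proof. by case: cl => -[]. Qed.
Let v0 z : 0 <= v z. Proof. by case: cl. Qed.

Lemma measurable_profile : measurable_fun setT (fun z => gf del j (v z)).
Proof.
have [B B0 [gBL _]] := gf_dgf_BL j del0 del1.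
exact: (measurable_lip_comp gBL.2 mv v0).
Qed.

Lemma measurable_mass_density (w : X -> R) : measurable_fun setT (w : ST -> R) ->
  measurable_fun setT (fun z : ST => v z `^ q * gf del j (v z) * w z).
Proof.
move=> mw; apply: measurable_funM => //; apply: measurable_funM.
  exact: (measurableT_comp (measurable_powR _) mv).
exact: measurable_profile.
Qed.

Lemma mass_density_ge0 (w : X -> R) z : 0 <= w z ->
  0 <= v z `^ q * gf del j (v z) * w z.
Proof. by move=> w0; rewrite !mulr_ge0 ?powR_ge0 ?gf_ge0. Qed.

Lemma measurable_cube_density rad :
  measurable_fun setT (fun z : ST => v z `^ p * \1_(cube rad) z.1).
Proof.
apply: measurable_funM; first exact: (measurableT_comp (measurable_powR _) mv).
apply: (measurableT_comp (measurable_indic _)); first exact: measurable_cube.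
exact: measurable_fst.
Qed.

Lemma cube_density_ge0 rad (z : ST) : 0 <= v z `^ p * \1_(cube rad) z.1.
Proof. by rewrite mulr_ge0 ?powR_ge0. Qed.

Lemma measurable_cube_mass rad :
  measurable_fun [set: measurableTypeR R] (cube_mass p v rad : measurableTypeR R -> \bar R).
Proof.
apply: (measurable_slice_integral (f := fun z => (v z `^ p * \1_(cube rad) z.1)%:E)).
  exact: (measurable_EFin_fun (measurable_cube_density rad)).
by move=> z; rewrite lee_fin cube_density_ge0.
Qed.

Lemma cube_mass_ge0 rad t : (0 <= cube_mass p v rad t)%E.
Proof. by apply: integral_ge0 => y _; rewrite lee_fin mulr_ge0 ?powR_ge0. Qed.

Section weight.
Variables (w : X -> R).
Hypotheses (mw : measurable_fun setT (w : ST -> R)) (w0 : forall z, 0 <= w z).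

Lemma measurable_weighted_mass :
  measurable_fun [set: measurableTypeR R] (weighted_mass w : measurableTypeR R -> \bar R).
Proof.
apply: (measurable_slice_integral (f := fun z => (v z `^ q * gf del j (v z) * w z)%:E)).
  exact: (measurable_EFin_fun (measurable_mass_density mw)).
by move=> z; rewrite lee_fin mass_density_ge0.
Qed.

Lemma weighted_mass_ge0 t : (0 <= weighted_mass w t)%E.
Proof. by apply: integral_ge0 => y _; rewrite lee_fin mass_density_ge0. Qed.

Lemma measurable_interaction rad : measurable_fun [set: measurableTypeR R]
  (fun t : measurableTypeR R => cube_mass p v rad t * weighted_mass w t)%E.
Proof.
apply: emeasurable_funM; first exact: measurable_cube_mass.
exact: measurable_weighted_mass.
Qed.

Lemma interaction_ge0 rad : (0 <= interaction rad w)%E.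
Proof.
by apply: integral_ge0 => t _; rewrite mule_ge0 ?cube_mass_ge0 ?weighted_mass_ge0.
Qed.

Lemma interaction_slices rad kap : 0 <= kap ->
  (\int[mu]_z (kap%:E * (cube_mass p v rad z.2 *
     (v z `^ q * gf del j (v z) * w z)%:E)) = kap%:E * interaction rad w)%E.
Proof.
move=> kap0.
have mz : measurable_fun setT (fun z : ST => kap%:E * (cube_mass p v rad z.2 *
     (v z `^ q * gf del j (v z) * w z)%:E))%E.
  apply: measurable_funeM; apply: emeasurable_funM.
    apply: (measurableT_comp (measurable_cube_mass rad)); exact: measurable_snd.
  exact: (measurable_EFin_fun (measurable_mass_density mw)).
rewrite integral_slices//; last first.
  move=> z; apply: mule_ge0; rewrite ?lee_fin//; apply: mule_ge0; first exact: cube_mass_ge0.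
  by rewrite lee_fin mass_density_ge0.
rewrite /interaction -ge0_integralZl//; first last.
- by move=> t _; rewrite mule_ge0 ?cube_mass_ge0 ?weighted_mass_ge0.
- exact: measurable_interaction.
apply: eq_integral => t _.
have ms : measurable_fun setT (fun x : 'rV[R]_N => (v (x, t) `^ q * gf del j (v (x, t)) * w (x, t))%:E).
  exact: (measurable_slice t (measurable_EFin_fun (measurable_mass_density mw))).
have s0 (x : 'rV[R]_N) : setT x -> (0 <= (v (x, t) `^ q * gf del j (v (x, t)) * w (x, t))%:E)%E.
  by move=> _; rewrite lee_fin mass_density_ge0.
transitivity (kap%:E * \int[leb]_x (cube_mass p v rad t * (v (x, t) `^ q * gf del j (v (x, t)) * w (x, t))%:E))%E.
  apply: ge0_integralZl => //; first by rewrite /=; exact: measurable_funeM.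
  by move=> x _; apply: mule_ge0; [exact: cube_mass_ge0|exact: s0].
congr (_ * _)%E; apply: ge0_integralZl => //; exact: cube_mass_ge0.
Qed.

End weight.

Lemma interaction_decay : exists2 Q : R, 0 <= Q &
  forall rad eps : R, 1 <= rad -> 0 < eps -> eps <= rad `^ m ->
  (interaction rad (cutoff rad (rad `^ m) eps k) <= (Q * rad `^ (2 * beta - m))%:E)%E.
Proof.
have [C C0 energy] := energy_bound (N := N) del0 del1 hp hq m1 c00 pq2 pqm jpq mk.
exists (4 * C ^+ 2 / c ^+ 2); first by rewrite divr_ge0 ?sqr_ge0// mulr_ge0 ?sqr_ge0.
move=> rad eps r1 e0 eT; have r0 : 0 < rad by apply: lt_le_trans r1.
set T := rad `^ m in eT *; have T0 : 0 < T by rewrite powR_gt0.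
have [[mX Xoo] ineq] := energy v sg vt Dv F cl rad T eps r0 T0 e0 eT.
set psi := cutoff rad T eps k in mX Xoo ineq *.
have mpsi : measurable_fun setT (psi : ST -> R) by exact: measurable_cutoff.
have psi0 z : 0 <= psi z by exact: cutoff_ge0.
have supp (z : ST) : psi z != 0 -> [/\ D z, cube rad z.1 & eps <= z.2 <= T].
  by move=> /(cutoff_support r0 T0)[zx zt]; split=> //; case/andP: zt => + _; exact: lt_le_trans.
have psiE (z : ST) : ~ cube rad z.1 -> psi z = 0.
  by move=> nz; apply/eqP; apply: contra_notT nz => /supp[].
pose kap := c * rad `^ (- beta); have kap0 : 0 < kap by rewrite mulr_gt0 ?powR_gt0.
pose h (z : ST) := v z `^ q * gf del j (v z) * psi z.
have mh : measurable_fun setT h by exact: measurable_mass_density.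
have h0 z : 0 <= h z by exact: mass_density_ge0.
set Y := interaction rad psi.
have Y0 : (0 <= Y)%E by exact: interaction_ge0.
pose Xint := (\int[mu]_z (sg z * psi z * gf del j (v z))%:E)%E.
have Xfin : Xint \is a fin_num by apply: (integral_fin_num (f := fun z => (sg z * psi z * gf del j (v z))%:E)).
have lower : (kap%:E * Y <= Xint)%E.
  rewrite -(interaction_slices mpsi psi0 rad (ltW kap0)); apply: ae_le_integral.
  apply: filterS (src r1) => z sz _.
  have [z0|/supp[Dz zr _]] := eqVneq (psi z) 0.
    by rewrite z0 !mulr0 mule0 mule0 mul0r.
  have gp0 : (0 <= (gf del j (v z) * psi z)%:E)%E by rewrite lee_fin mulr_ge0// gf_ge0.
  have := lee_wpmul2r gp0 (sz Dz zr); rewrite -muleA -muleA -EFinM -EFinM.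
  by rewrite mulrA (_ : sg z * (gf del j (v z) * psi z) = sg z * psi z * gf del j (v z))//; ring.
have mw := measurable_cube_density rad.
pose wd (z : ST) := v z `^ p * \1_(cube rad) z.1.
have wd0 z : 0 <= wd z by exact: cube_density_ge0.
have [e eE] : exists e : R, e = C * (T^-1 + T^-1) by eexists.
have e0' : 0 < e by rewrite eE mulr_gt0// addr_gt0// invr_gt0.
rewrite -eE in ineq.
have upper (lam : R) : 0 < lam ->
    (Xint <= e%:E * (lam%:E * Y + ((4 * lam)^-1 * T)%:E))%E.
  move=> lam0; apply: (le_trans ineq).
  have lam4 : 0 <= (4 * lam)^-1 by rewrite invr_ge0 mulr_ge0// ltW.
  have ms : measurable_fun setT (fun z => Num.sqrt (wd z * h z)).
    by apply: measurable_sqrt; exact: measurable_funM.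
  rewrite (_ : (\int[mu]_z _)%E = (\int[mu]_z (e * Num.sqrt (wd z * h z))%:E)%E); last first.
    apply: eq_integral => z _; congr (_ * Num.sqrt _)%:E.
    rewrite /h /wd indicE; case: (boolP (_ \in _)) => [_|/negP nz]; first by rewrite mulr1.
    by rewrite psiE ?mulr0// => zr; apply: nz; exact/mem_set.
  rewrite nnintZ// ?(ltW e0')//.
  apply: lee_wpmul2l; first by rewrite lee_fin ltW.
  rewrite (integral_slices (measurable_EFin_fun ms)); last by move=> z; rewrite lee_fin sqrtr_ge0.
  pose I : set (measurableTypeR R) := `[0, T]%classic.
  have mI : measurable I by exact: measurable_itv.
  apply: (@le_trans _ _ (\int[lebesgue_measure]_t
     (lam%:E * (cube_mass p v rad t * weighted_mass psi t) + ((4 * lam)^-1 * \1_I t)%:E))%E).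
    apply: ae_le_integral; apply: nearW => t _.
    have mf : measurable_fun setT (fun x : 'rV[R]_N => wd (x, t)).
      by apply: (measurableT_comp mw); exact: pair2_measurable.
    have mht : measurable_fun setT (fun x : 'rV[R]_N => h (x, t)).
      by apply: (measurableT_comp mh); exact: pair2_measurable.
    have [It|nIt] := pselect (I t).
      rewrite indicE mem_set// mulr1.
      exact: (integral_sqrt_mul_le leb lam0 mf mht (fun x => wd0 (x, t)) (fun x => h0 (x, t))).
    rewrite indicE memNset// mulr0 adde0 (_ : (\int[leb]_x _)%E = 0%E).
      by rewrite mule_ge0 ?lee_fin ?(ltW lam0)// mule_ge0 ?cube_mass_ge0 ?weighted_mass_ge0.
    rewrite -[RHS](integral0 leb setT); apply: eq_integral => x _.
    rewrite /h (_ : psi (x, t) = 0) ?mulr0 ?mulr0 ?sqrtr0//.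
    apply/eqP; apply: contra_notT nIt => /supp[_ _ /= /andP[t1 t2]].
    by rewrite /I /= in_itv/= t2 andbT (le_trans _ t1)// ltW.
  have mYf := measurable_interaction mpsi psi0 rad.
  have mIf : measurable_fun [set: measurableTypeR R] (fun t : measurableTypeR R => (4 * lam)^-1 * \1_I t).
    by apply: measurable_funM => //; exact: measurable_indic.
  rewrite ge0_integralD//; first last.
  - exact: (measurable_EFin_fun mIf).
  - by move=> t _; rewrite lee_fin mulr_ge0.
  - exact: measurable_funeM.
  - move=> t _; rewrite mule_ge0 ?lee_fin ?(ltW lam0)//.
    by rewrite mule_ge0 ?cube_mass_ge0 ?weighted_mass_ge0.
  rewrite ge0_integralZl//; first last.
  - by rewrite lee_fin ltW.
  - by move=> t _; rewrite mule_ge0 ?cube_mass_ge0 ?weighted_mass_ge0.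
  rewrite leeD2l// nnintZ//.
  rewrite EFinM lee_wpmul2l ?lee_fin// integral_indic// setIT.
  have mIE : lebesgue_measure I = T%:E.
    by rewrite lebesgue_measure_itv/= lte_fin T0 sube0.
  by rewrite -mIE; exact: lexx.
have Ylt : (Y < +oo)%E.
  rewrite ltey; apply/eqP => Yoo; move: lower.
  rewrite Yoo gt0_muley ?lte_fin// leye_eq => /eqP Xoo'.
  by move: Xfin; rewrite Xoo'.
have /fineK YE : Y \is a fin_num by rewrite ge0_fin_numE.
have XE := fineK Xfin.
set y := fine Y in YE; set x := fine Xint in XE.
rewrite -YE lee_fin.
have lowR : kap * y <= x by rewrite -lee_fin EFinM YE XE.
have upR : x <= e * (kap / (2 * e) * y + (4 * (kap / (2 * e)))^-1 * T).
  have l0 : 0 < kap / (2 * e) by rewrite divr_gt0// mulr_gt0.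
  have up := upper _ l0; rewrite -YE -XE in up.
  by rewrite -lee_fin EFinM EFinD (EFinM _ y).
have h2 : kap * y <= kap / 2 * y + e ^+ 2 * T / (2 * kap).
  apply: (le_trans lowR); apply: (le_trans upR); rewrite le_eqVlt; apply/orP; left; apply/eqP.
  by field; rewrite !gt_eqF.
have h3 : y <= e ^+ 2 * T / kap ^+ 2.
  exact: absorb_half kap0 h2.
apply: (le_trans h3); rewrite le_eqVlt; apply/orP; left; apply/eqP.
have -> : rad `^ (2 * beta - m) = (rad `^ (- beta))^-1 ^+ 2 * T^-1.
  rewrite powRD_gt0// powRN; congr (_ * _).
  by rewrite powRN invrK -powR_mulrn ?powR_ge0// -powRrM mulrC.
by rewrite eE /kap; field; rewrite !gt_eqF ?powR_gt0.
Qed.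

End interaction_decay.

Section vanishing.
Context {R : realType} {N : nat}.
Local Notation ST := ('rV[R]_N * measurableTypeR R)%type.
Local Notation X := ('rV[R]_N * R)%type.
Local Notation mu := (@spacetime_measure R N).
Local Notation leb := (lebesgue_rV R N).
Local Notation D := (open_halfspace : set ST).

Lemma ereal_le0_of_multiples (x : \bar R) (low Q : R) : 0 < low -> 0 <= Q ->
  (0 <= x)%E -> (forall e : R, 0 < e -> (low%:E * x <= (Q * e)%:E)%E) -> x = 0%E.
Proof.
move=> l0 Q0 x0 hx; apply/eqP; rewrite eq_le x0 andbT.
apply/lee_addgt0Pr => e e0; rewrite add0e.
have Q1 : 0 < Q + 1 by rewrite ltr_wpDl.
have h := hx (low * e / (Q + 1)) (divr_gt0 (mulr_gt0 l0 e0) Q1).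
rewrite -(@lee_pmul2l _ low%:E) ?lte_fin//; apply: (le_trans h).
rewrite -EFinM lee_fin (_ : Q * _ = low * e * (Q / (Q + 1))); last by ring.
rewrite ler_piMr ?mulr_ge0 ?(ltW l0) ?(ltW e0)//.
by rewrite ler_pdivrMr// mul1r lerDl.
Qed.

Variables (del p q m c0 : R) (j k : nat).
Hypotheses (del0 : 0 < del) (del1 : del <= 2^-1).
Hypotheses (hp : 0 < p) (hq : 0 < q) (m1 : 1 < m) (c00 : 0 < c0).
Hypotheses (pq2 : 2 < p + q) (pqm : (1 + del) * (2 * m - 2) <= p + q).
Hypothesis (jpq : p + q <= j.+2%:R).
Hypothesis (mk : m <= k.+1%:R).
Variables (v sg vt : ST -> R) (Dv F : 'I_N -> ST -> R).
Hypothesis cl : clean_solution m c0 v sg vt Dv F.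
Variables (c beta : R).
Hypotheses (c_gt0 : 0 < c) (bm : 2 * beta < m).
Hypothesis src : forall rad, 1 <= rad -> {ae mu, forall z : ST, D z -> cube rad z.1 ->
    ((c * rad `^ (- beta))%:E * (cube_mass p v rad z.2 * (v z `^ q)%:E) <= (sg z)%:E)%E}.

Let mv : measurable_fun setT v. Proof. by case: cl => -[]. Qed.
Let v0 z : 0 <= v z. Proof. by case: cl. Qed.

Lemma large_radius (r0 eps t0 e : R) : (1 <= N)%N -> 0 <= r0 -> 0 < eps -> 0 <= t0 -> 0 < e ->
  exists rad : R, [/\ 1 <= rad, r0 <= rad, N%:R * r0 ^+ 2 <= rad ^+ 2 / 2 &
    [/\ eps <= rad `^ m, t0 <= rad `^ m / 2 & rad `^ (2 * beta - m) <= e]].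
Proof.
move=> N1 r00 e0 t00 ee0; pose s := m - 2 * beta; have s0 : 0 < s by rewrite subr_gt0.
have es : 0 < e `^ (- s^-1) by rewrite powR_gt0.
have n1 : 1 <= N%:R :> R by rewrite ler1n.
have nr : r0 <= N%:R * r0 by rewrite ler_peMl.
pose rad := 1 + 2 * (N%:R * r0) + 2 * t0 + eps + e `^ (- s^-1).
have [h1 h2 h3 h4] : [/\ 1 <= rad, 2 * (N%:R * r0) <= rad, 2 * t0 <= rad & eps <= rad].
  by rewrite /rad; split; lra.
have h5 : e `^ (- s^-1) <= rad by rewrite /rad; lra.
have rad0 : 0 < rad by apply: lt_le_trans h1.
have radm : rad <= rad `^ m.
  by rewrite -[leLHS](powRr1 (ltW rad0)) ler_powR// ltW.
exists rad; split => //; [lra| |split; [lra|lra|]].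
  rewrite ler_pdivlMr//; apply: (@le_trans _ _ ((2 * (N%:R * r0)) ^+ 2)).
    rewrite !exprMn; apply: (@le_trans _ _ (2 ^+ 2 * (N%:R * r0 ^+ 2))).
      by have := mulr_ge0 (ler0n R N) (sqr_ge0 r0); lra.
    by rewrite ler_wpM2l// ler_wpM2r ?sqr_ge0// expr2 ler_peMl.
  by rewrite lerXn2r ?nnegrE ?mulr_ge0 ?(ltW rad0).
have -> : 2 * beta - m = - s by rewrite /s opprB.
rewrite powRN -[leRHS]invrK lef_pV2 ?posrE ?powR_gt0 ?invr_gt0//.
have -> : e^-1 = (e `^ (- s^-1)) `^ s.
  by rewrite -powRrM mulNr mulVf ?gt_eqF// powR_inv1// ltW.
by apply: le_powR_base => //; exact: ltW.
Qed.

Lemma vanishing_on_boxes (r0 eps t0 : R) : (1 <= N)%N -> 0 <= r0 -> 0 < eps -> 0 <= t0 ->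
  mu [set z : ST | stbox r0 (2 * eps) t0 (z : X) /\ v z <> 0] = 0%E.
Proof.
move=> N1 r00 e0 t00.
have [Q Q0 decay] := interaction_decay del0 del1 hp hq m1 c00 pq2 pqm jpq mk cl c_gt0 src.
pose w (z : X) : R := \1_(stbox r0 (2 * eps) t0 : set ST) z.
have mw : measurable_fun setT (w : ST -> R) by apply: measurable_indic; exact: measurable_stbox.
have w0 z : 0 <= w z by [].
pose low := 4^-1 ^+ k.+1 * ((1 - inv1 (eps ^+ 2)) * 4^-1 ^+ k.+1) : R.
have low0 : 0 < low.
  have q0 : 0 < 4^-1 ^+ k.+1 :> R by rewrite exprn_gt0// invr_gt0.
  rewrite mulr_gt0// mulr_gt0// subr_gt0 /inv1 invf_lt1 ?ltrDl ?exprn_gt0//.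
  by rewrite ltr_wpDr// sqr_ge0.
pose Z := (\int[lebesgue_measure]_t (cube_mass p v r0 t * weighted_mass del q j v w t))%E.
have Z0 : Z = 0%E.
  apply: (ereal_le0_of_multiples low0 Q0) => [|e ee0].
    exact: (interaction_ge0 p q j del0 cl w0 r0).
  have [rad [r1 rr Nr [eT tT re]]] := large_radius N1 r00 e0 t00 ee0.
  have rad0 : 0 < rad by apply: lt_le_trans r1.
  have T0 : 0 < rad `^ m by rewrite powR_gt0.
  apply: (@le_trans _ _ (Q * rad `^ (2 * beta - m))%:E); last by rewrite lee_fin ler_wpM2l.
  apply: le_trans (decay rad eps r1 e0 eT).
  rewrite /Z -ge0_integralZl//; first last.
  - by rewrite lee_fin ltW.
  - by move=> t _; rewrite mule_ge0 ?cube_mass_ge0 ?(weighted_mass_ge0 q j del0 cl w0).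
  - exact: (measurable_interaction p q j del0 del1 cl mw w0).
  apply: ae_le_integral; apply: nearW => t _.
  rewrite muleCA; apply: lee_pmul.
  - exact: cube_mass_ge0.
  - by rewrite mule_ge0 ?lee_fin ?(ltW low0)// (weighted_mass_ge0 q j del0 cl w0).
  - apply: nnint_le.
    + by apply: measurable_funM; [exact: measurable_powR_slice|apply: measurable_indic; exact: measurable_cube].
    + by apply: measurable_funM; [exact: measurable_powR_slice|apply: measurable_indic; exact: measurable_cube].
    + by move=> y; rewrite mulr_ge0 ?powR_ge0.
    + move=> y; rewrite ler_wpM2l ?powR_ge0// !indicE.
      case: (boolP (y \in cube r0)) => [/set_mem yr|]//; rewrite mem_set//.
      by move=> i; apply: le_trans rr.
  - rewrite /weighted_mass -nnintZ ?(ltW low0)//; first last.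
    + by move=> x; apply: (mass_density_ge0 q j del0 cl).
    + by apply: (measurableT_comp (measurable_mass_density q j del0 del1 cl mw)); exact: pair2_measurable.
    apply: ae_le_integral; apply: nearW => x _; rewrite lee_fin mulrCA ler_wpM2l//.
      by rewrite mulr_ge0 ?powR_ge0// gf_ge0.
    rewrite /w indicE; case: (boolP (_ \in _)) => [/set_mem[zx /andP[zt1 zt2]]|_]; last first.
      by rewrite mulr0 cutoff_ge0.
    rewrite mulr1; apply: cutoff_low => //; first exact: ltW.
    + by rewrite -mulr2n -mulr_natl.
    + exact: le_trans tT.
    + apply: le_trans Nr; rewrite /dot (@le_trans _ _ (\sum_(i < N) r0 ^+ 2))//.
        apply: ler_sum => i _; rewrite -expr2 -[leLHS]real_normK ?num_real//.
        by rewrite lerXn2r ?nnegrE.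
      by rewrite sumr_const card_ord mulr_natl.
have mE : measurable [set z : ST | stbox r0 (2 * eps) t0 (z : X) /\ v z <> 0].
  have mV : measurable (v @^-1` (~` [set 0])).
    by rewrite -[X in measurable X]setTI; apply: mv => //; exact: measurableC.
  exact: measurableI (measurable_stbox r0 (2 * eps) t0) mV.
apply: (slices_null mE).
have mZ := measurable_interaction p q j del0 del1 cl mw w0 r0.
have /(ae_eq_integral_abs _ measurableT mZ) : (\int[lebesgue_measure]_t `|cube_mass p v r0 t * weighted_mass del q j v w t| = 0)%E.
  rewrite -[RHS]Z0; apply: eq_integral => t _.
  by rewrite gee0_abs// mule_ge0 ?cube_mass_ge0 ?(weighted_mass_ge0 q j del0 cl w0).
apply: filterS => t /(_ Logic.I) /= /eqP; rewrite mule_eq0 => /orP[] /eqP I0.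
  have : {ae leb, forall y : 'rV[R]_N, v (y, t) `^ p * \1_(cube r0) y = 0}.
    apply: integral_null_ae I0.
    - by apply: measurable_funM; [exact: measurable_powR_slice|apply: measurable_indic; exact: measurable_cube].
    - by move=> y; rewrite mulr_ge0 ?powR_ge0.
  apply: filterS => y h [[yr _] nv]; move: h; rewrite indicE mem_set// mulr1 => /eqP.
  by rewrite powR_eq0 => /andP[/eqP].
have : {ae leb, forall y : 'rV[R]_N, v (y, t) `^ q * gf del j (v (y, t)) * w (y, t) = 0}.
  apply: integral_null_ae I0.
  - by apply: (measurableT_comp (measurable_mass_density q j del0 del1 cl mw)); exact: pair2_measurable.
  - by move=> y; apply: (mass_density_ge0 q j del0 cl).
apply: filterS => y h [yC nv]; move: h; rewrite /w indicE mem_set// mulr1 => /eqP.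
have vp : 0 < v (y, t) by rewrite lt_neqAle v0 andbT eq_sym; apply/eqP.
by rewrite mulf_eq0 powR_eq0 !gt_eqF// gf_gt0.
Qed.

End vanishing.

Section nonexistence.
Context {R : realType} {N : nat}.
Local Notation ST := ('rV[R]_N * measurableTypeR R)%type.
Local Notation X := ('rV[R]_N * R)%type.
Local Notation mu := (@spacetime_measure R N).
Local Notation D := (open_halfspace : set ST).

Lemma profile_parameters (p q m : R) : 0 < p -> 0 < q -> 1 < m ->
  2 * Num.max 1 (m - 1) < p + q ->
  exists (del : R) (j k : nat), [/\ 0 < del, del <= 2^-1,
    (1 + del) * (2 * m - 2) <= p + q, p + q <= j.+2%:R & m <= k.+1%:R].
Proof.
move=> p0 q0 m1 pq.
have pqm : 2 * m - 2 < p + q.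
  have : m - 1 <= Num.max 1 (m - 1) by rewrite le_max lexx orbT.
  by move: pq; lra.
have m2 : 0 < 2 * m - 2 by lra.
pose del := Num.min 2^-1 ((p + q) / (2 * m - 2) - 1).
have [j hj] := archi_boundP_ge (p + q); have [k hk] := archi_boundP_ge m.
exists del, j, k; split.
- by rewrite lt_min invr_gt0 ltr0n/= subr_gt0 ltr_pdivlMr// mul1r.
- by rewrite ge_min lexx.
- rewrite -ler_pdivlMr// -lerBrDl.
  by rewrite ge_min lexx orbT.
- by apply: (le_trans hj); rewrite ler_nat ltnW// ltnW.
- by apply: (le_trans hk); rewrite ler_nat ltnW.
Qed.

Lemma halfspace_boxes (z : ST) : D z ->
  exists n : nat, stbox n%:R (2 * n.+1%:R^-1) n%:R (z : X).
Proof.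
move=> Dz; have z0 : 0 < z.2 := Dz.
have [n hn] := archi_boundP_ge (`|z : X| + 2 * (z.2 : R)^-1).
have iz : 0 <= 2 * (z.2 : R)^-1 by rewrite mulr_ge0// invr_ge0 ltW.
exists n; split.
  by move=> i; apply: (le_trans (ler_norm_space z i)); apply: le_trans hn; rewrite lerDl.
apply/andP; split; last first.
  apply: le_trans hn; apply: (le_trans (ler_norm _)); apply: (le_trans (ler_norm_time z)).
  by rewrite lerDl.
rewrite ler_pdivrMr ?ltr0n// -ler_pdivrMl//.
rewrite mulrC; apply: (@le_trans _ _ n%:R); last by rewrite ler_nat.
by apply: le_trans hn; rewrite lerDr.
Qed.

Lemma weak_solution_trivial (p q m beta : R) : (1 <= N)%N -> 0 < p -> 0 < q ->
  forall (A : 'rV[R]_N -> R -> 'rV[R]_N -> 'rV[R]_N) (K : 'rV[R]_N -> R)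
    (u0 : 'rV[R]_N -> R) (u : X -> R),
  weakly_coercive m A -> admissible_kernel beta K -> 0 < beta < m / 2 ->
  2 * Num.max 1 (m - 1) < p + q -> weak_solution A m K p q u0 u ->
  {ae mu, forall z : ST, D z -> u z = 0}.
Proof.
move=> N1 p0 q0 A K u0 u hA hK /andP[b0 bm] pq sol.
have m1 := wc_exponent hA.
have [c0 [v [sg [vt [Dv [F [c00 cl uv ssg]]]]]]] := clean_solution_exists hA sol.
have [c c_gt0 Kc] := kernel_lower_bound b0 hK.
have mv : measurable_fun setT v by case: cl => -[].
have src := source_lower_bound N1 c_gt0 (kernel_gt0 hK) Kc mv uv ssg.
have [del [j [k [del0 del1 pqm jpq mk]]]] := profile_parameters p0 q0 m1 pq.
have pq2 : 2 < p + q.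
  have : 1 <= Num.max 1 (m - 1) by rewrite le_max lexx.
  by move: pq; lra.
have bm2 : 2 * beta < m by move: bm; lra.
have vn (n : nat) : {ae mu, forall z : ST, stbox n%:R (2 * n.+1%:R^-1) n%:R (z : X) -> v z = 0}.
  exists [set z : ST | stbox n%:R (2 * n.+1%:R^-1) n%:R (z : X) /\ v z <> 0]; split.
  - have mV : measurable (v @^-1` (~` [set 0])).
      by rewrite -[X in measurable X]setTI; apply: mv => //; exact: measurableC.
    exact: measurableI (measurable_stbox _ _ _) mV.
  - apply: (vanishing_on_boxes del0 del1 p0 q0 m1 c00 pq2 pqm jpq mk cl c_gt0 bm2 src) => //.
  - by move=> z /= /not_implyP.
have /ae_foralln := vn => vN.
move: uv vN; apply: filterS2 => z uvz vz Dz.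
by have [n nz] := halfspace_boxes Dz; rewrite uvz// (vz n).
Qed.

End nonexistence.

Theorem theorem1p5 (R : realType) (N : nat) (hN : (1 <= N)%N)
    (p q m beta d : R) (hp : 0 < p) (hq : 0 < q)
    (A : 'rV[R]_N -> R -> 'rV[R]_N -> 'rV[R]_N) (hA : weakly_coercive m A)
    (K : 'rV[R]_N -> R) (hK : admissible_kernel beta K)
    (u0 : 'rV[R]_N -> R) (hu0 : L1loc_space u0)
    (hu0_ge0 : {ae lebesgue_rV R N, forall x, 0 <= u0 x})
    (hbeta : 0 < beta < m / 2)
    (hpq : 2 * Num.max 1 (m - 1) < p + q)
    (hd : 0 < d)
    (hGamma : 2 < Gamma p q m d < (2 * N%:R + m) / (N%:R + beta)) :
  ~ exists u : 'rV[R]_N * R -> R,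
      [/\ weak_solution A m K p q u0 u,
          L1loc closed_halfspace
            (fun z => (convolution K p u z * (u z `^ (q + d))%:E)%E) &
          ~ {ae spacetime_measure (N := N),
               forall z, open_halfspace z -> u z = 0}].
Proof.
move=> [u [sol _]]; apply.
exact: weak_solution_trivial hN hp hq A K u0 u hA hK hbeta hpq sol.
Qed.
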